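(* Let $u\in C^1(\mathbb{R}^2,\mathbb{R}^2)$ be an entire weak solution of the stationary Navier–Stokes equations in the plane, i.e. $\operatorname{div}u=0$ in $\mathbb{R}^2$ and $$\int_{\mathbb{R}^2}Du:D\varphi\,dx-\int_{\mathbb{R}^2}u^ku^i\,\partial_k\varphi^i\,dx=0$$ for all $\varphi\in C_0^\infty(\mathbb{R}^2,\mathbb{R}^2)$ with $\operatorname{div}\varphi=0$. Suppose that $u\in L^p(\mathbb{R}^2,\mathbb{R}^2)$ for some $p>1$. Then $u$ must be the zero vector.
   Context: Repeated indices are summed over $1,2$; $:$ is the scalar product of $2\times2$ matrices. *)

(* Defs.v *)
From HB Require Import structures.
From mathcomp Require Import all_boot all_order all_algebra.
From mathcomp Require Import all_classical all_reals all_analysis.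
Import Order.TTheory GRing.Theory Num.Theory.
Import numFieldNormedType.Exports.

Set Implicit Arguments.
Unset Strict Implicit.
Unset Printing Implicit Defensive.

Local Open Scope classical_set_scope.
Local Open Scope ring_scope.

(* The plane is R * R with the product topology. The norm that the library puts
   on R * R is the max norm, hence the separate Euclidean norm [enorm] below. *)

Definition lebesgue2 (R : realType) :
    {measure set (measurableTypeR R * measurableTypeR R) -> \bar R} :=
  (@lebesgue_measure R \x @lebesgue_measure R)%E.

Definition coord (R : realType) (i : 'I_2) (x : R * R) : R :=
  if i == ord0 then x.1 else x.2.

Definition basis_vec (R : realType) (i : 'I_2) : R * R :=
  if i == ord0 then (1, 0) else (0, 1).

Definition enorm (R : realType) (x : R * R) : R :=
  Num.sqrt (\sum_(i < 2) coord i x ^+ 2).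

Definition pd (R : realType) (W : normedModType R) (k : 'I_2)
    (f : R * R -> W) : R * R -> W := 'D_(basis_vec R k) f.

Fixpoint Cn (R : realType) (W : normedModType R) (n : nat)
    (f : R * R -> W) : Prop :=
  if n is m.+1 then
    (forall x, differentiable f x) /\ (forall k, Cn m (pd k f))
  else continuous f.

Definition Cinfty (R : realType) (W : normedModType R) (f : R * R -> W) : Prop :=
  forall n, Cn n f.

Definition compact_support (R : realType) (W : normedModType R)
    (f : R * R -> W) : Prop :=
  compact (closure [set x | f x != 0]).

(* The scalar field \partial_k u^i. *)
Definition Dcomp (R : realType) (k i : 'I_2) (u : R * R -> R * R) : R * R -> R :=
  pd k (fun x => coord i (u x)).

Definition div_free (R : realType) (u : R * R -> R * R) : Prop :=
  forall x, \sum_(i < 2) Dcomp i i u x = 0.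

(* For u of class C^1 and f smooth with compact support, both integrands are
   continuous with compact support, so the real-valued integrals are genuine. *)
Definition NS_weak_solution (R : realType) (u : R * R -> R * R) : Prop :=
  div_free u /\
  forall f : R * R -> R * R, Cinfty f -> compact_support f -> div_free f ->
    \int[lebesgue2 R]_x (\sum_(i < 2) \sum_(k < 2) Dcomp k i u x * Dcomp k i f x)
    - \int[lebesgue2 R]_x
        (\sum_(k < 2) \sum_(i < 2) coord k (u x) * coord i (u x) * Dcomp k i f x)
    = 0.

Definition in_Lp (R : realType) (p : R) (u : R * R -> R * R) : Prop :=
  measurable_fun [set: measurableTypeR R * measurableTypeR R]
    (u : _ -> measurableTypeR R * measurableTypeR R) /\
  (fun x => enorm (u x)) \in Lfun (lebesgue2 R) p%:E.

(* Main.v *)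
(* The vorticity [w] of the flow satisfies [Lap w = div (w v)]. Test this equation with
   [theta^m w] on a large square of half-width [L], where the weight [theta] vanishes on the
   boundary: the integral [D] of [theta^m |grad w|^2] is bounded by terms of order
   [W / L^2] and [X / L], where [W] and [X] are weighted integrals of [|grad v|^2] and
   [|v| w^2]. The hypothesis [v \in L^p] enters only through truncation: for
   [q = 1 + 1/(n+1) <= p] and every [delta > 0] the function [(|v| - delta)_+ ^ q] is
   integrable over the plane. Two-dimensional interpolation inequalities between [D], [W],
   [X], the integral of [|v|^2] and those of two auxiliary quantities form a closed system,
   from which [D <= K delta^4] on all sufficiently large squares. As [delta] is arbitrary,
   [grad w = 0]; then [v] is harmonic, the same inequalities give [W <= K delta^2], so [v]
   is constant, and a constant in [L^p] is zero.

   Since [u] is only of class C^1, the argument is run on mollifications of [u]: the weak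
   equation tested with the rotated gradients of translated mollifiers is exactly the
   vorticity equation for them, with [w v] replaced by its mollification, and on a fixed
   square the error this causes tends to zero with the width of the mollifier. *)

Require Import Defs.
From HB Require Import structures.
From mathcomp Require Import all_boot all_order all_algebra.
From mathcomp Require Import all_classical all_reals all_analysis.
From mathcomp Require Import measurable_realfun zify ring lra.
Import Order.TTheory GRing.Theory Num.Theory.
Import numFieldNormedType.Exports.

Set Implicit Arguments.
Unset Strict Implicit.
Unset Printing Implicit Defensive.

Local Open Scope classical_set_scope.
Local Open Scope ring_scope.

(** * The numerical bootstrap *)

(** The bound [A] on the truncated mass may grow without control as [delta] decreases, so
    [D <= K delta^4] is useful only if [K] does not depend on [A]. This shapes the bootstrap: [A]
    may enter the threshold for [L] and the terms that decay with [L], but no leading term. The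
    truncation makes this separation possible: velocities below a multiple of [delta] cost at most a
    multiple of [delta^2] times the area, and the others are charged to [A]. The natural unknowns
    are [d] and [z] with [d^4 = D] and [z^4 = W / L]. Up to terms of order [L^(-1/4)] and constant
    factors, the system says that [z^4] is at most [delta d^2] and [d^4] at most
    [delta z^4 + delta^4], whence [d^2] is at most of order [delta^2]. This bounds only [W / L],
    which gives nothing for [grad v] on a fixed square; the factor [L] disappears only in a second
    pass, run with [D] exactly zero. *)

Ltac nonneg := first [assumption | lazymatch goal with
  | |- is_true (0 <= _ * _)%R => apply: mulr_ge0; nonneg
  | |- is_true (0 <= _ + _)%R => apply: addr_ge0; nonneg
  | |- is_true (0 <= _ ^+ 2)%R => exact: sqr_ge0
  | |- is_true (0 <= _ ^+ _)%R => apply: exprn_ge0; nonneg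
  | |- is_true (0 <= _^-1)%R => rewrite invr_ge0; nonneg
  | |- is_true (0 <= `|_|)%R => exact: normr_ge0
  | |- is_true (0 <= _%:R)%R => exact: ler0n
  | |- is_true (0 <= 1)%R => exact: ler01
  | |- is_true (0 <= _)%R => first [exact: ltW | lra]
  end].

Section YoungOptimization.
Context {R : realType}.
Implicit Types (b c d x y z C D W V X Y T E L A K : R).

(** The optimal choice is [r = c / b]. When [b] or [c] vanishes the bound 0 is only approached, as
    [r] tends to infinity or to zero, hence the slack [e]. *)
Lemma young_opt b c x : 0 <= b -> 0 <= c ->
  (forall r, 0 < r -> x <= r * b ^+ 2 + c ^+ 2 / r) -> x <= 2 * b * c.
Proof.
move=> b0 c0 H; apply/ler_addgt0Pr => e e0.
have [b00|bn0] := eqVneq b 0.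
  have r0 : 0 < (c ^+ 2 + 1) / e by rewrite divr_gt0// ltr_wpDl// sqr_ge0.
  apply: le_trans (H _ r0) _; rewrite b00 expr0n mulr0 add0r mulr0 mul0r add0r.
  rewrite invf_div mulrA ler_pdivrMr; first by nra.
  by rewrite ltr_wpDl// sqr_ge0.
have bp : 0 < b by rewrite lt_neqAle eq_sym bn0.
have [c00|cn0] := eqVneq c 0.
  have r0 : 0 < e / b ^+ 2 by rewrite divr_gt0// exprn_gt0.
  apply: le_trans (H _ r0) _; rewrite c00 expr0n mul0r addr0 mulr0 add0r.
  by rewrite mulfVK// sqrf_eq0.
have cp : 0 < c by rewrite lt_neqAle eq_sym cn0.
apply: le_trans (H (c / b) _) _; first exact: divr_gt0.
rewrite (_ : c / b * b ^+ 2 + c ^+ 2 / (c / b) = 2 * b * c) ?lerDl ?ltW//.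
by field; rewrite bn0 cn0.
Qed.

(* The rescaled system: [z ^+ 4] is [W / L], [d ^+ 4] is [D], and [e] is of order
   [L ^- 1/4]. *)
Lemma rescaled_bootstrap c delta : 1 <= c -> 0 < delta <= 1 ->
  exists2 e0, 0 < e0 & forall e d z, 0 <= e <= e0 -> delta <= d -> 0 <= z ->
    z ^+ 4 <= c * delta * d ^+ 2 + e * (d ^+ 2 * (z + 1) + z ^+ 2) ->
    d ^+ 4 <= c * delta * z ^+ 4 + e * ((z + 1) * (d ^+ 2 * z ^+ 2 + z ^+ 4)) +
      delta ^+ 4 / 4 ->
    d ^+ 2 <= (2 * c ^+ 2 + 1) * delta ^+ 2.
Proof.
move=> c1 /andP[de0 de1].
pose q := delta ^- 2.
have q1 : 1 <= q by rewrite /q invf_ge1 ?exprn_gt0// expr_le1// ltW.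
(* [M] bounds [z ^+ 3 / d ^+ 2], and [M2] collects the coefficients of [e * d ^+ 4] once all error
   terms are expressed through [d ^+ 4]. The choice of [e0] lets half of [d ^+ 4] absorb them. *)
pose M := 2 * c + 4 + q.
have M1 : 1 <= M by rewrite /M; lra.
pose M2 := c * (3 * q * (q + M) ) + 4 * (q + M) ^+ 2.
have M20 : 0 < M2.
  rewrite /M2 ltr_wpDl//; last by rewrite mulr_gt0// exprn_gt0//; lra.
  by nonneg.
exists (Num.min (1 / 2) (1 / (2 * M2))).
  by rewrite lt_min; apply/andP; split; rewrite divr_gt0//; lra.
move=> e d z /andP[e0]; rewrite le_min => /andP[e2 eM] ded z0 Q1 Q2.
have d0 : 0 < d by lra.
have qd : 1 <= q * d ^+ 2.
  by rewrite /q mulrC ler_pdivlMr ?exprn_gt0// mul1r ler_pXn2r// nnegrE ltW.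
have dd : d ^+ 2 <= q * d ^+ 4.
  by rewrite (_ : q * d ^+ 4 = q * d ^+ 2 * d ^+ 2); [rewrite ler_peMl// sqr_ge0|ring].
have qd4 : 1 <= q ^+ 2 * d ^+ 4.
  rewrite (_ : q ^+ 2 * d ^+ 4 = (q * d ^+ 2) * (q * d ^+ 2)); last by ring.
  by rewrite -[1]mul1r ler_pM.
(* For [z > 1] the condition [e <= 1 / 2] lets half of [z ^+ 4] absorb [e * z ^+ 2], and every
   remaining term carries at most one factor [z], which is divided out. For [z <= 1] the bound
   [1 <= q * d ^+ 2] suffices. *)
have z3 : z ^+ 3 <= M * d ^+ 2.
  have [z1|z1] := leP z 1.
    apply: le_trans (_ : 1 <= _); first by rewrite expr_le1.
    apply: le_trans qd _; apply: ler_wpM2r; first exact: sqr_ge0.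
    by rewrite /M; lra.
  have : z ^+ 4 <= 2 * (c * delta + e) * d ^+ 2 + 2 * e * d ^+ 2 * z.
    have : e * z ^+ 2 <= 1 / 2 * z ^+ 4.
      apply: ler_pM => //; first exact: sqr_ge0.
      by rewrite ler_weXn2l// ltW.
    by move: Q1; lra.
  have -> : z ^+ 4 = z ^+ 3 * z by ring.
  have h : 2 * (c * delta + e) * d ^+ 2 <= 2 * (c * delta + e) * d ^+ 2 * z.
    apply: ler_peMr; last exact: ltW.
    by nonneg.
  move=> {}Q1; have {}Q1 : z ^+ 3 * z <= ((2 * (c * delta + e) + 2 * e) * d ^+ 2) * z.
    by lra.
  move: Q1; rewrite ler_pM2r; last lra.
  move=> Q1; apply: le_trans Q1 _; apply: ler_wpM2r; first exact: sqr_ge0.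
  have : c * delta <= c * 1 by apply: ler_wpM2l; lra.
  by rewrite /M; lra.
have zM (n : nat) : (n <= 3)%N -> z ^+ n <= (q + M) * d ^+ 2.
  move=> n3; apply: le_trans (_ : 1 + z ^+ 3 <= _); last by rewrite mulrDl lerD.
  have [z1|z1] := leP z 1.
    by apply: le_trans (exprn_ile1 _ z0 z1) _; rewrite lerDl exprn_ge0.
  by apply: le_trans (ler_weXn2l (ltW z1) n3) _; rewrite lerDr.
have d2 : 0 <= d ^+ 2 by exact: sqr_ge0.
have d4 : 0 <= d ^+ 4 by rewrite exprn_ge0// ltW.
have d22 : d ^+ 2 * d ^+ 2 = d ^+ 4 by ring.
have qM0 : 0 <= q + M by lra.
have dqd : d ^+ 2 * ((q + M) * d ^+ 2) = (q + M) * d ^+ 4 by ring.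
have E1 : d ^+ 2 * (z + 1) + z ^+ 2 <= 3 * q * (q + M) * d ^+ 4.
  have h1 := ler_wpM2l d2 (zM 1%N isT).
  have h0 := ler_wpM2l d2 (zM 0%N isT).
  have h2 := zM 2 isT.
  have : (q + M) * d ^+ 2 <= (q + M) * (q * d ^+ 4) by apply: ler_wpM2l.
  have : (q + M) * d ^+ 4 <= q * ((q + M) * d ^+ 4) by rewrite ler_peMl// mulr_ge0.
  move: h0 h1 h2; rewrite expr0 expr1 !dqd.
  by move: (q + M) (d ^+ 4) (d ^+ 2) => ? ? ?; lra.
have E2 : (z + 1) * (d ^+ 2 * z ^+ 2 + z ^+ 4) <= 4 * (q + M) ^+ 2 * d ^+ 4.
  have p1 : 1 <= q + M by lra.
  have sq (m n : nat) : (m <= 3)%N -> (n <= 3)%N ->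
      z ^+ m * z ^+ n <= (q + M) ^+ 2 * d ^+ 4.
    move=> m3 n3; rewrite (_ : _ * d ^+ 4 = ((q + M) * d ^+ 2) * ((q + M) * d ^+ 2)); last by ring.
    by apply: ler_pM; rewrite ?exprn_ge0// zM.
  have h1 := sq 3 2 isT isT; have h2 := sq 2 2 isT isT.
  have h3 := ler_wpM2l d2 (zM 3 isT); have h4 := ler_wpM2l d2 (zM 2 isT).
  have h5 : (q + M) * d ^+ 4 <= (q + M) ^+ 2 * d ^+ 4.
    by apply: ler_wpM2r => //; rewrite expr2 ler_peMl.
  rewrite (_ : (z + 1) * _ = d ^+ 2 * z ^+ 3 + d ^+ 2 * z ^+ 2 + z ^+ 3 * z ^+ 2 + z ^+ 2 * z ^+ 2); last by ring.
  move: h3 h4; rewrite !dqd => h3 h4.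
  by lra.
(* The first inequality is inserted into the leading term of the second. The two factors [delta]
   combine to [delta ^+ 2 * d ^+ 2], which is what makes [d ^+ 2] of order [delta ^+ 2]. *)
have Z4 : c * delta * z ^+ 4 <= c ^+ 2 * delta ^+ 2 * d ^+ 2 + e * (c * (3 * q * (q + M)) * d ^+ 4).
  have cd0 : 0 <= c * delta by nonneg.
  apply: le_trans (ler_wpM2l cd0 Q1) _.
  rewrite mulrDr; apply: lerD.
    by rewrite le_eqVlt; apply/orP; left; apply/eqP; ring.
  rewrite mulrCA; apply: ler_wpM2l => //.
  apply: le_trans (ler_wpM2l cd0 E1) _.
  rewrite (_ : c * (3 * q * (q + M)) * d ^+ 4 = c * (3 * q * (q + M) * d ^+ 4)); last by ring.
  apply: ler_wpM2r; first by nonneg.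
  by rewrite ler_piMr//; lra.
have Me : e * (M2 * d ^+ 4) <= d ^+ 4 / 2.
  have : e * M2 <= 1 / 2.
    by move: eM; rewrite ler_pdivlMr; [rewrite mulrCA => ?; lra|lra].
  by move=> h; rewrite mulrA mulrC; apply: le_trans (ler_wpM2l d4 h) _; lra.
have Qd : delta ^+ 4 <= delta ^+ 2 * d ^+ 2.
  rewrite (_ : delta ^+ 4 = delta ^+ 2 * delta ^+ 2); last by ring.
  by apply: ler_wpM2l; [exact: sqr_ge0|rewrite ler_pXn2r// nnegrE; lra].
have E2' := ler_wpM2l e0 E2.
have fin : d ^+ 4 <= (2 * c ^+ 2 + 1) * delta ^+ 2 * d ^+ 2.
  have : 0 <= delta ^+ 2 * d ^+ 2 by rewrite mulr_ge0 ?sqr_ge0.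
  by move: Me; rewrite /M2; lra.
move: fin; rewrite -d22 ler_pM2r// exprn_gt0//.
Qed.

Lemma sqr_young_opt C b c w x : 0 < C -> 0 <= b -> 0 <= c -> 0 <= w -> 0 <= x ->
  (forall r, 0 < r -> x <= C * (r * b ^+ 2 + c ^+ 2 / r + w) ^+ 2) ->
  x <= C * (2 * b * c + w) ^+ 2.
Proof.
move=> C0 b0 c0 w0 x0 H.
have xC0 : 0 <= x / C by rewrite divr_ge0// ltW.
have : Num.sqrt (x / C) - w <= 2 * b * c.
  apply: young_opt => // r r0; rewrite lerBlDr.
  have t0 : 0 <= r * b ^+ 2 + c ^+ 2 / r + w.
    by rewrite !addr_ge0// ?mulr_ge0 ?sqr_ge0 ?invr_ge0 ?(ltW r0).
  rewrite -[leRHS]ger0_norm// -sqrtr_sqr ler_wsqrtr//.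
  by rewrite ler_pdivrMr// mulrC H.
rewrite lerBlDr => h; rewrite -ler_pdivrMl// mulrC -[x / C]sqr_sqrtr//.
by rewrite ler_pXn2r// nnegrE ?sqrtr_ge0// addr_ge0// !mulr_ge0.
Qed.

End YoungOptimization.

Section SystemBounds.
Context {R : realType}.
Implicit Types (b c d x y z C D W V X Y T E L A K : R).

(** Optimising in [r] bounds [T] by a multiple of [A * (W + V / L ^+ 2)], so that [t * T + A / t] is
    nearly least for [t] of order [W ^- 1/2]. The lower bound on [L ^+ 2] allows the contribution of
    [V / L ^+ 2] to be absorbed by [V]. *)
Lemma system_bounds C delta A L W V T : 1 <= C -> 0 < delta <= 1 -> 1 <= A ->
  1 <= L -> 8 * C ^+ 2 * A <= L ^+ 2 -> 0 <= W -> 0 <= V -> 0 <= T ->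
  (forall t : R, 0 < t <= 1 ->
    V <= C * (L ^+ 2 * delta ^+ 2 + (t * T + A / t))) ->
  (forall r : R, 0 < r -> T <= C * (r * A + (W + V / L ^+ 2) / r) ^+ 2) ->
  V <= 2 * C * L ^+ 2 * delta ^+ 2 +
       22 * C ^+ 2 * A * (Num.sqrt (Num.sqrt W) ^+ 2 + 1) /\
  (exists2 t, 0 < t <= 1 &
    t * T + A / t <= 22 * C ^+ 2 * A * (Num.sqrt (Num.sqrt W) ^+ 2 + 1)).
Proof.
move=> C1 delta01 A1 L1 LA W0 V0 T0 H2 H3; have /andP[de0 de1] := delta01.
set y := Num.sqrt (Num.sqrt W).
have y4 : y ^+ 4 = W.
  by rewrite (_ : y ^+ 4 = (y ^+ 2) ^+ 2); [rewrite !sqr_sqrtr// sqrtr_ge0|ring].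
have L20 : 0 < L ^+ 2 by rewrite exprn_gt0//; lra.
have VL0 : 0 <= V / L ^+ 2 by rewrite divr_ge0// ltW.
have {}H3 : T <= 4 * C * A * (W + V / L ^+ 2).
  have := @sqr_young_opt R C (Num.sqrt A) (Num.sqrt (W + V / L ^+ 2)) 0 T.
  rewrite addr0 !exprMn !sqr_sqrtr ?addr_ge0//; try lra.
  rewrite (_ : C * (2 ^+ 2 * A * (W + V / L ^+ 2)) = 4 * C * A * (W + V / L ^+ 2)); last by ring.
  apply => //; rewrite ?sqrtr_ge0//; first lra.
  by move=> r r0; rewrite addr0; exact: H3.
(* [y ^+ 2] is the square root of [W]; the summand 1 keeps [t] below 1. *)
pose t := (y ^+ 2 + 1)^-1.
have y20 : 0 <= y ^+ 2 by exact: sqr_ge0.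
have t01 : 0 < t <= 1.
  by apply/andP; split; [rewrite invr_gt0; lra|rewrite invf_le1; lra].
have /andP[t0 t1] := t01.
have tW : t * W <= y ^+ 2 + 1.
  rewrite -y4 /t mulrC ler_pdivrMr; last lra.
  by rewrite (_ : y ^+ 4 = y ^+ 2 * y ^+ 2); [apply: ler_pM => //; lra|ring].
have tV : t * (V / L ^+ 2) <= V / L ^+ 2 by rewrite ler_piMl.
have At : A / t = A * (y ^+ 2 + 1) by rewrite /t invrK.
have tT : t * T <= 4 * C * A * (y ^+ 2 + 1) + 4 * C * A * (V / L ^+ 2).
  have CA0 : 0 <= 4 * C * A by nonneg.
  apply: le_trans (ler_wpM2l (ltW t0) H3) _.
  rewrite mulrCA -mulrDr; apply: ler_wpM2l => //; rewrite mulrDr; exact: lerD.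
have C2A : 8 * C ^+ 2 * A * (V / L ^+ 2) <= V.
  by rewrite mulrCA ler_piMr// ler_pdivrMr// mul1r.
have Vb : V <= 2 * C * L ^+ 2 * delta ^+ 2 + (8 * C ^+ 2 * A + 2 * C * A) * (y ^+ 2 + 1).
  have := H2 _ t01; rewrite At => h.
  have : C * (t * T) <= C * (4 * C * A * (y ^+ 2 + 1) + 4 * C * A * (V / L ^+ 2)).
    by apply: ler_wpM2l => //; lra.
  by move: h C2A; lra.
have CC : C <= C ^+ 2 by rewrite expr2 ler_peMl//; lra.
have CA : C * A <= C ^+ 2 * A by apply: ler_wpM2r; lra.
have CAA : A <= C ^+ 2 * A by apply: ler_peMl; lra.
have CA1 : 1 <= C ^+ 2 * A by lra.
split.
  apply: le_trans Vb _; rewrite lerD2l; apply: ler_wpM2r; first lra.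
  by lra.
exists t => //; rewrite At.
have VL : V / L ^+ 2 <= 4 * C * (y ^+ 2 + 1).
  rewrite ler_pdivrMr//; apply: le_trans Vb _.
  have : (8 * C ^+ 2 * A + 2 * C * A) * (y ^+ 2 + 1) <= 2 * L ^+ 2 * (y ^+ 2 + 1).
    by apply: ler_wpM2r; lra.
  have CM : 1 <= C * (y ^+ 2 + 1) by rewrite mulr_ege1//; lra.
  have d21 : delta ^+ 2 <= 1 by rewrite expr_le1// ltW.
  have : 2 * C * L ^+ 2 * delta ^+ 2 <= 2 * C * L ^+ 2 * (y ^+ 2 + 1).
    by apply: ler_wpM2l; [nonneg|lra].
  have : L ^+ 2 * (y ^+ 2 + 1) <= C * (L ^+ 2 * (y ^+ 2 + 1)).
    by apply: ler_peMl => //; nonneg.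
  by lra.
have : 4 * C * A * (V / L ^+ 2) <= 4 * C * A * (4 * C * (y ^+ 2 + 1)).
  by apply: ler_wpM2l => //; nonneg.
have : (C * A) * (y ^+ 2 + 1) <= (C ^+ 2 * A) * (y ^+ 2 + 1) by apply: ler_wpM2r; lra.
have : A * (y ^+ 2 + 1) <= (C ^+ 2 * A) * (y ^+ 2 + 1) by apply: ler_wpM2r; lra.
have : 0 <= C ^+ 2 * A * (y ^+ 2 + 1) by nonneg.
by move: tT; lra.
Qed.

End SystemBounds.

Section Rescaling.
Context {R : realType}.
Implicit Types (b c d x y z C D W V X Y T E L A K q : R).

Lemma sqrt_sqrt_expr4 x : 0 <= x -> Num.sqrt (Num.sqrt x) ^+ 4 = x.
Proof.
move=> x0; rewrite (_ : 4 = 2 * 2)%N// exprM !sqr_sqrtr// sqrtr_ge0.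
Qed.

(** Here [rho ^+ 4] is [L]. After division by [L] only the part of [sqrt V] proportional to
    [L * delta] survives as a leading term. The others carry at least a factor [rho ^- 3], of which
    only [1 / rho] is kept, the rate that [rescaled_D] allows. *)
Lemma rescaled_W C K delta q rho d z V sV : 1 <= C -> 0 <= K -> 0 < delta ->
  1 <= rho -> delta <= d -> 0 <= z -> 0 <= q -> 1 <= q * d ^+ 2 ->
  (rho * z) ^+ 4 <= C * (2 * d ^+ 2 * sV + V / (rho ^+ 4) ^+ 2) ->
  sV <= 2 * C * rho ^+ 4 * delta + 2 * K * (rho * z + 1) ->
  V <= 2 * C * (rho ^+ 4) ^+ 2 * delta ^+ 2 + 2 * K * ((rho * z) ^+ 2 + 1) ->
  z ^+ 4 <= 4 * C ^+ 2 * delta * d ^+ 2 +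
    (4 * C * K + 2 * C ^+ 2 + 2 * C * K * q) / rho *
      (d ^+ 2 * (z + 1) + z ^+ 2).
Proof.
move=> C1 K0 de0 r1 ded z0 q0 qd H HsV HV.
have d20 : 0 <= d ^+ 2 by exact: sqr_ge0.
have r4 : 0 < rho ^+ 4 by rewrite exprn_gt0//; lra.
have rr n : 1 <= rho ^+ n by exact: exprn_ege1.
have dd : delta ^+ 2 <= d ^+ 2 by rewrite ler_pXn2r// nnegrE; lra.
set r := rho ^+ 3.
have r3 : 1 <= r by exact: rr.
have HV' : V / (rho ^+ 4) ^+ 2 <= 2 * C * d ^+ 2 + 2 * K * (z ^+ 2 + q * d ^+ 2).
  have r42 : 0 < (rho ^+ 4) ^+ 2 by rewrite exprn_gt0.
  rewrite ler_pdivrMr//; apply: le_trans HV _.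
  rewrite [leRHS]mulrDl. apply: lerD.
    rewrite mulrAC; apply: ler_wpM2r; first by rewrite exprn_ge0// ltW.
    by apply: ler_wpM2l => //; lra.
  rewrite -[leRHS]mulrA; apply: ler_wpM2l; first lra.
  rewrite [leRHS]mulrDl; apply: lerD.
    rewrite exprMn mulrC; apply: ler_wpM2l; first exact: sqr_ge0.
    by rewrite -exprM; apply: ler_weXn2l.
  apply: le_trans qd _; rewrite ler_peMr ?(mulr_ge0 q0 d20)//.
  exact: exprn_ege1 (rr _).
have HsV' : d ^+ 2 * sV <= d ^+ 2 * (2 * C * (rho * r) * delta + 2 * K * (rho * (z + 1))).
  apply: ler_wpM2l => //; apply: le_trans HsV _.
  rewrite (_ : rho * r = rho ^+ 4); last by rewrite /r; ring.
  by rewrite lerD2l; apply: ler_wpM2l; lra.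
have H' : rho * r * z ^+ 4 <= 4 * C ^+ 2 * (rho * r) * delta * d ^+ 2 + rho * (4 * C * K * (d ^+ 2 * (z + 1)) + 2 * C ^+ 2 * d ^+ 2 + 2 * C * K * (z ^+ 2 + q * d ^+ 2)).
  apply: (@le_trans _ _ (C * (d ^+ 2 * sV * 2 + V / (rho ^+ 4) ^+ 2))).
    move: H; rewrite (_ : (rho * z) ^+ 4 = rho * r * z ^+ 4); last by rewrite /r; ring.
    by rewrite (_ : 2 * d ^+ 2 * sV = d ^+ 2 * sV * 2); last by ring.
  apply: (@le_trans _ _ (C * (d ^+ 2 * (2 * C * (rho * r) * delta + 2 * K * (rho * (z + 1))) * 2 +
      rho * (2 * C * d ^+ 2 + 2 * K * (z ^+ 2 + q * d ^+ 2))))); last first.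
    by rewrite le_eqVlt; apply/orP; left; apply/eqP; ring.
  apply: ler_wpM2l; first lra.
  apply: lerD; first by apply: ler_wpM2r.
  apply: le_trans HV' _; rewrite ler_peMl//.
  by nonneg.
have H2 : r * z ^+ 4 <= 4 * C ^+ 2 * r * delta * d ^+ 2 + (4 * C * K * (d ^+ 2 * (z + 1)) + 2 * C ^+ 2 * d ^+ 2 + 2 * C * K * (z ^+ 2 + q * d ^+ 2)).
  have rp : 0 < rho by lra.
  rewrite -(ler_pM2l rp) [rho * (r * _)]mulrA; apply: le_trans H' _.
  by rewrite le_eqVlt; apply/orP; left; apply/eqP; ring.
have rp : 0 < r by lra.
rewrite -(ler_pM2l rp); apply: le_trans H2 _.
rewrite [leRHS]mulrDr; apply: lerD; first by rewrite le_eqVlt; apply/orP; left; apply/eqP; ring.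
set S := d ^+ 2 * (z + 1) + z ^+ 2.
set M := 4 * C * K + _ + _.
have S0 : 0 <= S by rewrite /S; nonneg.
have CK : 0 <= C * K by nonneg.
have CKq : 0 <= C * K * q by exact: mulr_ge0.
have C20 : 0 <= C ^+ 2 by exact: sqr_ge0.
have M0 : 0 <= M by rewrite /M; lra.
apply: (@le_trans _ _ (M * S)); last first.
  rewrite (_ : r * (M / rho * S) = rho ^+ 2 * (M * S)); last by rewrite /r; field; lra.
  by rewrite ler_peMl ?mulr_ge0.
have dS : d ^+ 2 <= S.
  have : 0 <= d ^+ 2 * z by exact: mulr_ge0.
  by have := sqr_ge0 z; rewrite /S; lra.
have h1 : 4 * C * K * (d ^+ 2 * (z + 1)) + 4 * C * K * z ^+ 2 = 4 * C * K * S by rewrite /S; ring.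
have h2 := ler_wpM2l C20 dS; have h3 := ler_wpM2l CKq dS.
have h4 : 0 <= C * K * z ^+ 2 by rewrite mulr_ge0// sqr_ge0.
rewrite /M; move: (d ^+ 2 * (z + 1)) h1 => w h1; lra.
Qed.

(** The slowest error sits in [X / L]: the product of [rho * z + 1] with [(rho * z) ^+ 2] grows like
    [rho ^+ 3] against [L = rho ^+ 4], whence the factor [1 / rho]. The term [W / L ^+ 2] equals
    [z ^+ 4 / L] and is leading of size [delta * z ^+ 4], since [1 / L <= delta]. *)
Lemma rescaled_D C K delta rho d z E X : 1 <= C -> 0 <= K -> 0 < delta ->
  1 <= rho -> 0 <= z -> 0 <= d -> (rho ^+ 4)^-1 <= delta ->
  d ^+ 4 <= C * ((rho * z) ^+ 4 / (rho ^+ 4) ^+ 2 + X / rho ^+ 4 + E) ->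
  X <= C * (delta * (rho * z) ^+ 4 + 2 * (2 * K * (rho * z + 1)) *
     (C * (2 * d ^+ 2 * (rho * z) ^+ 2 + (rho * z) ^+ 4 / rho ^+ 4))) ->
  E <= delta ^+ 4 / (4 * C) ->
  d ^+ 4 <= 4 * C ^+ 2 * delta * z ^+ 4 +
    (8 * C ^+ 3 * K) / rho * ((z + 1) * (d ^+ 2 * z ^+ 2 + z ^+ 4)) +
    delta ^+ 4 / 4.
Proof.
move=> C1 K0 de0 r1 z0 d0 rd HD HX HE.
have r0 : rho != 0 by rewrite gt_eqF//; lra.
have r4 : 0 < rho ^+ 4 by rewrite exprn_gt0//; lra.
have C0 : 0 < C by lra.
apply: le_trans HD _; rewrite mulrDr; apply: lerD; last first.
  apply: le_trans (ler_wpM2l (ltW C0) HE) _.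
  by rewrite le_eqVlt; apply/orP; left; apply/eqP; field; lra.
have z4 : 0 <= z ^+ 4 by exact: exprn_ge0.
have h1 : (rho * z) ^+ 4 / (rho ^+ 4) ^+ 2 <= C * delta * z ^+ 4.
  rewrite (_ : _ / _ = (rho ^+ 4)^-1 * z ^+ 4); last by field.
  apply: ler_wpM2r => //; apply: le_trans rd _; rewrite ler_peMl// ltW//.
set P := (z + 1) * (d ^+ 2 * z ^+ 2 + z ^+ 4).
have P0 : 0 <= P by rewrite mulr_ge0 ?addr_ge0 ?mulr_ge0 ?sqr_ge0//; lra.
have h2 : X / rho ^+ 4 <= C * delta * z ^+ 4 + 8 * C ^+ 2 * K / rho * P.
  rewrite ler_pdivrMr//; apply: le_trans HX _.
  rewrite (_ : (rho * z) ^+ 4 / rho ^+ 4 = z ^+ 4); last by field.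
  rewrite (_ : _ * rho ^+ 4 = C * (delta * (rho * z) ^+ 4 + 2 * (2 * K * rho) * (C * (2 * (rho ^+ 2 * P))))); last by field.
  apply: ler_wpM2l; first lra.
  rewrite lerD2l.
  have rz : 0 <= rho * z by nonneg.
  have dz : 0 <= d ^+ 2 * z ^+ 2 by rewrite mulr_ge0 ?sqr_ge0.
  have rp2 : z ^+ 4 <= rho ^+ 2 * z ^+ 4 by rewrite ler_peMl// exprn_ege1.
  have rdz : 0 <= rho ^+ 2 * (d ^+ 2 * z ^+ 2) by rewrite mulr_ge0 ?sqr_ge0.
  have key : (rho * z + 1) * (2 * (rho ^+ 2 * (d ^+ 2 * z ^+ 2)) + z ^+ 4) <=
      (rho * (z + 1)) * (2 * (rho ^+ 2 * (d ^+ 2 * z ^+ 2 + z ^+ 4))).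
    by apply: ler_pM; lra.
  have K4 : 0 <= 4 * (K * C) by nonneg.
  apply: le_trans (le_trans (ler_wpM2l K4 key) _).
    by rewrite le_eqVlt; apply/orP; left; apply/eqP; ring.
  by rewrite le_eqVlt; apply/orP; left; apply/eqP; rewrite /P; ring.
apply: le_trans (ler_wpM2l (ltW C0) (lerD h1 h2)) _.
have : 0 <= C ^+ 2 * delta * z ^+ 4 by rewrite !mulr_ge0 ?sqr_ge0// ltW.
have -> : C * (C * delta * z ^+ 4 + (C * delta * z ^+ 4 + 8 * C ^+ 2 * K / rho * P)) =
  2 * (C ^+ 2 * delta * z ^+ 4) + 8 * C ^+ 3 * K / rho * P by field.
lra.
Qed.

End Rescaling.

Section EnergyBootstrap.
Context {R : realType}.
Implicit Types (b c d x y z C D W V X Y T E L A K : R).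

Lemma sqrt_bound C K delta L y V : 1 <= C -> 1 <= K -> 1 <= L -> 0 <= y ->
  0 < delta ->
  V <= 2 * C * L ^+ 2 * delta ^+ 2 + 2 * K * (y ^+ 2 + 1) ->
  Num.sqrt V <= 2 * C * L * delta + 2 * K * (y + 1).
Proof.
move=> C1 K1 L1 y0 de0 HV.
have C0 : 0 <= C by lra.
have C20 : 0 <= 2 * C by lra.
have K0 : 0 <= 2 * K by lra.
have b1 : 0 <= 2 * C * L * delta.
  by apply: mulr_ge0; [apply: mulr_ge0 => //; lra|exact: ltW].
have b2 : 0 <= 2 * K * (y + 1) by apply: mulr_ge0 => //; exact: addr_ge0.
rewrite -[leRHS]ger0_norm ?addr_ge0// -sqrtr_sqr ler_wsqrtr//.
apply: le_trans HV _; rewrite sqrrD.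
have h1 : 2 * C * L ^+ 2 * delta ^+ 2 <= (2 * C * L * delta) ^+ 2.
  rewrite (_ : (2 * C * L * delta) ^+ 2 = (2 * C) * (2 * C * L ^+ 2 * delta ^+ 2)); last by ring.
  rewrite ler_peMl//; last lra.
  by apply: mulr_ge0; [apply: mulr_ge0 => //|]; exact: sqr_ge0.
have h2 : 2 * K * (y ^+ 2 + 1) <= (2 * K * (y + 1)) ^+ 2.
  have -> : (2 * K * (y + 1)) ^+ 2 = 2 * K * (2 * K * (y + 1) ^+ 2) by ring.
  apply: ler_wpM2l => //.
  rewrite -[leLHS]mul1r; apply: ler_pM => //; [by rewrite addr_ge0// sqr_ge0|lra|].
  by rewrite sqrrD expr1n mulr1 lerD2r lerDl mulrn_wge0.
have h3 := mulr_ge0 b1 b2.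
by rewrite -mulr_natl; lra.
Qed.

(** Optimising in [r] bounds [Y] by a square, and optimising in [s] then yields the product of the
    roots of [S] and [Y]. The bound on [S] is first enlarged to the perfect square of
    [2 * K * (y + 1)]. *)
Lemma convective_bound C K delta L y d X Y S : 1 <= C -> 1 <= K -> 1 <= L ->
  0 <= y -> 0 <= d -> 0 <= Y -> S <= 2 * K * (y ^+ 2 + 1) ->
  (forall s : R, 0 < s -> X <= C * (delta * y ^+ 4 + s * S + Y / s)) ->
  (forall r : R, 0 < r -> Y <= C * (r * d ^+ 4 + y ^+ 4 / r + y ^+ 4 / L) ^+ 2) ->
  X <= C * (delta * y ^+ 4 +
    2 * (2 * K * (y + 1)) * (C * (2 * d ^+ 2 * y ^+ 2 + y ^+ 4 / L))).
Proof.
move=> C1 K1 L1 y0 d0 Y0 HS HX HY.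
have C0 : 0 < C by lra.
have C0' : 0 <= C by exact: ltW.
have K0 : 0 <= 2 * K by lra.
have L0 : 0 <= L by lra.
have yL : 0 <= y ^+ 4 / L by rewrite divr_ge0// exprn_ge0.
have y20 : 0 <= y ^+ 2 by exact: sqr_ge0.
have dy : 0 <= 2 * d ^+ 2 * y ^+ 2 by rewrite -mulrA mulr_ge0// mulr_ge0// sqr_ge0.
have {HX} : X / C - delta * y ^+ 4 <=
    2 * (2 * K * (y + 1)) * (C * (2 * d ^+ 2 * y ^+ 2 + y ^+ 4 / L)).
  apply: young_opt.
  - by apply: mulr_ge0 => //; exact: addr_ge0.
  - by apply: mulr_ge0 => //; exact: addr_ge0.
  move=> s s0; rewrite lerBlDl ler_pdivrMr// mulrC.
  apply: le_trans (HX _ s0) _; apply: ler_wpM2l => //.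
  rewrite -addrA lerD2l; apply: lerD.
    apply: ler_wpM2l; first exact: ltW.
    apply: le_trans HS _.
    have -> : (2 * K * (y + 1)) ^+ 2 = 2 * K * (2 * K * (y + 1) ^+ 2) by ring.
    apply: ler_wpM2l => //.
    rewrite -[leLHS]mul1r; apply: ler_pM; [by []|exact: addr_ge0|lra|].
    by rewrite sqrrD expr1n mulr1 lerD2r lerDl mulrn_wge0.
  apply: ler_wpM2r; first by rewrite invr_ge0 ltW.
  have Yb : Y <= C * (2 * d ^+ 2 * y ^+ 2 + y ^+ 4 / L) ^+ 2.
    apply: sqr_young_opt => //; first exact: sqr_ge0.
    move=> r r0; rewrite (_ : (d ^+ 2) ^+ 2 = d ^+ 4); last by ring.
    rewrite (_ : (y ^+ 2) ^+ 2 = y ^+ 4); last by ring.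
    exact: HY.
  apply: le_trans Yb _; rewrite exprMn; apply: ler_wpM2r; first exact: sqr_ge0.
  by rewrite expr2 ler_peMl.
by rewrite lerBlDl ler_pdivrMr// mulrC.
Qed.

(* The energies of a flow at scale [L]: with weights omitted, [D], [W], [V], [T], [X], [Y]
   are the integrals of |grad w|^2, |grad v|^2, |v|^2, G(v)^2, |v| w^2 and w^4, where
   [G' = g] and [A] bounds the integral of g(v)^2; [E] is the error of mollification. *)
Definition energy_system (C delta A L D W V X Y T E : R) : Prop :=
  [/\ [/\ 0 <= D, 0 <= W & 0 <= V], [/\ 0 <= X, 0 <= Y & 0 <= T],
      forall s : R, 0 < s -> W <= C * (s * D + V / s + V / L ^+ 2),
      forall t : R, 0 < t <= 1 -> V <= C * (L ^+ 2 * delta ^+ 2 + (t * T + A / t)) &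
      (forall r : R, 0 < r -> T <= C * (r * A + (W + V / L ^+ 2) / r) ^+ 2) /\
      [/\ D <= C * (W / L ^+ 2 + X / L + E),
          forall s t : R, 0 < s -> 0 < t <= 1 ->
            X <= C * (delta * W + s * (t * T + A / t) + Y / s) &
          forall r : R, 0 < r -> Y <= C * (r * D + W / r + W / L) ^+ 2]].

(** The factor of [delta ^+ 4] involves [C] alone; [A] and the negative powers of [delta] are
    confined to [L0]. *)
Lemma energy_bootstrap C delta A : 1 <= C -> 0 < delta <= 1 -> 1 <= A ->
  exists2 L0, 1 <= L0 & forall L D W V X Y T E, L0 <= L ->
  energy_system C delta A L D W V X Y T E ->
  E <= delta ^+ 4 / (4 * C) -> D <= (32 * C ^+ 4 + 1) ^+ 2 * delta ^+ 4.
Proof.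
move=> C1 delta01 A1; have /andP[de0 de1] := delta01.
(* [4 * C ^+ 2] is the leading coefficient of both rescaled inequalities; inserted into
   [2 * c ^+ 2 + 1] it gives [32 * C ^+ 4 + 1]. *)
have c1 : 1 <= 4 * C ^+ 2.
  by have : 1 <= C ^+ 2 by [rewrite exprn_ege1]; lra.
have [e0 e0_gt0 RB] := rescaled_bootstrap c1 delta01.
pose q := delta ^- 2.
have q0 : 0 <= q by rewrite invr_ge0 sqr_ge0.
pose K := 11 * C ^+ 2 * A.
have K1 : 1 <= K.
  have : 1 <= C ^+ 2 * A by rewrite mulr_ege1// exprn_ege1.
  by rewrite /K; lra.
pose K2 := 4 * C * K + 2 * C ^+ 2 + 2 * C * K * q + 8 * C ^+ 3 * K.
have C0 : 0 <= C by lra.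
have K20 : 0 < K2.
  rewrite /K2 ltr_wpDr//; first by rewrite !mulr_ge0 ?exprn_ge0//; lra.
  rewrite ltr_wpDr//; first by nonneg.
  by rewrite ltr_wpDr// ?mulr_ge0 ?sqr_ge0// !mulr_gt0//; lra.
(* The four summands ensure in turn [1 <= L], [1 / L <= delta], the lower bound on [L ^+ 2] required
   by [system_bounds], and [K2 / rho <= e0] for the fourth root [rho] of [L]. *)
exists (1 + delta^-1 + 8 * C ^+ 2 * A + (K2 / e0) ^+ 4).
  rewrite -!addrA lerDl !addr_ge0 ?invr_ge0 ?exprn_ge0 ?divr_ge0 ?mulr_ge0 ?sqr_ge0//; lra.
have C3 : 0 <= 8 * C ^+ 3 * K by apply: mulr_ge0; [apply: mulr_ge0; [lra|exact: exprn_ge0]|lra].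
have CK1 : 0 <= 2 * C * K * q by nonneg.
have CK4 : 0 <= 4 * C * K by nonneg.
have CC2 : 0 <= 2 * C ^+ 2 by nonneg.
have K1K2 : 4 * C * K + 2 * C ^+ 2 + 2 * C * K * q <= K2 by rewrite /K2 lerDl.
have K3K2 : 8 * C ^+ 3 * K <= K2 by rewrite /K2 lerDr !addr_ge0.
have K0 : 0 <= K by lra.
have Cp : 0 < C by lra.
move=> L D W V X Y T E LL0 [[D0 W0 V0] [X0 Y0 T0] H1 H2 [H3 [H4 H5 H6]]] HE.
have i0 : 0 <= delta^-1 by rewrite invr_ge0 ltW.
have CA0 : 0 <= 8 * C ^+ 2 * A by nonneg.
have Ke0 : 0 <= (K2 / e0) ^+ 4 by rewrite exprn_ge0// divr_ge0// ltW.
have L1 : 1 <= L by lra.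
have LL2 : L <= L ^+ 2 by rewrite expr2 ler_peMl//; lra.
have LA : 8 * C ^+ 2 * A <= L ^+ 2 by lra.
have Ldelta : L^-1 <= delta.
  by rewrite invf_ple ?posrE//; lra.
have [Vb [t t01 Sb]] := system_bounds C1 delta01 A1 L1 LA W0 V0 T0 H2 H3.
set y := Num.sqrt (Num.sqrt W) in Vb Sb.
have y0 : 0 <= y by exact: sqrtr_ge0.
have y4 : W = y ^+ 4.
  by rewrite sqrt_sqrt_expr4.
pose d := Num.sqrt (Num.sqrt D).
have d0 : 0 <= d by exact: sqrtr_ge0.
have d4 : D = d ^+ 4.
  by rewrite sqrt_sqrt_expr4.
pose rho := Num.sqrt (Num.sqrt L).
have rho4 : L = rho ^+ 4.
  by rewrite sqrt_sqrt_expr4//; lra.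
have rho0 : 0 <= rho by exact: sqrtr_ge0.
have rho1 : 1 <= rho.
  by rewrite -(@ler_pXn2r _ 4) ?nnegrE// expr1n -rho4.
have rhoK : K2 / e0 <= rho.
  rewrite -(@ler_pXn2r _ 4) ?nnegrE// -?rho4; last by rewrite divr_ge0// ltW.
  by lra.
have [dd|ded] := ltP d delta.
  rewrite d4; apply: (@le_trans _ _ (delta ^+ 4)); first by rewrite ler_pXn2r ?nnegrE// ltW.
  rewrite ler_peMl ?exprn_ge0 ?(ltW de0)// exprn_ege1// lerDr.
  by rewrite mulr_ge0// exprn_ge0.
pose z := y / rho.
have z0 : 0 <= z by rewrite divr_ge0.
have yz : y = rho * z by rewrite /z mulrCA divff ?mulr1// gt_eqF// (lt_le_trans _ rho1).
have sV : Num.sqrt V <= 2 * C * L * delta + 2 * K * (y + 1).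
  apply: sqrt_bound => //; apply: le_trans Vb _.
  by rewrite (_ : 22 * C ^+ 2 * A = 2 * K)// /K; ring.
have W1 : W <= C * (2 * d ^+ 2 * Num.sqrt V + V / L ^+ 2).
  rewrite -ler_pdivrMl -?lerBlDr//.
  apply: young_opt; rewrite ?sqr_ge0 ?sqrtr_ge0// => s s0.
  rewrite (sqr_sqrtr V0) (_ : (d ^+ 2) ^+ 2 = D); last by rewrite d4; ring.
  rewrite lerBlDr ler_pdivrMl//.
  exact: H1.
have qd : 1 <= q * d ^+ 2.
  by rewrite /q mulrC ler_pdivlMr ?exprn_gt0// mul1r ler_pXn2r// nnegrE ltW.
have rp : 0 < rho by exact: lt_le_trans rho1.
have P1 : z ^+ 4 <= 4 * C ^+ 2 * delta * d ^+ 2 + K2 / rho * (d ^+ 2 * (z + 1) + z ^+ 2).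
  move: W1 sV Vb; rewrite y4 rho4 yz => W1 sV Vb.
  have K22 : 22 * C ^+ 2 * A = 2 * K by rewrite /K; ring.
  rewrite K22 in Vb.
  apply: le_trans (rescaled_W C1 K0 de0 rho1 ded z0 q0 qd W1 sV Vb) _.
  rewrite lerD2l; apply: ler_wpM2r.
    by rewrite addr_ge0 ?sqr_ge0// mulr_ge0 ?sqr_ge0// addr_ge0.
  by apply: ler_wpM2r; [rewrite invr_ge0|].
have P2 : d ^+ 4 <= 4 * C ^+ 2 * delta * z ^+ 4 + K2 / rho * ((z + 1) * (d ^+ 2 * z ^+ 2 + z ^+ 4)) + delta ^+ 4 / 4.
  have XB : X <= C * (delta * y ^+ 4 + 2 * (2 * K * (y + 1)) * (C * (2 * d ^+ 2 * y ^+ 2 + y ^+ 4 / L))).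
    apply: (@convective_bound C K delta L y d X Y (t * T + A / t)) => //.
    - by rewrite (le_trans Sb)// (_ : 22 * C ^+ 2 * A = 2 * K)// /K; ring.
    - by move=> s s0; rewrite -y4; exact: H5.
    - by rewrite -d4 -y4; exact: H6.
  move: XB Ldelta H4; rewrite d4 y4 rho4 yz => XB Ldelta H4.
  apply: le_trans (rescaled_D C1 K0 de0 rho1 z0 d0 Ldelta H4 XB HE) _.
  rewrite lerD2r lerD2l; apply: ler_wpM2r.
    apply: mulr_ge0; first exact: addr_ge0.
    by apply: addr_ge0; [apply: mulr_ge0; exact: sqr_ge0|exact: exprn_ge0].
  by apply: ler_wpM2r; [rewrite invr_ge0|].
have Ke : 0 <= K2 / rho <= e0.
  apply/andP; split; first by rewrite divr_ge0// ltW.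
  by rewrite ler_pdivrMr// mulrC -ler_pdivrMr.
have := RB _ _ _ Ke ded z0 P1 P2.
rewrite (_ : 2 * (4 * C ^+ 2) ^+ 2 + 1 = 32 * C ^+ 4 + 1); last by ring.
move=> h; rewrite d4 (_ : d ^+ 4 = (d ^+ 2) ^+ 2); last by ring.
rewrite (_ : _ * delta ^+ 4 = ((32 * C ^+ 4 + 1) * delta ^+ 2) ^+ 2); last by ring.
rewrite ler_pXn2r// ?nnegrE ?sqr_ge0// mulr_ge0 ?sqr_ge0// addr_ge0// mulr_ge0// exprn_ge0//.
Qed.

(* With [D = 0] the choice [s = L^2] in the first inequality gives [W <= 2CV/L^2]. *)
Lemma energy_system_degenerate C delta A L W V X Y T E : 1 <= C ->
  0 < delta <= 1 -> 1 <= A -> 1 <= L -> 88 * C ^+ 3 * A <= L ^+ 2 * delta ^+ 2 ->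
  energy_system C delta A L 0 W V X Y T E -> W <= (8 * C ^+ 2 + 2) * delta ^+ 2.
Proof.
move=> C1 de A1 L1 hL [[_ W0 V0] [_ _ T0] h1 h2 [h3 _]]; have /andP[de0 de1] := de.
have L0 : 0 < L ^+ 2 by rewrite exprn_gt0//; lra.
have C23 : C ^+ 2 <= C ^+ 3 by rewrite [leRHS]exprSr ler_peMr// sqr_ge0.
have C30 : 0 <= C ^+ 3 by rewrite exprn_ge0//; lra.
have d2 : delta ^+ 2 <= 1 by rewrite exprn_ile1//; lra.
have d20 : 0 < delta ^+ 2 by rewrite exprn_gt0.
have hL' : 8 * C ^+ 2 * A <= L ^+ 2.
  have a1 := ler_wpM2r (le_trans ler01 A1) C23.
  have a2 := ler_wpM2l (ltW L0) d2.
  have a3 : 0 <= C ^+ 3 * A by nonneg.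
  by move: a1 a2 a3 hL; move: (C ^+ 2) (C ^+ 3) (L ^+ 2) (delta ^+ 2); clear => *; lra.
have [hV _] := system_bounds C1 de A1 L1 hL' W0 V0 T0 h2 h3.
have hW : W <= 2 * C * V / L ^+ 2.
  by have := h1 _ L0; move: (L ^+ 2)^-1; clear => *; lra.
set S := Num.sqrt (Num.sqrt W) ^+ 2 in hV.
(* [S] is the square root of [W]. Replacing it by a linear bound costs in the end at most half of
   [W], because its coefficient is [delta ^+ 2 / 2]. *)
have SW : S <= W + 1.
  rewrite /S sqr_sqrtr ?sqrtr_ge0//.
  have := sqr_sqrtr W0; move: (Num.sqrt W) => q <-; have := sqr_ge0 (q - 1 / 2).
  by clear; nra.
have S0 : 0 <= S by exact: sqr_ge0.
have {}hW : W * L ^+ 2 <= 2 * C * V by rewrite -ler_pdivlMr.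
have C0 : 0 <= 2 * C by lra.
have hV' := ler_wpM2l C0 hV.
have e1 : 2 * C * (2 * C * L ^+ 2 * delta ^+ 2 + 22 * C ^+ 2 * A * (S + 1)) =
  4 * C ^+ 2 * delta ^+ 2 * L ^+ 2 + (88 * C ^+ 3 * A) * (S + 1) / 2 by field.
have S1 : 0 <= S + 1 by lra.
have h4 := ler_wpM2r S1 hL.
have h5 : W * L ^+ 2 <= (4 * C ^+ 2 * delta ^+ 2 + delta ^+ 2 * (S + 1) / 2) * L ^+ 2.
  apply: le_trans hW _; apply: le_trans hV' _; rewrite e1.
  by move: h4; move: (88 * C ^+ 3 * A) (C ^+ 2) (delta ^+ 2) (L ^+ 2) (S + 1); clear => *; lra.
rewrite ler_pM2r// in h5.
have h6 := ler_wpM2l (ltW d20) SW; have h7 := ler_wpM2r W0 d2.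
by move: h5 h6 h7; move: (C ^+ 2) (delta ^+ 2); clear => *; lra.
Qed.

End EnergyBootstrap.

(** * Integrals over squares and slicewise calculus *)

Section SquareIntegral.
Context {R : realType}.
Implicit Types (f g : R * R -> R) (L : R).

(** The plane carries the product sigma-algebra, so an open set is exhibited as a countable union of
    boxes with rational centres and radii. *)
Lemma open_plane_measurable (A : set (R * R)) :
  open A -> measurable (A : set (measurableTypeR R * measurableTypeR R)).
Proof.
move=> oA.
pose box (a b r : rat) : set (R * R) :=
  `]ratr a - ratr r, ratr a + ratr r[ `*` `]ratr b - ratr r, ratr b + ratr r[.
have mbox a b r :
    measurable (box a b r : set (measurableTypeR R * measurableTypeR R)).
  by apply: measurableX; exact: measurable_itv.
have -> : A = \bigcup_(a : rat) \bigcup_(b : rat)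
    \bigcup_(r in [set r | box a b r `<=` A]) box a b r.
  apply/seteqP; split=> [[x y] Axy|z [a _ [b _ [r rA]]]]; last exact: rA.
  have [e /= e0 eA] := (nbhs_ballP _ _).1 (open_nbhs_nbhs (conj oA Axy)).
  have rat_near (s t : R) : s < t -> exists q : rat, s < ratr q < t.
    move=> st; have [q] := rat_in_itvoo st.
    by rewrite in_itv/= => qst; exists q.
  have e8 : e / 8 > 0 by rewrite divr_gt0.
  have [a /andP[a1 a2]] : exists q : rat, x - e / 8 < ratr q < x + e / 8.
    by apply: rat_near; lra.
  have [b /andP[b1 b2]] : exists q : rat, y - e / 8 < ratr q < y + e / 8.
    by apply: rat_near; lra.
  have [r /andP[r1 r2]] : exists q : rat, e / 8 < ratr q < e / 4.
    by apply: rat_near; lra.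
  exists a => //; exists b => //; exists r.
    move=> [x' y'] [/=]; rewrite !in_itv/= => /andP[? ?] /andP[? ?].
    apply: eA; split=> /=; rewrite /ball/= ltr_norml; apply/andP; split; lra.
  by split=> /=; rewrite in_itv/=; apply/andP; split; lra.
apply: bigcupT_measurable_rat => a; apply: bigcupT_measurable_rat => b.
rewrite bigcup_mkcond; apply: bigcupT_measurable_rat => r.
by case: ifP.
Qed.

Lemma continuous_plane_measurable f : continuous f ->
  measurable_fun [set: measurableTypeR R * measurableTypeR R] f.
Proof.
move=> /continuousP cf; apply: (measurability _ (RGenOpens.measurableE R)) => //.
move=> _ [_ [a [b ->] <-]]; rewrite setTI; apply: open_plane_measurable.
exact/cf/interval_open.
Qed.

Definition square L : set (R * R) := `[- L, L] `*` `[- L, L].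

Lemma squareP L (x y : R) : square L (x, y) <-> - L <= x <= L /\ - L <= y <= L.
Proof. by rewrite /square /= !in_itv. Qed.

Lemma square_compact L : compact (square L).
Proof. by apply: compact_setX; exact: segment_compact. Qed.

Lemma square_measurable L :
  measurable (square L : set (measurableTypeR R * measurableTypeR R)).
Proof. by apply: measurableX; exact: measurable_itv. Qed.

Lemma lebesgue_segment L : 0 <= L -> @lebesgue_measure R `[- L, L] = (2 * L)%:E.
Proof.
move=> L0; rewrite lebesgue_measure_itv/= lte_fin; case: ifPn => [_|].
  by rewrite -EFinD; congr EFin; ring.
rewrite -leNgt => L0x; have L00 : L = 0 by apply: le_anti; rewrite L0 andbT; lra.
by rewrite L00 mulr0.
Qed.

Lemma lebesgue2_square L : 0 <= L -> lebesgue2 R (square L) = ((2 * L) ^+ 2)%:E.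
Proof.
move=> L0.
rewrite -[LHS]/((@lebesgue_measure R \x @lebesgue_measure R)%E (square L)).
rewrite product_measure1E; [|exact: measurable_itv..].
by rewrite expr2 EFinM -lebesgue_segment.
Qed.

Lemma continuous_square_bounded f L : continuous f ->
  exists2 M, 0 < M & forall z, square L z -> `|f z| <= M.
Proof.
move=> cf.
have /compact_bounded[M [_ Mf]] : compact (f @` square L).
  apply: continuous_compact; last exact: square_compact.
  exact: continuous_subspaceT.
exists (`|M| + 1) => [|z zL]; first by rewrite ltr_wpDl.
by apply: Mf; [rewrite (le_lt_trans (ler_norm _))// ltrDl|exists z].
Qed.

Lemma continuous_square_integrable f L : 0 <= L -> continuous f ->
  (lebesgue2 R).-integrable (square L) (EFin \o f).
Proof.
move=> L0 cf; apply: measurable_bounded_integrable.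
- exact: square_measurable.
- by rewrite [X in (X < _)%E]lebesgue2_square// ltry.
- by apply: measurable_funTS; exact: continuous_plane_measurable.
- have [M _ fM] := continuous_square_bounded L cf.
  exists M; split; first by rewrite num_real.
  by move=> M1 MM1 z zL; exact: le_trans (fM _ zL) (ltW MM1).
Qed.

Lemma segment_integrable (h : R -> R) L : continuous h ->
  (@lebesgue_measure R).-integrable `[- L, L] (EFin \o h).
Proof.
move=> ch; apply: continuous_compact_integrable; first exact: segment_compact.
exact: continuous_subspaceT.
Qed.

Definition sqint L f : R := \int[lebesgue2 R]_(z in square L) f z.
Definition segint L (h : R -> R) : R := \int[lebesgue_measure]_(x in `[- L, L]) h x.

Lemma sqintD L f g : 0 <= L -> continuous f -> continuous g ->
  sqint L (fun z => f z + g z) = sqint L f + sqint L g.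
Proof.
move=> L0 cf cg; apply: RintegralD; first exact: square_measurable.
all: exact: continuous_square_integrable.
Qed.

Lemma sqintZ L f (c : R) : 0 <= L -> continuous f ->
  sqint L (fun z => c * f z) = c * sqint L f.
Proof.
move=> L0 cf; apply: RintegralZl; first exact: square_measurable.
exact: continuous_square_integrable.
Qed.

Lemma eq_sqint L f g : (forall z, square L z -> f z = g z) ->
  sqint L f = sqint L g.
Proof. by move=> fg; apply: eq_Rintegral => z /set_mem; exact: fg. Qed.

Lemma le_sqint L f g : 0 <= L -> continuous f -> continuous g ->
  (forall z, square L z -> f z <= g z) -> sqint L f <= sqint L g.
Proof.
move=> L0 cf cg fg; apply: le_Rintegral => //; first exact: square_measurable.
all: exact: continuous_square_integrable.
Qed.

Lemma sqint_ge0 L f : (forall z, square L z -> 0 <= f z) -> 0 <= sqint L f.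
Proof. by move=> f0; apply: Rintegral_ge0. Qed.

Lemma sqint_cst L (c : R) : 0 <= L -> sqint L (fun=> c) = c * (2 * L) ^+ 2.
Proof.
move=> L0; rewrite /sqint Rintegral_cst; last exact: square_measurable.
by congr (_ * _); rewrite [X in fine X]lebesgue2_square.
Qed.

Lemma norm_sqint L f : 0 <= L -> continuous f ->
  `|sqint L f| <= sqint L (fun z => `|f z|).
Proof.
move=> L0 cf; apply: le_normr_Rintegral; first exact: square_measurable.
exact: continuous_square_integrable.
Qed.

Lemma restrict_square L f (x y : R) : (f \_ (square L)) (x, y) =
  (if x \in `[- L, L]%classic then
     ((fun t => f (x, t)) \_ `[- L, L]%classic) y else 0).
Proof.
rewrite /patch /square; case: ifPn => [/set_mem[/=]|nxy].
  move=> xL yL; rewrite ifT ?inE//= ifT ?inE//.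
case: ifPn => // xL; case: ifPn => // yL; case/negP: nxy.
by rewrite inE; split; [exact: set_mem|exact: set_mem].
Qed.

Lemma restrict_square' L f (x y : R) : (f \_ (square L)) (x, y) =
  (if y \in `[- L, L]%classic then
     ((fun s => f (s, y)) \_ `[- L, L]%classic) x else 0).
Proof. by rewrite restrict_square /patch; case: ifP; case: ifP. Qed.

Let integrable_restrict_square L f : 0 <= L -> continuous f ->
  (lebesgue2 R).-integrable setT (EFin \o (f \_ (square L))).
Proof.
move=> L0 cf; have := continuous_square_integrable L0 cf.
rewrite (integrable_mkcond _ (square_measurable L)).
by rewrite restrict_EFin.
Qed.

Lemma sqint_iterated1 L f : 0 <= L -> continuous f ->
  sqint L f = segint L (fun x => segint L (fun y => f (x, y))).
Proof.
move=> L0 cf; rewrite /sqint Rintegral_mkcond /Rintegral.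
rewrite -(integral12_prod_meas1 (integrable_restrict_square L0 cf))/=.
rewrite /segint [RHS]Rintegral_mkcond /Rintegral; congr fine.
apply: eq_integral => x _; rewrite /fubini_F /patch/=.
have cfx : continuous (fun y => f (x, y)).
  by move=> y; apply: continuous_comp; [exact: cvg_pair (cvg_cst _) cvg_id|exact: cf].
case: ifPn => xL; last first.
  rewrite integral0_eq// => y _; rewrite -/(patch _ _ _ _).
  by rewrite -[X in (X)%:E]/((f \_ (square L)) (x, y)) restrict_square (negbTE xL).
rewrite fineK; last exact/integrable_fin_num/segment_integrable.
rewrite [RHS]integral_mkcond; apply: eq_integral => y _.
rewrite -[X in (X)%:E = _]/((f \_ (square L)) (x, y)) restrict_square xL.
by rewrite /patch; case: ifP.
Qed.

Lemma sqint_iterated2 L f : 0 <= L -> continuous f ->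
  sqint L f = segint L (fun y => segint L (fun x => f (x, y))).
Proof.
move=> L0 cf; rewrite /sqint Rintegral_mkcond /Rintegral.
rewrite -(integral21_prod_meas1 (integrable_restrict_square L0 cf))/=.
rewrite /segint [RHS]Rintegral_mkcond /Rintegral; congr fine.
apply: eq_integral => y _; rewrite /fubini_G /patch/=.
have cfy : continuous (fun x => f (x, y)).
  by move=> x; apply: continuous_comp; [exact: cvg_pair cvg_id (cvg_cst _)|exact: cf].
case: ifPn => yL; last first.
  rewrite integral0_eq// => x _.
  by rewrite -[X in (X)%:E]/((f \_ (square L)) (x, y)) restrict_square' (negbTE yL).
rewrite fineK; last exact/integrable_fin_num/segment_integrable.
rewrite [RHS]integral_mkcond; apply: eq_integral => x _.
rewrite -[X in (X)%:E = _]/((f \_ (square L)) (x, y)) restrict_square' yL.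
by rewrite /patch; case: ifP.
Qed.

End SquareIntegral.

(** * Slicewise derivatives, integration by parts and a Sobolev inequality on squares *)

Section SliceCalculus.
Context {R : realType}.
Implicit Types (f g : R * R -> R) (h : R -> R) (L : R).

(** Only [z] is confined to the square: [z'] may lie outside, as happens under the support of a
    mollifier centred near the boundary. Compactness enters as a covering argument in which the
    radius tends to zero from the right. *)
Lemma square_uniform_continuity f L : continuous f -> forall e : R, 0 < e ->
  exists2 d, 0 < d & forall z z', square L z ->
    `|z.1 - z'.1| < d -> `|z.2 - z'.2| < d -> `|f z - f z'| < e.
Proof.
move=> cf e e0.
have := (compact_near_coveringP (square L)).1 (@square_compact R L).
move=> /(_ R (0^'+) (fun d z => forall z', ball z d z' -> `|f z - f z'| < e)).
move=> /(_ _)[z zL|d /= d0 dP].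
  have e2 : 0 < e / 2 by exact: divr_gt0.
  have /cvgrPdist_lt/(_ _ e2)/nbhs_ballP[r /= r0 rP] := cf z.
  exists (ball z (r / 2), [set d | d < r / 2]) => /=.
    split; first by apply: nbhsx_ballx; exact: divr_gt0.
    by apply: nbhs_right_lt; exact: divr_gt0.
  move=> [z1 d] /= [zz1 dr] z2 z12.
  have b1 : ball z r z1 by apply: le_ball zz1; rewrite ler_pdivrMr//; lra.
  have b2 : ball z r z2.
    by rewrite (splitr r); apply: ball_triangle zz1 _; exact: le_ball (ltW dr) _ z12.
  have := rP _ b1; have := rP _ b2 => /= h2 h1.
  rewrite (_ : f z1 - f z2 = (f z - f z2) - (f z - f z1)); last by ring.
  by rewrite (le_lt_trans (ler_normB _ _))// (splitr e) ltrD.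
exists (d / 2); first exact: divr_gt0.
move=> z z' zL h1 h2; apply: (dP (d / 2)) zL _ _ => /=.
- by rewrite /ball/= sub0r normrN gtr0_norm ?divr_gt0// ltr_pdivrMr//; lra.
- exact: divr_gt0.
- by split.
Qed.

Lemma continuous_slice1 f y : continuous f -> continuous (fun x => f (x, y)).
Proof.
move=> cf x; apply: (@continuous_comp _ _ _ (fun x => (x, y)) f); last exact: cf.
exact: cvg_pair cvg_id (cvg_cst _).
Qed.

Lemma continuous_slice2 f x : continuous f -> continuous (fun y => f (x, y)).
Proof.
move=> cf y; apply: (@continuous_comp _ _ _ (fun y => (x, y)) f); last exact: cf.
exact: cvg_pair (cvg_cst _) cvg_id.
Qed.

Lemma integral_is_derive (h h' : R -> R) a b : a < b -> continuous h' ->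
  (forall x : R, is_derive x 1 h (h' x)) ->
  \int[lebesgue_measure]_(x in `[a, b]) h' x = h b - h a.
Proof.
move=> ab ch' hh'.
have ch : continuous h.
  move=> x; apply: differentiable_continuous; apply/derivable1_diffP.
  exact: ex_derive.
rewrite /Rintegral (@continuous_FTC2 _ h' h)//.
- exact: continuous_subspaceT.
- split; first by move=> x _; exact: ex_derive.
  + exact: cvg_at_right_filter (ch a).
  + exact: cvg_at_left_filter (ch b).
- by move=> x _; rewrite derive1E derive_val.
Qed.

Lemma segint_is_derive L h h' : 0 < L -> continuous h' ->
  (forall x : R, is_derive x 1 h (h' x)) -> segint L h' = h L - h (- L).
Proof. by move=> L0 ch hh'; apply: integral_is_derive => //; lra. Qed.

Lemma norm_le_segint L h h' x : 0 < L -> - L <= x <= L -> continuous h' ->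
  (forall x : R, is_derive x 1 h (h' x)) -> h (- L) = 0 ->
  `|h x| <= segint L (fun x => `|h' x|).
Proof.
move=> L0 /andP[Lx xL] ch hh' h0.
have cn : continuous (fun x => `|h' x|).
  by move=> t; apply: continuous_comp; [exact: ch|exact: norm_continuous].
have [->|xNL] := eqVneq x (- L).
  by rewrite h0 normr0; apply: Rintegral_ge0.
have {}Lx : - L < x by rewrite lt_neqAle eq_sym xNL.
have -> : h x = \int[lebesgue_measure]_(t in `[- L, x]) h' t.
  by rewrite (integral_is_derive Lx ch hh') h0 subr0.
have ii (k : R -> R) : continuous k ->
    lebesgue_measure.-integrable `[- L, x] (EFin \o k).
  move=> ck; apply: integrableS (segment_integrable L ck) => //.
  by apply: subset_itvl; rewrite bnd_simp.
apply: le_trans (le_normr_Rintegral _ (ii _ ch)) _ => //.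
rewrite /segint /Rintegral; apply: fine_le.
- exact/integrable_fin_num/ii.
- exact/integrable_fin_num/segment_integrable.
apply: ge0_subset_integral => //=.
- by apply/measurable_EFinP/measurable_funTS; exact: continuous_measurable_fun.
- by apply: subset_itvl; rewrite bnd_simp.
Qed.

Lemma segintZ L (c : R) h : continuous h ->
  segint L (fun x => c * h x) = c * segint L h.
Proof. by move=> ch; apply: RintegralZl => //; exact: segment_integrable. Qed.

Lemma eq_segint L h k : (forall x, - L <= x <= L -> h x = k x) ->
  segint L h = segint L k.
Proof. by move=> hk; apply: eq_Rintegral => x /set_mem/=; rewrite in_itv/=; exact: hk. Qed.

Lemma segint_cst L (c : R) : 0 <= L -> segint L (fun=> c) = c * (2 * L).
Proof.
move=> L0; rewrite /segint Rintegral_cst//.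
by rewrite -[2 * L]/(fine (2 * L)%:E) -(lebesgue_segment L0).
Qed.

Lemma le_segint L h k : continuous h -> continuous k ->
  (forall x, - L <= x <= L -> h x <= k x) -> segint L h <= segint L k.
Proof.
move=> ch ck hk; apply: le_Rintegral => //; try exact: segment_integrable.
Qed.

Lemma segintB L h k : continuous h -> continuous k ->
  segint L (fun x => h x - k x) = segint L h - segint L k.
Proof. by move=> ch ck; apply: RintegralB => //; exact: segment_integrable. Qed.

Lemma norm_segint_le L h (c : R) : 0 <= L -> continuous h ->
  (forall x, - L <= x <= L -> `|h x| <= c) -> `|segint L h| <= c * (2 * L).
Proof.
move=> L0 ch hc.
apply: le_trans (le_normr_Rintegral _ (segment_integrable L ch)) _ => //.
rewrite -segint_cst//; apply: le_segint => //; last by move=> x; exact: cvg_cst.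
by move=> t; apply: continuous_comp; [exact: ch|exact: norm_continuous].
Qed.

Lemma continuous_swap f : continuous f -> continuous (fun z => f (z.2, z.1)).
Proof.
move=> cf z; apply: (@continuous_comp _ _ _ (fun z => (z.2, z.1)) f); last exact: cf.
exact: (cvg_pair cvg_snd cvg_fst).
Qed.

Lemma continuous_segint L f : 0 <= L -> continuous f ->
  continuous (fun x => segint L (fun y => f (x, y))).
Proof.
move=> L0 cf x; apply/cvgrPdist_lt => e e0.
pose M := `|x| + L; have M0 : 0 <= M by rewrite addr_ge0.
have eL : 0 < e / (2 * L + 1) by rewrite divr_gt0//; lra.
have [d d0 dP] := square_uniform_continuity M cf eL.
near=> t.
have tx : `|x - t| < d by near: t; exists d.
rewrite -segintB; [|exact: continuous_slice2..].
apply: (@le_lt_trans _ _ (e / (2 * L + 1) * (2 * L))).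
  apply: norm_segint_le => //.
    by move=> y; apply: cvgB; exact: continuous_slice2.
  move=> y yL; apply/ltW; apply: dP => //=; last by rewrite subrr normr0.
  apply/squareP; rewrite /M; split.
    have := ler_norm x; have := ler_norm (- x); rewrite normrN => ? ?.
    by apply/andP; split; lra.
  by have := normr_ge0 x; move: yL => /andP[? ?] ?; apply/andP; split; lra.
rewrite mulrAC ltr_pdivrMr; last lra.
by rewrite ltr_pM2l//; lra.
Unshelve. all: by end_near. Qed.

Lemma continuous_segint2 L f : 0 <= L -> continuous f ->
  continuous (fun y => segint L (fun x => f (x, y))).
Proof.
by move=> L0 /continuous_swap cf; exact: (@continuous_segint L _ L0 cf).
Qed.

(* [d1 f f'] and [d2 f f'] say that [f'] is the partial derivative of [f] in the
   first, resp. second, variable; [f] need not be differentiable as a function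
   of the pair. *)
Definition d1 f f' := forall x y : R, is_derive x 1 (fun s => f (s, y)) (f' (x, y)).
Definition d2 f f' := forall x y : R, is_derive y 1 (fun t => f (x, t)) (f' (x, y)).

Definition vanishes_on_boundary L f := forall s, - L <= s <= L ->
  [/\ f (L, s) = 0, f (- L, s) = 0, f (s, L) = 0 & f (s, - L) = 0].

Lemma sqint_d1 L f f' : 0 < L -> continuous f' -> d1 f f' ->
  vanishes_on_boundary L f -> sqint L f' = 0.
Proof.
move=> L0 cf' ff' f0; rewrite sqint_iterated2 ?ltW//.
rewrite (@eq_segint _ _ (fun=> 0)) ?segint_cst ?mul0r ?ltW// => y yL.
rewrite (segint_is_derive L0 (continuous_slice1 cf') (fun x => ff' x y)).
by have [-> ->] := f0 _ yL; rewrite subrr.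
Qed.

Lemma sqint_d2 L f f' : 0 < L -> continuous f' -> d2 f f' ->
  vanishes_on_boundary L f -> sqint L f' = 0.
Proof.
move=> L0 cf' ff' f0; rewrite sqint_iterated1 ?ltW//.
rewrite (@eq_segint _ _ (fun=> 0)) ?segint_cst ?mul0r ?ltW// => x xL.
rewrite (segint_is_derive L0 (continuous_slice2 cf') (fun y => ff' x y)).
by have [_ _ -> ->] := f0 _ xL; rewrite subrr.
Qed.

Lemma continuous_normfun (T : topologicalType) (f : T -> R) :
  continuous f -> continuous (fun z => `|f z|).
Proof. by move=> cf z; apply: continuous_comp; [exact: cf|exact: norm_continuous]. Qed.

(* The Gagliardo-Nirenberg embedding of W^{1,1} into L^2. *)
Lemma sqint_sqr_le L f f1 f2 : 0 < L -> continuous f -> continuous f1 -> continuous f2 ->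
  d1 f f1 -> d2 f f2 -> vanishes_on_boundary L f ->
  sqint L (fun z => f z ^+ 2) <=
  sqint L (fun z => `|f1 z|) * sqint L (fun z => `|f2 z|).
Proof.
move=> L0 cf cf1 cf2 df1 df2 f0; have L0' := ltW L0.
pose a y := segint L (fun x => `|f1 (x, y)|).
pose b x := segint L (fun y => `|f2 (x, y)|).
have ca : continuous a.
  exact: (continuous_segint2 L0' (continuous_normfun cf1)).
have cb : continuous b.
  exact: (continuous_segint L0' (continuous_normfun cf2)).
have cab : continuous (fun z : R * R => a z.2 * b z.1).
  move=> z; apply: cvgM.
    by apply: (@continuous_comp _ _ _ snd a); [exact: cvg_snd|exact: ca].
  by apply: (@continuous_comp _ _ _ fst b); [exact: cvg_fst|exact: cb].
apply: (@le_trans _ _ (sqint L (fun z => a z.2 * b z.1))).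
  apply: le_sqint => //; first by move=> z; apply: cvgM; exact: cf.
  move=> [x y] /squareP[xL yL]; rewrite -real_normK ?num_real//=.
  rewrite expr2; apply: ler_pM => //.
  - apply: (@norm_le_segint L (fun x => f (x, y)) (fun x => f1 (x, y))) => //.
      exact: continuous_slice1.
    by have [] := f0 _ yL.
  - apply: (@norm_le_segint L (fun y => f (x, y)) (fun y => f2 (x, y))) => //.
      exact: continuous_slice2.
    by have [] := f0 _ xL.
rewrite [X in _ <= X * _]sqint_iterated2//; last exact: continuous_normfun.
rewrite [X in _ <= _ * X]sqint_iterated1//; last exact: continuous_normfun.
rewrite sqint_iterated2//= -/a.
rewrite [X in X <= _](_ : _ = segint L (fun y => segint L b * a y)).
  by rewrite (segintZ _ _ ca) mulrC.
by apply: eq_segint => y _; rewrite segintZ// mulrC.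
Qed.

End SliceCalculus.

(** * Weighted energy inequalities *)

Section Combinators.
Context {R : realType}.
Implicit Types (f g : R * R -> R) (L : R).

Lemma contD (T : topologicalType) (f g : T -> R) : continuous f -> continuous g -> continuous (fun z => f z + g z).
Proof. by move=> cf cg z; apply: cvgD; [exact: cf|exact: cg]. Qed.

Lemma contB (T : topologicalType) (f g : T -> R) : continuous f -> continuous g -> continuous (fun z => f z - g z).
Proof. by move=> cf cg z; apply: cvgB; [exact: cf|exact: cg]. Qed.

Lemma contN (T : topologicalType) (f : T -> R) : continuous f -> continuous (fun z => - f z).
Proof. by move=> cf z; apply: cvgN; exact: cf. Qed.

Lemma contM (T : topologicalType) (f g : T -> R) : continuous f -> continuous g -> continuous (fun z => f z * g z).
Proof. by move=> cf cg z; apply: cvgM; [exact: cf|exact: cg]. Qed.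

Lemma contX (T : topologicalType) (f : T -> R) n : continuous f -> continuous (fun z => f z ^+ n).
Proof.
move=> cf; elim: n => [|n ih].
  by rewrite (_ : (fun z => _) = cst 1); [move=> z; exact: cvg_cst|apply/funext => z; rewrite expr0].
rewrite (_ : (fun z => _) = fun z => f z * f z ^+ n); first exact: contM.
by apply/funext => z; rewrite exprS.
Qed.

Lemma contC (T : topologicalType) (c : R) : continuous (fun _ : T => c).
Proof. by move=> z; exact: cvg_cst. Qed.

Lemma cont_comp (T : topologicalType) (h : R -> R) (f : T -> R) :
  continuous h -> continuous f -> continuous (fun z => h (f z)).
Proof. by move=> ch cf z; apply: continuous_comp; [exact: cf|exact: ch]. Qed.

Lemma is_deriveMf (x a b : R) (f g : R -> R) : is_derive x 1 f a -> is_derive x 1 g b ->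
  is_derive x 1 (fun s => f s * g s) (a * g x + f x * b).
Proof.
move=> fa gb; have := @is_deriveM _ _ f g x 1 a b fa gb.
by rewrite addrC /GRing.scale/= [g x * a]mulrC.
Qed.

Lemma is_deriveDf (x a b : R) (f g : R -> R) : is_derive x 1 f a -> is_derive x 1 g b ->
  is_derive x 1 (fun s => f s + g s) (a + b).
Proof. by move=> fa gb; exact: (@is_deriveD _ _ _ f g x 1 a b fa gb). Qed.

Lemma d1_ext f f' g' : (forall z, f' z = g' z) -> d1 f f' -> d1 f g'.
Proof. by move=> /funext <-. Qed.
Lemma d2_ext f f' g' : (forall z, f' z = g' z) -> d2 f f' -> d2 f g'.
Proof. by move=> /funext <-. Qed.

Lemma d1M f f' g g' : d1 f f' -> d1 g g' ->
  d1 (fun z => f z * g z) (fun z => f' z * g z + f z * g' z).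
Proof. by move=> df dg x y; exact: is_deriveMf (df x y) (dg x y). Qed.
Lemma d2M f f' g g' : d2 f f' -> d2 g g' ->
  d2 (fun z => f z * g z) (fun z => f' z * g z + f z * g' z).
Proof. by move=> df dg x y; exact: is_deriveMf (df x y) (dg x y). Qed.
Lemma d1D f f' g g' : d1 f f' -> d1 g g' ->
  d1 (fun z => f z + g z) (fun z => f' z + g' z).
Proof. by move=> df dg x y; exact: is_deriveDf (df x y) (dg x y). Qed.
Lemma d2D f f' g g' : d2 f f' -> d2 g g' ->
  d2 (fun z => f z + g z) (fun z => f' z + g' z).
Proof. by move=> df dg x y; exact: is_deriveDf (df x y) (dg x y). Qed.
Lemma d1C (c : R) : d1 (fun _ : R * R => c) (fun=> 0).
Proof. by move=> x y; exact: is_derive_cst. Qed.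
Lemma d2C (c : R) : d2 (fun _ : R * R => c) (fun=> 0).
Proof. by move=> x y; exact: is_derive_cst. Qed.

Lemma d1Z (c : R) f f' : d1 f f' -> d1 (fun z => c * f z) (fun z => c * f' z).
Proof.
by move=> df; apply: d1_ext (d1M (d1C c) df) => z; rewrite mul0r add0r.
Qed.
Lemma d2Z (c : R) f f' : d2 f f' -> d2 (fun z => c * f z) (fun z => c * f' z).
Proof.
by move=> df; apply: d2_ext (d2M (d2C c) df) => z; rewrite mul0r add0r.
Qed.
Lemma d1B f f' g g' : d1 f f' -> d1 g g' ->
  d1 (fun z => f z - g z) (fun z => f' z - g' z).
Proof.
move=> df dg; have := d1D df (d1Z (-1) dg).
rewrite (_ : (fun z => f z + _) = (fun z => f z - g z)); last by apply/funext => z; ring.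
by apply: d1_ext => z; ring.
Qed.
Lemma d2B f f' g g' : d2 f f' -> d2 g g' ->
  d2 (fun z => f z - g z) (fun z => f' z - g' z).
Proof.
move=> df dg; have := d2D df (d2Z (-1) dg).
rewrite (_ : (fun z => f z + _) = (fun z => f z - g z)); last by apply/funext => z; ring.
by apply: d2_ext => z; ring.
Qed.

Lemma d1X f f' n : d1 f f' ->
  d1 (fun z => f z ^+ n.+1) (fun z => n.+1%:R * f z ^+ n * f' z).
Proof.
move=> df; elim: n => [|n ih]; first by apply: d1_ext df => z; rewrite expr0 !mul1r.
rewrite (_ : (fun z => f z ^+ n.+2) = (fun z => f z * f z ^+ n.+1)); last by apply/funext => z; rewrite exprS.
apply: d1_ext (d1M df ih) => z; rewrite [in RHS](natrD _ 1 n.+1).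
by rewrite !exprS; ring.
Qed.
Lemma d2X f f' n : d2 f f' ->
  d2 (fun z => f z ^+ n.+1) (fun z => n.+1%:R * f z ^+ n * f' z).
Proof.
move=> df; elim: n => [|n ih]; first by apply: d2_ext df => z; rewrite expr0 !mul1r.
rewrite (_ : (fun z => f z ^+ n.+2) = (fun z => f z * f z ^+ n.+1)); last by apply/funext => z; rewrite exprS.
apply: d2_ext (d2M df ih) => z; rewrite [in RHS](natrD _ 1 n.+1).
by rewrite !exprS; ring.
Qed.

Lemma d1_comp (h h' : R -> R) f f' : (forall x : R, is_derive x 1 h (h' x)) -> d1 f f' ->
  d1 (fun z => h (f z)) (fun z => h' (f z) * f' z).
Proof.
by move=> dh df x y; exact: (@is_derive1_comp _ h (fun s => f (s, y)) x _ _ (dh _) (df x y)).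
Qed.
Lemma d2_comp (h h' : R -> R) f f' : (forall x : R, is_derive x 1 h (h' x)) -> d2 f f' ->
  d2 (fun z => h (f z)) (fun z => h' (f z) * f' z).
Proof.
by move=> dh df x y; exact: (@is_derive1_comp _ h (fun s => f (x, s)) y _ _ (dh _) (df x y)).
Qed.

Lemma cont_fst : continuous (fun z : R * R => z.1).
Proof. by move=> z; exact: cvg_fst. Qed.
Lemma cont_snd : continuous (fun z : R * R => z.2).
Proof. by move=> z; exact: cvg_snd. Qed.

Lemma d1_fst : d1 (fun z : R * R => z.1) (fun=> 1).
Proof. by move=> x y; exact: is_derive_id. Qed.
Lemma d2_fst : d2 (fun z : R * R => z.1) (fun=> 0).
Proof. by move=> x y; exact: is_derive_cst. Qed.
Lemma d1_snd : d1 (fun z : R * R => z.2) (fun=> 0).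
Proof. by move=> x y; exact: is_derive_cst. Qed.
Lemma d2_snd : d2 (fun z : R * R => z.2) (fun=> 1).
Proof. by move=> x y; exact: is_derive_id. Qed.

End Combinators.

Ltac cont := cbn beta;
  lazymatch goal with
  | h : continuous ?f |- continuous (fun z => ?f z) => exact: h
  | |- continuous (fun z => - @?f z)%R => apply: (contN (f := f)); cont
  | |- continuous (fun z => @?f z + - @?g z)%R => apply: (contB (f := f) (g := g)); cont
  | |- continuous (fun z => @?f z + @?g z)%R => apply: (contD (f := f) (g := g)); cont
  | |- continuous (fun z => @?f z * @?g z)%R => apply: (contM (f := f) (g := g)); cont
  | |- continuous (fun z => @?f z ^+ ?n)%R => apply: (contX (f := f) (n := n)); cont
  | |- continuous (fun z => `|@?f z|)%R => apply: (continuous_normfun (f := f)); cont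
  | |- continuous (fun z => z.1) => exact: cont_fst
  | |- continuous (fun z => z.2) => exact: cont_snd
  | |- continuous (fun z => ?c) => first [assumption | exact: contC]
  | |- continuous _ => assumption
  end.

(** * The polynomial weight *)

Section Weight.
Context {R : realType}.
Implicit Types (f g : R * R -> R) (L : R).

(** A polynomial serves as cut-off because every integration by parts takes place on the square
    itself and needs only zero boundary values. Its gradient is of order [1 / L] and it stays above
    [1 / 2] on the square of half the size. *)
Definition weight L (z : R * R) : R := (1 - (z.1 / L) ^+ 2) * (1 - (z.2 / L) ^+ 2).
Definition weight1 L (z : R * R) : R := - (2 * z.1 / L ^+ 2) * (1 - (z.2 / L) ^+ 2).
Definition weight2 L (z : R * R) : R := - (2 * z.2 / L ^+ 2) * (1 - (z.1 / L) ^+ 2).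

Lemma cont_weight L : continuous (weight L).
Proof. by rewrite /weight; cont. Qed.
Lemma cont_weight1 L : continuous (weight1 L).
Proof. by rewrite /weight1; cont. Qed.
Lemma cont_weight2 L : continuous (weight2 L).
Proof. by rewrite /weight2; cont. Qed.

Lemma d1_weight L : d1 (weight L) (weight1 L).
Proof.
have h : d1 (fun z => 1 - (z.1 * L^-1) ^+ 2) (fun z => - (2 * z.1 / L ^+ 2)).
  have := d1B (d1C 1) (@d1X _ _ _ 1 (d1M d1_fst (d1C L^-1))).
  apply: d1_ext => z; rewrite -exprVn; ring.
have k : d1 (fun z => 1 - (z.2 * L^-1) ^+ 2) (fun=> 0).
  have := d1B (d1C 1) (@d1X _ _ _ 1 (d1M d1_snd (d1C L^-1))).
  by apply: d1_ext => z; ring.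
by apply: d1_ext (d1M h k) => z; rewrite /weight1; ring.
Qed.

Lemma d2_weight L : d2 (weight L) (weight2 L).
Proof.
have h : d2 (fun z => 1 - (z.2 * L^-1) ^+ 2) (fun z => - (2 * z.2 / L ^+ 2)).
  have := d2B (d2C 1) (@d2X _ _ _ 1 (d2M d2_snd (d2C L^-1))).
  apply: d2_ext => z; rewrite -exprVn; ring.
have k : d2 (fun z => 1 - (z.1 * L^-1) ^+ 2) (fun=> 0).
  have := d2B (d2C 1) (@d2X _ _ _ 1 (d2M d2_fst (d2C L^-1))).
  by apply: d2_ext => z; ring.
by apply: d2_ext (d2M k h) => z; rewrite /weight2; ring.
Qed.

Lemma weight_boundary L : 0 < L -> vanishes_on_boundary L (weight L).
Proof.
move=> L0 s _; have LL : L / L = 1 by rewrite divff// gt_eqF.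
have LN : - L / L = -1 by rewrite mulNr LL.
by rewrite /weight/= LL LN sqrrN expr1n subrr !(mul0r, mulr0).
Qed.

Lemma weightX_boundary L n f : 0 < L ->
  vanishes_on_boundary L (fun z => weight L z ^+ n.+1 * f z).
Proof.
by move=> L0 s /(weight_boundary L0)[-> -> -> ->]; rewrite expr0n/= !mul0r.
Qed.

Lemma weight_bounds L z : 0 < L -> square L z ->
  [/\ 0 <= weight L z <= 1, `|weight1 L z| <= 2 / L & `|weight2 L z| <= 2 / L].
Proof.
move=> L0; case: z => x y /squareP[xL yL].
have sc (t : R) : - L <= t <= L -> 0 <= 1 - (t / L) ^+ 2 <= 1 /\ `|- (2 * t / L ^+ 2)| <= 2 / L.
  move=> /andP[tL Lt]; have tL1 : `|t / L| <= 1.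
    by rewrite normrM normfV (gtr0_norm L0) ler_pdivrMr// mul1r ler_norml tL.
  split.
    rewrite lerBlDr lerDl sqr_ge0 andbT subr_ge0 -real_normK ?num_real//.
    by rewrite expr_le1.
  rewrite normrN (_ : 2 * t / L ^+ 2 = 2 / L * (t / L)); last by field; rewrite gt_eqF.
  by rewrite normrM ger0_norm ?ler_piMr// divr_ge0// ltW.
have [/andP[x0 x1] x2] := sc _ xL; have [/andP[y0 y1] y2] := sc _ yL.
split; rewrite /weight /weight1 /weight2/=.
- by rewrite mulr_ge0//= mulr_ile1.
- by rewrite normrM (ger0_norm y0) -[leRHS]mulr1 ler_pM.
- by rewrite normrM (ger0_norm x0) -[leRHS]mulr1 ler_pM.
Qed.

End Weight.

(** * Pointwise inequalities behind the energy estimates *)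

Section Pointwise.
Context {R : realType}.
Implicit Types (a t l : R).

Lemma young_mul (s x y : R) : 0 < s -> 2 * x * y <= s * x ^+ 2 + y ^+ 2 / s.
Proof.
move=> s0; rewrite -subr_ge0.
rewrite (_ : _ - _ = (s * x - y) ^+ 2 / s); first by rewrite divr_ge0 ?sqr_ge0// ltW.
by field; rewrite gt_eqF.
Qed.

Lemma young_mulN (s x y : R) : 0 < s -> - (2 * x * y) <= s * x ^+ 2 + y ^+ 2 / s.
Proof. by move=> s0; have := young_mul (- x) y s0; rewrite sqrrN; lra. Qed.

(** With [a] standing for [t ^+ n], the powers of the weight become monomials in [a] and [t]. The
    inequalities below are then polynomial and hold for all [n] at once. *)
Lemma weight_pow (t : R) k n j : t ^+ (k * n + j) = (t ^+ n) ^+ k * t ^+ j.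
Proof. by rewrite exprD mulnC exprM. Qed.

Lemma norm_sqr_le (x y : R) : `|x| <= y -> x ^+ 2 <= y ^+ 2.
Proof.
move=> xy; rewrite -real_normK ?num_real// ler_pXn2r// nnegrE//.
exact: le_trans xy.
Qed.

Lemma mul_sqr_le (x y : R) : 0 <= x <= 1 -> (x * y) ^+ 2 <= y ^+ 2.
Proof.
by move=> /andP[x0 x1]; rewrite exprMn ler_piMl ?sqr_ge0// expr_le1.
Qed.

(** With [a ^+ 4 * t ^+ 2] the weight and [r] the Laplacian of [f], the bracket is the expanded
    divergence of weight times [f * grad f], which integrates to zero. It is taken twice because one
    copy of the gradient term is spent on the product with the derivative of the weight. *)
Lemma gradient_pointwise a t t1 t2 l k s f f1 f2 r : 0 <= a <= 1 -> 0 <= t <= 1 ->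
  `|t1| <= l -> `|t2| <= l -> 0 < s -> 0 <= k ->
  a ^+ 4 * t ^+ 2 * (f1 ^+ 2 + f2 ^+ 2) <=
  2 * (a ^+ 4 * t ^+ 2 * (f1 ^+ 2 + f2 ^+ 2) + a ^+ 4 * t ^+ 2 * (f * r) +
       k * (a ^+ 4 * t) * f * (t1 * f1 + t2 * f2)) +
  (s * (a ^+ 6 * t ^+ 4 * r ^+ 2) + (1 / s + 2 * (k * l) ^+ 2) * (a ^+ 2 * f ^+ 2)).
Proof.
move=> a01 t01 /norm_sqr_le h1 /norm_sqr_le h2 s0 k0.
have y1 := young_mulN (a ^+ 3 * t ^+ 2 * r) (a * f) s0.
have y2 := young_mulN (a ^+ 2 * t * f1) (a * (k * (a * f) * t1)) ltr01.
have y3 := young_mulN (a ^+ 2 * t * f2) (a * (k * (a * f) * t2)) ltr01.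
rewrite divr1 mul1r in y2; rewrite divr1 mul1r in y3.
have z1 := mul_sqr_le (k * (a * f) * t1) a01.
have z2 := mul_sqr_le (k * (a * f) * t2) a01.
have q0 : 0 <= (k * (a * f)) ^+ 2 by exact: sqr_ge0.
have u1 := ler_wpM2l q0 h1; have u2 := ler_wpM2l q0 h2.
rewrite -exprMn in u1; rewrite -exprMn in u2.
move: (s^-1) y1 => si y1.
move: z1 z2 y1 y2 y3 u1 u2; clear; lra.
Qed.

(** The left side is a partial derivative of [theta ^+ (5n+3) * w ^+ 2]. The exponent is the mean of
    [6n+4] and [4n+2], so Young's inequality produces exactly the integrands of [D] and [W]. *)
Lemma quartic_pointwise a t t1 l k r w w1 : 0 <= a <= 1 -> `|t1| <= l ->
  0 < r -> 0 <= k ->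
  `|k * (a ^+ 5 * t ^+ 2) * t1 * w ^+ 2 + a ^+ 5 * t ^+ 3 * (2 * w * w1)| <=
  r * (a ^+ 6 * t ^+ 4 * w1 ^+ 2) + (1 / r + k * l) * (a ^+ 4 * t ^+ 2 * w ^+ 2).
Proof.
move=> /andP[a0 a1] h1 r0 k0.
have y1 := young_mul (a ^+ 3 * t ^+ 2 * w1) (a ^+ 2 * t * w) r0.
have y2 := young_mulN (a ^+ 3 * t ^+ 2 * w1) (a ^+ 2 * t * w) r0.
have u0 : 0 <= k * (a ^+ 2 * t * w) ^+ 2 by rewrite mulr_ge0 ?sqr_ge0.
have h : `|a * t1| <= l.
  by rewrite normrM ger0_norm// (le_trans _ h1)// ler_piMl.
move: h; rewrite !ler_norml => /andP[/(ler_wpM2l u0) v1 /(ler_wpM2l u0) v2].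
move: (r^-1) y1 y2 v1 v2 => ri; clear.
by move=> *; apply/andP; split; lra.
Qed.

(** The left side is a partial derivative of [theta ^+ (2n+2) * G(f)]. As [|G|] is at most
    [|f| * g], both terms contain the factor [g], and Young's inequality splits off [g ^+ 2] without
    weight. *)
Lemma trunc_pointwise a t t1 l k r f f1 g G : 0 <= a <= 1 -> 0 <= t <= 1 ->
  `|t1| <= l -> 0 < r -> 0 <= k -> 0 <= g -> `|G| <= `|f| * g ->
  `|k * (a ^+ 2 * t) * t1 * G + a ^+ 2 * t ^+ 2 * (g * f1)| <=
  r * g ^+ 2 + (a ^+ 4 * t ^+ 2 * f1 ^+ 2 + (k * l) ^+ 2 * (a ^+ 2 * f ^+ 2)) / r.
Proof.
move=> a01 t01 h1 r0 k0 g0 hG.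
have /andP[a0 a1] := a01; have /andP[t0 t1'] := t01.
have l0 : 0 <= l by exact: le_trans h1.
apply: le_trans (ler_normD _ _) _.
have e1 : `|k * (a ^+ 2 * t) * t1 * G| <= g * (k * (a * (t * a)) * l * `|f|).
  rewrite !normrM (ger0_norm k0) (ger0_norm t0) (ger0_norm a0).
  rewrite (_ : g * _ = k * (a * a * t) * l * (`|f| * g)); last by ring.
  by apply: ler_pM => //; rewrite ?mulr_ge0//; apply: ler_wpM2l; rewrite ?mulr_ge0.
have e2 : `|a ^+ 2 * t ^+ 2 * (g * f1)| <= g * `|t * (a ^+ 2 * t * f1)|.
  rewrite (_ : a ^+ 2 * _ * _ = g * (t * (a ^+ 2 * t * f1))); last by ring.
  by rewrite normrM (ger0_norm g0).
have y1 := young_mul g (k * (a * (t * a)) * l * `|f|) r0.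
have y2 := young_mul g (`|t * (a ^+ 2 * t * f1)|) r0.
rewrite real_normK ?num_real// in y2.
have z2 := mul_sqr_le (a ^+ 2 * t * f1) t01.
have ta : 0 <= t * a <= 1 by rewrite mulr_ge0//= mulr_ile1.
have z1 := mul_sqr_le (k * l * (a * `|f|)) ta.
have fn : (a * `|f|) ^+ 2 = a ^+ 2 * f ^+ 2 by rewrite exprMn real_normK ?num_real.
have ri0 : 0 <= r^-1 by rewrite invr_ge0 ltW.
have u1 := ler_wpM2r ri0 z1; have u2 := ler_wpM2r ri0 z2.
rewrite (_ : k * (a * (t * a)) * l * `|f| = t * a * (k * l * (a * `|f|))) in y1 e1; last by ring.
rewrite (exprMn _ (k * l)) fn in u1.
have p1 : 0 <= (a ^+ 2 * t * f1) ^+ 2 / r by apply: mulr_ge0 => //; exact: sqr_ge0.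
have p2 : 0 <= (k * l) ^+ 2 * (a ^+ 2 * f ^+ 2) / r.
  by apply: mulr_ge0 => //; rewrite -fn mulr_ge0 ?sqr_ge0.
move: e1 e2 y1 y2 u1 u2 p1 p2; move: (r^-1) (t * a * (k * l * (a * `|f|))) `|t * (a ^+ 2 * t * f1)| (`|f|) => ri A B nf.
move: `|_ * _| `|_ * _| ((t * (a ^+ 2 * t * f1)) ^+ 2) => D E F; clear; lra.
Qed.

(** The bracket is the expanded divergence of [theta ^+ m * (w grad w - w p + w ^+ 2 v / 2)] with
    [p = v w + e]. The last summand cancels the convective term [w v . grad w]; the velocity
    survives only next to the gradient of the weight, that is with a factor [l] of order [1 / L]. *)
Lemma vorticity_pointwise a t t1 t2 l m w w1 w2 v1 v2 e1 e2 lap dphi :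
  0 <= a <= 1 -> 0 <= t <= 1 -> `|t1| <= l -> `|t2| <= l -> 0 <= m ->
  lap = dphi ->
  a ^+ 6 * t ^+ 4 * (w1 ^+ 2 + w2 ^+ 2) <=
  2 * ((a ^+ 6 * t ^+ 4 * (w1 ^+ 2 + w2 ^+ 2) + a ^+ 6 * t ^+ 4 * (w * lap) +
        m * (a ^+ 6 * t ^+ 3) * w * (t1 * w1 + t2 * w2))
     - (a ^+ 6 * t ^+ 4 * (w * dphi) +
        a ^+ 6 * t ^+ 4 * (w1 * (v1 * w + e1) + w2 * (v2 * w + e2)) +
        m * (a ^+ 6 * t ^+ 3) * w * (t1 * (v1 * w + e1) + t2 * (v2 * w + e2)))
     + (a ^+ 6 * t ^+ 4 * (w * (w1 * v1 + w2 * v2)) +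
        m * (a ^+ 6 * t ^+ 3) * w ^+ 2 * (t1 * v1 + t2 * v2) / 2)) +
  (6 * (m * l) ^+ 2 * (a ^+ 4 * t ^+ 2 * w ^+ 2) + 3 * (e1 ^+ 2 + e2 ^+ 2) +
   m * l * (a ^+ 6 * t ^+ 3 * ((`|v1| + `|v2|) * w ^+ 2))).
Proof.
move=> a01 t01 h1 h2 m0 ->.
have /andP[a0 a1] := a01; have /andP[t0 t1'] := t01.
set P1 := a ^+ 3 * t ^+ 2 * w1; set P2 := a ^+ 3 * t ^+ 2 * w2.
set S1 := a * (m * (a ^+ 2 * t * w) * t1); set S2 := a * (m * (a ^+ 2 * t * w) * t2).
set f1 := a ^+ 3 * t ^+ 2 * e1; set f2 := a ^+ 3 * t ^+ 2 * e2.
have half0 : 0 < 1 / 2 :> R by lra.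
have y1 := young_mulN P1 S1 half0; have y2 := young_mulN P2 S2 half0.
have y3 := young_mul P1 f1 half0; have y4 := young_mul P2 f2 half0.
have y5 := young_mul S1 f1 ltr01; have y6 := young_mul S2 f2 ltr01.
have at1 : 0 <= a ^+ 3 * t ^+ 2 <= 1.
  by rewrite mulr_ge0 ?exprn_ge0//= mulr_ile1 ?exprn_ge0// expr_le1.
have z1 : f1 ^+ 2 <= e1 ^+ 2 by exact: mul_sqr_le.
have z2 : f2 ^+ 2 <= e2 ^+ 2 by exact: mul_sqr_le.
have q0 : 0 <= (m * (a ^+ 2 * t * w)) ^+ 2 by exact: sqr_ge0.
have s1 : S1 ^+ 2 <= (m * (a ^+ 2 * t * w)) ^+ 2 * l ^+ 2.
  apply: le_trans (mul_sqr_le _ a01) _; rewrite exprMn.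
  by apply: ler_wpM2l => //; exact: norm_sqr_le.
have s2 : S2 ^+ 2 <= (m * (a ^+ 2 * t * w)) ^+ 2 * l ^+ 2.
  apply: le_trans (mul_sqr_le _ a01) _; rewrite exprMn.
  by apply: ler_wpM2l => //; exact: norm_sqr_le.
have c0 : 0 <= m * (a ^+ 6 * t ^+ 3) * w ^+ 2 by nonneg.
have tv (x y : R) : `|x| <= l -> x * y <= l * `|y|.
  move=> xl; apply: le_trans (ler_norm _) _.
  by rewrite normrM; apply: ler_wpM2r.
have c1 := ler_wpM2l c0 (tv _ v1 h1); have c2 := ler_wpM2l c0 (tv _ v2 h2).
move: y1 y2 y3 y4 y5 y6 z1 z2 s1 s2 c1 c2; rewrite !divr1 !mul1r.
rewrite /P1 /P2 /S1 /S2 /f1 /f2; move: `|v1| `|v2| => n1 n2; clear.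
rewrite !invrK; lra.
Qed.

(** Where [|x|] is below [4 * delta] it is simply replaced by that number. Elsewhere Young's
    inequality separates [a * |x|] from [a ^+ 5 * t ^+ 3 * w ^+ 2], and the second alternative
    bounds the square of the former. *)
Lemma convective_pointwise a t s tau delta x w g G : 0 <= a <= 1 -> 0 <= t <= 1 ->
  0 < s -> 0 < tau -> 0 <= delta ->
  (`|x| <= 4 * delta \/
   a ^+ 2 * x ^+ 2 <= 64 * (tau * (a ^+ 4 * t ^+ 4 * G ^+ 2) + g ^+ 2 / tau)) ->
  a ^+ 6 * t ^+ 3 * (`|x| * w ^+ 2) <= 4 * delta * (a ^+ 4 * t ^+ 2 * w ^+ 2) +
    64 * s * (tau * (a ^+ 4 * t ^+ 4 * G ^+ 2) + g ^+ 2 / tau) +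
    a ^+ 10 * t ^+ 6 * w ^+ 4 / s.
Proof.
move=> a01 t01 s0 tau0 de0.
have /andP[a0 a1] := a01; have /andP[t0 t1'] := t01.
set B := tau * _ + _.
have B0 : 0 <= B by rewrite /B; nonneg.
have sB : 0 <= 64 * s * B by nonneg.
have q0 : 0 <= a ^+ 10 * t ^+ 6 * w ^+ 4 / s.
  rewrite (_ : w ^+ 4 = (w ^+ 2) ^+ 2); last by ring.
  by nonneg.
have u0 : 0 <= a ^+ 4 * t ^+ 2 * w ^+ 2 by nonneg.
case=> h.
  have ta : 0 <= a ^+ 2 * t <= 1.
    by rewrite mulr_ge0 ?sqr_ge0//= mulr_ile1 ?sqr_ge0// expr_le1.
  have /andP[ta0 ta1] := ta.
  have h1 : a ^+ 2 * t * `|x| <= 4 * delta by apply: le_trans h; rewrite ler_piMl.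
  have := ler_wpM2r u0 h1.
  rewrite (_ : a ^+ 6 * t ^+ 3 * (`|x| * w ^+ 2) = a ^+ 2 * t * `|x| * (a ^+ 4 * t ^+ 2 * w ^+ 2)); last by ring.
  by lra.
have y := young_mul (a * `|x|) (a ^+ 5 * t ^+ 3 * w ^+ 2) s0.
have nx : (a * `|x|) ^+ 2 = a ^+ 2 * x ^+ 2 by rewrite exprMn real_normK ?num_real.
rewrite nx in y.
have h2 := ler_wpM2l (ltW s0) h.
rewrite (_ : a ^+ 6 * t ^+ 3 * (`|x| * w ^+ 2) = a * `|x| * (a ^+ 5 * t ^+ 3 * w ^+ 2)); last by ring.
have x0 : 0 <= a * `|x| * (a ^+ 5 * t ^+ 3 * w ^+ 2).
  by nonneg.
have du : 0 <= 4 * delta * (a ^+ 4 * t ^+ 2 * w ^+ 2) by nonneg.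
rewrite (_ : (a ^+ 5 * t ^+ 3 * w ^+ 2) ^+ 2 = a ^+ 10 * t ^+ 6 * w ^+ 4) in y; last by ring.
move: y h2 x0 du sB q0; clearbody B; move: (s^-1); clear => si; lra.
Qed.

End Pointwise.

Section WeightedEnergy.
Context {R : realType}.
Implicit Types (f g w : R * R -> R) (L s r tau delta : R) (n : nat).

(* The exponents of the weight are affine in [n], the slope and the intercept being chosen
   so that the powers match in the interpolation inequalities. *)
Definition wint L n k j f : R := sqint L (fun z => weight L z ^+ (k * n + j) * f z).

Lemma cont_wpow L n f : continuous f -> continuous (fun z => weight L z ^+ n * f z).
Proof. by move=> cf; have cw := @cont_weight R L; cont. Qed.

Lemma wint_ge0 L n k j f : 0 < L -> (forall z, 0 <= f z) -> 0 <= wint L n k j f.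
Proof.
move=> L0 f0; apply: sqint_ge0 => z zL.
have [/andP[t0 _] _ _] := weight_bounds L0 zL.
by apply: mulr_ge0 => //; exact: exprn_ge0.
Qed.

Lemma weight_power_bounds L n z : 0 < L -> square L z ->
  0 <= weight L z ^+ n <= 1.
Proof.
move=> L0 zL; have [/andP[t0 t1] _ _] := weight_bounds L0 zL.
by rewrite exprn_ge0//= exprn_ile1.
Qed.

(** The device that discards an expanded divergence: [A] has integral zero, so any multiple of it
    may be added under the integral sign. *)
Lemma sqint_null_le L f A h (c : R) : 0 < L -> continuous f -> continuous A ->
  continuous h -> sqint L A = 0 ->
  (forall z, square L z -> f z <= c * A z + h z) -> sqint L f <= sqint L h.
Proof.
move=> L0 cf cA ch A0 H.
apply: (@le_trans _ _ (sqint L (fun z => c * A z + h z))).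
  by apply: le_sqint => //; [exact: ltW|cont].
by rewrite sqintD ?sqintZ ?A0 ?mulr0 ?add0r// ?ltW//; cont.
Qed.

Lemma sqintDD L f g : 0 < L -> continuous f -> continuous g ->
  sqint L f = 0 -> sqint L g = 0 -> sqint L (fun z => f z + g z) = 0.
Proof. by move=> L0 cf cg f0 g0; rewrite sqintD ?f0 ?g0 ?addr0// ltW. Qed.

Lemma d1_wprod L n f f' : d1 f f' ->
  d1 (fun z => weight L z ^+ n.+1 * f z) (fun z =>
    n.+1%:R * weight L z ^+ n * weight1 L z * f z + weight L z ^+ n.+1 * f' z).
Proof. by move=> df; exact: (d1M (d1X n (@d1_weight R L)) df). Qed.

Lemma d2_wprod L n f f' : d2 f f' ->
  d2 (fun z => weight L z ^+ n.+1 * f z) (fun z =>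
    n.+1%:R * weight L z ^+ n * weight2 L z * f z + weight L z ^+ n.+1 * f' z).
Proof. by move=> df; exact: (d2M (d2X n (@d2_weight R L)) df). Qed.

Lemma sqint_div_wprod L n f f' g g' : 0 < L -> continuous f -> continuous f' ->
  continuous g -> continuous g' -> d1 f f' -> d2 g g' ->
  sqint L (fun z =>
    (n.+1%:R * weight L z ^+ n * weight1 L z * f z + weight L z ^+ n.+1 * f' z) +
    (n.+1%:R * weight L z ^+ n * weight2 L z * g z + weight L z ^+ n.+1 * g' z)) = 0.
Proof.
move=> L0 cf cf' cg cg' df dg.
have cw := @cont_weight R L; have cw1 := @cont_weight1 R L.
have cw2 := @cont_weight2 R L.
apply: sqintDD => //; try by cont.
  apply: (sqint_d1 L0 _ (d1_wprod L n df)); first by cont.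
  exact: weightX_boundary.
apply: (sqint_d2 L0 _ (d2_wprod L n dg)); first by cont.
exact: weightX_boundary.
Qed.

Lemma gradient_energy L n f f1 f2 f11 f22 s : 0 < L -> 0 < s ->
  continuous f -> continuous f1 -> continuous f2 -> continuous f11 -> continuous f22 ->
  d1 f f1 -> d2 f f2 -> d1 f1 f11 -> d2 f2 f22 ->
  wint L n 4 2 (fun z => f1 z ^+ 2 + f2 z ^+ 2) <=
  s * wint L n 6 4 (fun z => (f11 z + f22 z) ^+ 2) +
  (1 / s + 2 * ((4 * n + 2)%:R * (2 / L)) ^+ 2) * wint L n 2 0 (fun z => f z ^+ 2).
Proof.
move=> L0 s0 cf cf1 cf2 cf11 cf22 df1 df2 df11 df22.
have L0' := ltW L0; have cw := @cont_weight R L; have cw1 := @cont_weight1 R L.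
have cw2 := @cont_weight2 R L.
have dv : forall z, f11 z + f22 z = f11 z + f22 z by [].
have A0 := sqint_div_wprod (4 * n + 1) L0 (contM cf cf1) _ (contM cf cf2) _ (d1M df1 df11) (d2M df2 df22).
move: A0 => /(_ ltac:(by cont) ltac:(by cont)) A0.
rewrite /wint -sqintZ //; last by cont.
rewrite -sqintZ; [|by []|by cont].
rewrite -sqintD; [|by []|by cont|by cont].
apply: (@sqint_null_le _ _ _ _ (2 : R) L0 _ _ _ A0); [by cont|by cont|by cont|].
move=> z zL.
have [t01 h1 h2] := weight_bounds L0 zL; have a01 := weight_power_bounds n L0 zL.
have k0 : 0 <= (4 * n + 2)%:R :> R by exact: ler0n.
have := gradient_pointwise (f z) (f1 z) (f2 z) (f11 z + f22 z) a01 t01 h1 h2 s0 k0.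
have eN : (4 * n + 1).+1 = (4 * n + 2)%N := esym (addnS _ _).
rewrite eN !weight_pow expr1 expr0 mulr1.
move=> h; apply: le_trans h _.
by rewrite le_eqVlt; apply/orP; left; apply/eqP; ring.
Qed.

Lemma quartic_energy L n w w1 w2 r : 0 < L -> 0 < r ->
  continuous w -> continuous w1 -> continuous w2 -> d1 w w1 -> d2 w w2 ->
  wint L n 10 6 (fun z => w z ^+ 4) <=
  (r * wint L n 6 4 (fun z => w1 z ^+ 2 + w2 z ^+ 2) +
   (1 / r + (5 * n + 3)%:R * (2 / L)) * wint L n 4 2 (fun z => w z ^+ 2)) ^+ 2.
Proof.
move=> L0 r0 cv cv1 cv2 dw1 dw2.
have L0' := ltW L0; have cw := @cont_weight R L; have cw1 := @cont_weight1 R L.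
have cw2 := @cont_weight2 R L.
have := sqint_sqr_le L0 _ _ _ (d1_wprod L (5 * n + 2) (d1X 1 dw1)) (d2_wprod L (5 * n + 2) (d2X 1 dw2)) (weightX_boundary _ _ L0).
move=> /(_ ltac:(by cont) ltac:(by cont) ltac:(by cont)) H.
have e0 z : weight L z ^+ (10 * n + 6) * w z ^+ 4 = (weight L z ^+ (5 * n + 2).+1 * w z ^+ 2) ^+ 2.
  by move: (weight L z) (w z) => t x; rewrite exprMn -!exprM; congr (_ ^+ _ * _); clear; lia.
rewrite /wint; under eq_sqint do rewrite e0.
apply: le_trans H _; rewrite expr2.
have k0 : 0 <= (5 * n + 3)%:R :> R by exact: ler0n.
have B f (t1 : R * R -> R) : continuous f -> continuous t1 ->
  (forall z, square L z -> `|t1 z| <= 2 / L) ->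
  (forall z, f z ^+ 2 <= w1 z ^+ 2 + w2 z ^+ 2) ->
  sqint L (fun z => `|(5 * n + 2).+1%:R * weight L z ^+ (5 * n + 2) * t1 z * w z ^+ 2 +
       weight L z ^+ (5 * n + 2).+1 * (2 * w z ^+ 1 * f z)|) <=
  r * sqint L (fun z => weight L z ^+ (6 * n + 4) * (w1 z ^+ 2 + w2 z ^+ 2)) +
   (1 / r + (5 * n + 3)%:R * (2 / L)) * sqint L (fun z => weight L z ^+ (4 * n + 2) * w z ^+ 2).
  move=> cf ct ht hf.
  rewrite -sqintZ; [|by []|by cont].
  rewrite -sqintZ; [|by []|by cont].
  rewrite -sqintD; [|by []|by cont|by cont].
  apply: le_sqint; [by []|by cont|by cont|].
  move=> z zL; have a01 := weight_power_bounds n L0 zL.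
  have := quartic_pointwise (weight L z) (w z) (f z) a01 (ht _ zL) r0 k0.
  have eN : (5 * n + 2).+1 = (5 * n + 3)%N := esym (addnS _ _).
  rewrite eN !weight_pow expr1 => h; apply: le_trans h _.
  rewrite lerD2r; apply: ler_wpM2l; first exact: ltW.
  apply: ler_wpM2l => //.
  have [/andP[t0 _] _ _] := weight_bounds L0 zL; have /andP[a0 _] := a01.
  by nonneg.
apply: ler_pM; try by apply: sqint_ge0.
- apply: B => // z; first by move=> /(weight_bounds L0)[].
  by rewrite lerDl sqr_ge0.
- apply: B => // z; first by move=> /(weight_bounds L0)[].
  by rewrite lerDr sqr_ge0.
Qed.

End WeightedEnergy.

Section FlowEnergy.
Context {R : realType}.
Implicit Types (f w : R * R -> R) (g G : R -> R) (L s r tau delta : R) (n : nat).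

Lemma trunc_energy L n f f1 f2 g G r : 0 < L -> 0 < r ->
  continuous f -> continuous f1 -> continuous f2 -> d1 f f1 -> d2 f f2 ->
  continuous g -> continuous G -> (forall x : R, is_derive x 1 G (g x)) ->
  (forall x, 0 <= g x) -> (forall x, `|G x| <= `|x| * g x) ->
  wint L n 4 4 (fun z => G (f z) ^+ 2) <=
  (r * sqint L (fun z => g (f z) ^+ 2) +
   (wint L n 4 2 (fun z => f1 z ^+ 2 + f2 z ^+ 2) +
    ((2 * n + 2)%:R * (2 / L)) ^+ 2 * wint L n 2 0 (fun z => f z ^+ 2)) / r) ^+ 2.
Proof.
move=> L0 r0 cf cf1 cf2 df1 df2 cg cG dG g0 hG.
have L0' := ltW L0; have cw := @cont_weight R L; have cw1 := @cont_weight1 R L.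
have cw2 := @cont_weight2 R L.
have cgf := cont_comp cg cf; have cGf := cont_comp cG cf.
have := sqint_sqr_le L0 _ _ _ (d1_wprod L (2 * n + 1) (d1_comp dG df1))
  (d2_wprod L (2 * n + 1) (d2_comp dG df2)) (weightX_boundary _ _ L0).
move=> /(_ ltac:(by cont) ltac:(by cont) ltac:(by cont)) H.
have e0 z : weight L z ^+ (4 * n + 4) * G (f z) ^+ 2 = (weight L z ^+ (2 * n + 1).+1 * G (f z)) ^+ 2.
  by move: (weight L z) (G (f z)) => t x; rewrite exprMn -!exprM; congr (_ ^+ _ * _); clear; lia.
rewrite /wint; under eq_sqint do rewrite e0.
apply: le_trans H _; rewrite expr2.
have k0 : 0 <= (2 * n + 2)%:R :> R by exact: ler0n.
have ri0 : 0 <= r^-1 by nonneg.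
have B (h t1 : R * R -> R) : continuous h -> continuous t1 ->
  (forall z, square L z -> `|t1 z| <= 2 / L) ->
  (forall z, h z ^+ 2 <= f1 z ^+ 2 + f2 z ^+ 2) ->
  sqint L (fun z => `|(2 * n + 1).+1%:R * weight L z ^+ (2 * n + 1) * t1 z * G (f z) +
       weight L z ^+ (2 * n + 1).+1 * (g (f z) * h z)|) <=
  r * sqint L (fun z => g (f z) ^+ 2) +
   (sqint L (fun z => weight L z ^+ (4 * n + 2) * (f1 z ^+ 2 + f2 z ^+ 2)) +
    ((2 * n + 2)%:R * (2 / L)) ^+ 2 * sqint L (fun z => weight L z ^+ (2 * n + 0) * f z ^+ 2)) / r.
  move=> ch ct ht hf; rewrite [X in _ <= _ + X]mulrC.
  rewrite -sqintZ; [|by []|by cont].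
  rewrite -sqintZ; [|by []|by cont].
  rewrite -sqintD; [|by []|by cont|by cont].
  rewrite -sqintZ; [|by []|by cont].
  rewrite -sqintD; [|by []|by cont|by cont].
  apply: le_sqint; [by []|by cont|by cont|].
  move=> z zL; have a01 := weight_power_bounds n L0 zL.
  have [t01 _ _] := weight_bounds L0 zL.
  have := trunc_pointwise (h z) a01 t01 (ht _ zL) r0 k0 (g0 (f z)) (hG (f z)).
  have eN : (2 * n + 1).+1 = (2 * n + 2)%N := esym (addnS _ _).
  rewrite eN !weight_pow expr1 expr0 mulr1 => h1; apply: le_trans h1 _.
  rewrite lerD2l [leLHS]mulrC; apply: ler_wpM2l => //.
  rewrite lerD2r; apply: ler_wpM2l => //.
  have /andP[t0 _] := t01; have /andP[a0 _] := a01.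
  by nonneg.
apply: ler_pM; try by apply: sqint_ge0.
- apply: B => // z; first by move=> /(weight_bounds L0)[].
  by rewrite lerDl sqr_ge0.
- apply: B => // z; first by move=> /(weight_bounds L0)[].
  by rewrite lerDr sqr_ge0.
Qed.

(** Above the level [4 * delta] the square of the velocity is interpolated between [g ^+ 2], whose
    integral is bounded by hypothesis, and [G ^+ 2], which the Sobolev inequality controls. The
    powers of [t] are the weights of the integrals [V] and [T]. *)
Definition truncates n delta g G := forall t tau x, 0 <= t <= 1 -> 0 < tau <= 1 ->
  `|x| <= 4 * delta \/ (t ^+ n) ^+ 2 * x ^+ 2 <=
    64 * (tau * ((t ^+ n) ^+ 4 * t ^+ 4 * G x ^+ 2) + g x ^+ 2 / tau).

Lemma velocity_energy L n delta f g G tau : 0 < L -> 0 <= delta -> 0 < tau <= 1 ->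
  continuous f -> continuous g -> continuous G -> truncates n delta g G ->
  wint L n 2 0 (fun z => f z ^+ 2) <= 64 * (L ^+ 2 * delta ^+ 2 +
    (tau * wint L n 4 4 (fun z => G (f z) ^+ 2) + sqint L (fun z => g (f z) ^+ 2) / tau)).
Proof.
move=> L0 de0 tau01 cf cg cG tr; have /andP[tau0 _] := tau01.
have L0' := ltW L0; have cw := @cont_weight R L.
have cgf := cont_comp cg cf; have cGf := cont_comp cG cf.
have ti0 : 0 <= tau^-1 by nonneg.
(* The square has area [4 * L ^+ 2], hence the division by 4; multiplied by 64 the constant becomes
   [(4 * delta) ^+ 2], the bound for small velocities. *)
rewrite (_ : L ^+ 2 * delta ^+ 2 = sqint L (fun=> delta ^+ 2 / 4)); last first.
  by rewrite sqint_cst//; field.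
rewrite /wint [X in _ * (_ + (_ + X))]mulrC.
rewrite -sqintZ; [|by []|by cont].
rewrite -sqintZ; [|by []|by cont].
rewrite -sqintD; [|by []|by cont|by cont].
rewrite -sqintD; [|by []|by cont|by cont].
rewrite -sqintZ; [|by []|by cont].
apply: le_sqint; [by []|by cont|by cont|].
move=> z zL; have [t01 _ _] := weight_bounds L0 zL.
have a01 := weight_power_bounds n L0 zL.
have /andP[t0 _] := t01; have /andP[a0 a1] := a01.
rewrite !weight_pow expr0 mulr1.
have [h|h] := tr _ _ (f z) t01 tau01.
  have : ((weight L z ^+ n) * f z) ^+ 2 <= (4 * delta) ^+ 2.
    apply: le_trans (mul_sqr_le _ a01) _; exact: norm_sqr_le.
  rewrite exprMn => {}h; apply: le_trans h _.
  have : 0 <= tau * ((weight L z ^+ n) ^+ 4 * weight L z ^+ 4 * G (f z) ^+ 2) by nonneg.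
  have : 0 <= tau^-1 * g (f z) ^+ 2 by nonneg.
  by lra.
apply: le_trans h _; apply: ler_wpM2l => //.
by rewrite [g (f z) ^+ 2 / tau]mulrC lerDr; nonneg.
Qed.

Lemma convective_energy L n delta f w g G s tau : 0 < L -> 0 <= delta -> 0 < s ->
  0 < tau <= 1 -> continuous f -> continuous w -> continuous g -> continuous G ->
  truncates n delta g G ->
  wint L n 6 3 (fun z => `|f z| * w z ^+ 2) <=
  4 * delta * wint L n 4 2 (fun z => w z ^+ 2) +
  64 * s * (tau * wint L n 4 4 (fun z => G (f z) ^+ 2) + sqint L (fun z => g (f z) ^+ 2) / tau) +
  wint L n 10 6 (fun z => w z ^+ 4) / s.
Proof.
move=> L0 de0 s0 tau01 cf cw' cg cG tr; have /andP[tau0 _] := tau01.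
have L0' := ltW L0; have cw := @cont_weight R L.
have cgf := cont_comp cg cf; have cGf := cont_comp cG cf.
rewrite /wint [sqint L _ / tau]mulrC [sqint L _ / s]mulrC.
rewrite -sqintZ; [|by []|by cont].
rewrite -sqintZ; [|by []|by cont].
rewrite -sqintZ; [|by []|by cont].
rewrite -sqintD; [|by []|by cont|by cont].
rewrite -sqintZ; [|by []|by cont].
rewrite -sqintD; [|by []|by cont|by cont].
rewrite -sqintZ; [|by []|by cont].
rewrite -sqintD; [|by []|by cont|by cont].
apply: le_sqint; [by []|by cont|by cont|].
move=> z zL; have [t01 _ _] := weight_bounds L0 zL.
have a01 := weight_power_bounds n L0 zL.
rewrite !weight_pow [tau^-1 * _]mulrC [s^-1 * _]mulrC.
exact: convective_pointwise (tr _ _ (f z) t01 tau01).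
Qed.

Lemma vorticity_energy L n w w1 w2 w11 w22 v1 v2 v11 v22 p1 p2 p11 p22 : 0 < L ->
  continuous w -> continuous w1 -> continuous w2 -> continuous w11 -> continuous w22 ->
  continuous v1 -> continuous v2 -> continuous v11 -> continuous v22 ->
  continuous p1 -> continuous p2 -> continuous p11 -> continuous p22 ->
  d1 w w1 -> d2 w w2 -> d1 w1 w11 -> d2 w2 w22 ->
  d1 v1 v11 -> d2 v2 v22 -> d1 p1 p11 -> d2 p2 p22 ->
  (forall z, square L z -> v11 z + v22 z = 0) ->
  (forall z, square L z -> w11 z + w22 z = p11 z + p22 z) ->
  wint L n 6 4 (fun z => w1 z ^+ 2 + w2 z ^+ 2) <=
  6 * ((6 * n + 4)%:R * (2 / L)) ^+ 2 * wint L n 4 2 (fun z => w z ^+ 2) +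
  3 * sqint L (fun z => (p1 z - v1 z * w z) ^+ 2 + (p2 z - v2 z * w z) ^+ 2) +
  (6 * n + 4)%:R * (2 / L) * wint L n 6 3 (fun z => (`|v1 z| + `|v2 z|) * w z ^+ 2).
Proof.
move=> L0 cv cv1 cv2 cv11 cv22 cx1 cx2 cx11 cx22 cp1 cp2 cp11 cp22 dw1 dw2 dw11 dw22
  dv11 dv22 dp11 dp22 div0 eqw.
have L0' := ltW L0; have cw := @cont_weight R L; have cw1 := @cont_weight1 R L.
have cw2 := @cont_weight2 R L.
pose V1 := fun z => 1 / 2 * (w z ^+ 2 * v1 z).
pose V2 := fun z => 1 / 2 * (w z ^+ 2 * v2 z).
have := sqint_div_wprod (6 * n + 3) L0 _ _ _ _
  (d1D (d1B (d1M dw1 dw11) (d1M dw1 dp11)) (d1Z (1 / 2) (d1M (d1X 1 dw1) dv11)))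
  (d2D (d2B (d2M dw2 dw22) (d2M dw2 dp22)) (d2Z (1 / 2) (d2M (d2X 1 dw2) dv22))).
move=> /(_ ltac:(by cont) ltac:(by cont) ltac:(by cont) ltac:(by cont)) A0.
rewrite /wint.
rewrite -sqintZ; [|by []|by cont].
rewrite -sqintZ; [|by []|by cont].
rewrite -sqintZ; [|by []|by cont].
rewrite -sqintD; [|by []|by cont|by cont].
rewrite -sqintD; [|by []|by cont|by cont].
apply: (@sqint_null_le _ _ _ _ _ (2 : R) L0 _ _ _ A0); [by cont|by cont|by cont|].
move=> z zL.
have [t01 h1 h2] := weight_bounds L0 zL; have a01 := weight_power_bounds n L0 zL.
have k0 : 0 <= (6 * n + 4)%:R :> R by exact: ler0n.
have := vorticity_pointwise (w z) (w1 z) (w2 z) (v1 z) (v2 z)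
   (p1 z - v1 z * w z) (p2 z - v2 z * w z) a01 t01 h1 h2 k0 (eqw _ zL).
have eN : (6 * n + 3).+1 = (6 * n + 4)%N := esym (addnS _ _).
rewrite eN !weight_pow.
have v22E : v22 z = - v11 z by have := div0 _ zL; lra.
have wE : w11 z = p11 z + p22 z - w22 z by have := eqw _ zL; lra.
rewrite v22E wE.
move=> h; apply: le_trans h _.
move: (`|v1 z|) (`|v2 z|) => n1 n2.
by rewrite le_eqVlt; apply/orP; left; apply/eqP; field; rewrite gt_eqF.
Qed.

End FlowEnergy.

(** * Truncation *)

Section LeftPrimitive.
Context {R : realType}.
Implicit Types (h : R -> R) (c x : R).

Lemma integrable_left_vanishing h c x : continuous h -> (forall t, t < c -> h t = 0) ->
  (@lebesgue_measure R).-integrable `]-oo, x] (EFin \o h).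
Proof.
move=> ch h0; have hcx : (@lebesgue_measure R).-integrable `[c, x] (EFin \o h).
  apply: continuous_compact_integrable; first exact: segment_compact.
  exact: continuous_subspaceT.
have restr A := @integrable_mkcond _ (measurableTypeR R) R (@lebesgue_measure R) A (EFin \o h).
apply/(restr _ (measurable_itv _)).
rewrite (_ : _ \_ _ = (EFin \o h) \_ `[c, x]).
  exact/(restr _ (measurable_itv _)).
apply/funext => t; rewrite /patch !mem_setE !in_itv/=.
have [ct|tc] := leP c t; first by [].
by case: ifP => //= _; rewrite h0.
Qed.

(** Integrating from minus infinity gives a single formula on the whole line. It is meaningful for
    functions that vanish on a left half-line, as the truncations do. *)
Definition left_primitive h x : R := \int[lebesgue_measure]_(t in `]-oo, x]) h t.

Lemma is_derive_left_primitive h c x : continuous h -> (forall t, t < c -> h t = 0) ->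
  is_derive x 1 (left_primitive h) (h x).
Proof.
move=> ch h0.
have [||||dG G'] := @continuous_FTC1 R h -oo%O x (x + 1).
- by rewrite ltrDl.
- exact: integrable_left_vanishing ch h0.
- by rewrite ltNyr.
- exact: ch.
by split; [exact: dG|rewrite -derive1E].
Qed.

End LeftPrimitive.

Section Truncation.
Context {R : realType}.
Implicit Types (x y t tau delta : R) (n i : nat).

(** Dyadic exponents make all powers of [x] that occur integer powers of one root, so that comparing
    truncations becomes a polynomial question. *)
Definition root2 i x : R := iter i Num.sqrt x.

Lemma root2_ge0 i x : 0 <= x -> 0 <= root2 i x.
Proof. by move=> x0; elim: i => //= i _; exact: sqrtr_ge0. Qed.

Lemma root2_expr i x : 0 <= x -> root2 i x ^+ (2 ^ i) = x.
Proof.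
move=> x0; elim: i => [|i ih]; first by rewrite expn0 expr1.
by rewrite expnS exprM/= sqr_sqrtr ?ih// root2_ge0.
Qed.

Lemma root2_le i x y : x <= y -> root2 i x <= root2 i y.
Proof. by move=> xy; elim: i => //= i ih; exact: ler_wsqrtr. Qed.

Lemma root2_0 i : root2 i 0 = 0.
Proof. by elim: i => //= i ->; rewrite sqrtr0. Qed.

Lemma cont_root2 i : continuous (root2 i).
Proof.
elim: i => [|i ih]; first by move=> x; exact: cvg_id.
by move=> x; apply: (continuous_comp (ih x)); exact: sqrt_continuous.
Qed.

(* [x |-> (x - delta)_+ ^ ((n+2) / 2^i)]. *)
Definition gpos n i delta x : R := root2 i (Num.max (x - delta) 0) ^+ (n + 2).

Lemma cont_gpos n i delta : continuous (gpos n i delta).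
Proof.
apply: contX; apply: cont_comp; first exact: cont_root2.
rewrite (_ : (fun x => _) = fun x => (x - delta + `|x - delta|) / 2); last first.
  by apply/funext => x; rewrite maxr_absE addr0 subr0.
have c1 : continuous (fun x : R => x - delta).
  by apply: contB; [move=> x; exact: cvg_id|exact: contC].
by apply: contM; [apply: contD => //; exact: continuous_normfun|exact: contC].
Qed.

Lemma gpos_ge0 n i delta x : 0 <= gpos n i delta x.
Proof. by apply: exprn_ge0; apply: root2_ge0; rewrite le_max lexx orbT. Qed.

Lemma gpos_le n i delta x y : x <= y -> gpos n i delta x <= gpos n i delta y.
Proof.
move=> xy; apply: lerXn2r; rewrite ?nnegrE; try by apply: root2_ge0; rewrite le_max lexx orbT.
by apply: root2_le; rewrite ge_max !le_max lexx orbT andbT lerB.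
Qed.

Lemma gpos_0 n i delta x : x <= delta -> gpos n i delta x = 0.
Proof.
by move=> xd; rewrite /gpos max_r ?subr_le0// root2_0 addn2 expr0n.
Qed.

Definition Gpos n i delta : R -> R := left_primitive (gpos n i delta).

Lemma is_derive_Gpos n i delta x : 0 <= delta ->
  is_derive x 1 (Gpos n i delta) (gpos n i delta x).
Proof.
move=> de0; apply: (@is_derive_left_primitive _ _ 0); first exact: cont_gpos.
by move=> t t0; rewrite gpos_0//; lra.
Qed.

(* For [2^i = 2n+2] this is [(|x| - delta)_+ ^ (q/2)] with [q = 1 + 1/(n+1)]; [truncI] is
   its odd primitive. *)
Definition trunc n i delta x : R := gpos n i delta x + gpos n i delta (- x).
Definition truncI n i delta x : R := Gpos n i delta x - Gpos n i delta (- x).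

Lemma cont_trunc n i delta : continuous (trunc n i delta).
Proof.
have c := @cont_gpos n i delta; apply: contD => //.
by apply: cont_comp => // x; exact: oppr_continuous.
Qed.

Lemma is_derive_truncI n i delta x : 0 <= delta ->
  is_derive x 1 (truncI n i delta) (trunc n i delta x).
Proof.
move=> de0; have dG t := is_derive_Gpos n i t de0.
have dN : is_derive x 1 (fun t => Gpos n i delta (- t)) (gpos n i delta (- x) * -1).
  exact: (@is_derive1_comp _ (Gpos n i delta) -%R x _ _ (dG _) (is_deriveNid _ _)).
have := is_deriveB (dG x) dN; rewrite mulrN1 opprK; exact.
Qed.

Lemma cont_truncI n i delta : 0 <= delta -> continuous (truncI n i delta).
Proof.
move=> de0 x; apply: differentiable_continuous; apply/derivable1_diffP.
by have [] := is_derive_truncI n i x de0.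
Qed.

Lemma trunc_ge0 n i delta x : 0 <= trunc n i delta x.
Proof. by rewrite addr_ge0// gpos_ge0. Qed.

Lemma trunc_pos n i delta x : 0 <= delta -> 0 <= x -> trunc n i delta x = gpos n i delta x.
Proof. by move=> de0 x0; rewrite /trunc [gpos _ _ _ (- x)]gpos_0 ?addr0//; lra. Qed.

Lemma truncN n i delta x : trunc n i delta (- x) = trunc n i delta x.
Proof. by rewrite /trunc opprK addrC. Qed.

Lemma truncIN n i delta x : truncI n i delta (- x) = - truncI n i delta x.
Proof. by rewrite /truncI opprK opprB. Qed.

Lemma truncI_mvt n i delta x y : 0 <= delta -> x < y ->
  exists2 c, x < c < y & truncI n i delta y - truncI n i delta x = trunc n i delta c * (y - x).
Proof.
move=> de0 xy.
have [c|c cxy ->] := MVT xy (fun c _ => is_derive_truncI n i c de0).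
  by apply: continuous_subspaceT; exact: cont_truncI.
by exists c => //; move: cxy; rewrite in_itv.
Qed.

Lemma truncI0 n i delta : truncI n i delta 0 = 0.
Proof. by rewrite /truncI oppr0 subrr. Qed.

Lemma truncI_le n i delta x : 0 <= delta ->
  `|truncI n i delta x| <= `|x| * trunc n i delta x.
Proof.
move=> de0; wlog x0 : x / 0 <= x => [hw|].
  have [/hw//|/ltW] := leP 0 x; rewrite -oppr_ge0 => /hw.
  by rewrite truncIN truncN !normrN.
have [->|xn0] := eqVneq x 0; first by rewrite truncI0 normr0 mul0r.
have xp : 0 < x by rewrite lt_neqAle eq_sym xn0.
have [c /andP[c0 cx]] := truncI_mvt n i de0 xp.
rewrite truncI0 !subr0 => ->; rewrite normrM (ger0_norm (trunc_ge0 _ _ _ _)) mulrC.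
apply: ler_wpM2l => //; rewrite !trunc_pos//; last exact: ltW.
exact/gpos_le/ltW.
Qed.

(** The truncation is nondecreasing on the positive axis: on the right half of [[0, x]] it is at
    least its value at [x / 2], and the left half contributes a nonnegative amount. *)
Lemma truncI_ge n i delta x : 0 <= delta -> 0 < x ->
  x / 2 * gpos n i delta (x / 2) <= truncI n i delta x.
Proof.
move=> de0 x0; have x2 : x / 2 < x by lra.
have x20 : 0 < x / 2 by lra.
have [c /andP[c0 cx] E] := truncI_mvt n i de0 x2.
have [d /andP[d0 dx] F] := truncI_mvt n i de0 x20.
rewrite truncI0 !subr0 in F.
have F0 : 0 <= truncI n i delta (x / 2) by rewrite F mulr_ge0 ?trunc_ge0// ltW.
have : x / 2 * gpos n i delta (x / 2) <= trunc n i delta c * (x - x / 2).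
  have -> : x - x / 2 = x / 2 by lra.
  rewrite mulrC; apply: ler_wpM2r; first exact: ltW.
  by rewrite trunc_pos//; [apply: gpos_le; lra|lra].
by rewrite -E; lra.
Qed.

(** In terms of the root [r] of a quarter of [|x|], all terms share the factor [r ^+ (2n+4)]. What
    remains compares powers of the single quantity [t * r] with exponents [2n], [4n+4] and 0; this
    homogeneity dictates the weights of [V] and [T]. *)
Lemma truncatesP n i delta : (2 * n + 2 = 2 ^ i)%N -> 0 <= delta ->
  truncates n delta (trunc n i delta) (truncI n i delta).
Proof.
move=> ni de0 t tau x /andP[t0 t1] /andP[tau0 tau1].
have [|x4] := leP `|x| (4 * delta); [by left|right].
have gx : trunc n i delta x = trunc n i delta `|x|.
  by have [x0|x0] := ger0P x; rewrite ?truncN.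
have Gx : truncI n i delta x ^+ 2 = truncI n i delta `|x| ^+ 2.
  by have [x0|x0] := ger0P x; rewrite ?truncIN ?sqrrN.
rewrite gx Gx -(real_normK (num_real x)); move: (`|x|) x4 => {gx Gx}x x4.
have x0 : 0 < x by lra.
(* Since [x > 4 * delta], both [x - delta] and [x / 2 - delta] are at least this quarter. *)
pose y := x / 4; pose r := root2 i y.
have y0 : 0 <= y by rewrite /y; lra.
have r0 : 0 <= r by exact: root2_ge0.
have ry : y = r ^+ (2 * n + 2) by rewrite ni root2_expr.
have gy z : y <= z - delta -> r ^+ (n + 2) <= gpos n i delta z.
  move=> yz; apply: lerXn2r; rewrite ?nnegrE ?root2_ge0// ?le_max ?lexx ?orbT//.
  by apply: root2_le; rewrite le_max yz.
have g1 : r ^+ (n + 2) <= trunc n i delta x.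
  rewrite trunc_pos//; last exact: ltW.
  by apply: gy; rewrite /y; lra.
have g2 : 2 * y * r ^+ (n + 2) <= truncI n i delta x.
  apply: le_trans (truncI_ge n i de0 x0); rewrite (_ : x / 2 = 2 * y); last by rewrite /y; lra.
  apply: ler_wpM2l; first by lra.
  by apply: gy; rewrite /y; lra.
have rn0 : 0 <= r ^+ (n + 2) by exact: exprn_ge0.
have g1' : (r ^+ (n + 2)) ^+ 2 <= trunc n i delta x ^+ 2.
  by apply: lerXn2r; rewrite ?nnegrE ?trunc_ge0.
have g2' : (2 * y * r ^+ (n + 2)) ^+ 2 <= truncI n i delta x ^+ 2.
  have yr : 0 <= 2 * y * r ^+ (n + 2) by rewrite mulr_ge0//; lra.
  by apply: lerXn2r; rewrite ?nnegrE// (le_trans yr).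
apply: (@le_trans _ _ (64 * (tau * ((t ^+ n) ^+ 4 * t ^+ 4 * (2 * y * r ^+ (n + 2)) ^+ 2) +
    (r ^+ (n + 2)) ^+ 2 / tau))); last first.
  apply: ler_wpM2l => //; apply: lerD.
    apply: ler_wpM2l; first exact: ltW.
    by apply: ler_wpM2l => //; nonneg.
  by apply: ler_wpM2r => //; nonneg.
have -> : x = 4 * y by rewrite /y; lra.
pose P := (t * r) ^+ n.
have P0 : 0 <= P by rewrite exprn_ge0// mulr_ge0.
(* If [P ^+ 2] exceeds [1 / tau], it exceeds 1 because [tau <= 1]. Then [n] is positive and
   [t * r >= 1], so the extra factor [(t * r) ^+ 4] only helps. *)
have key : P ^+ 2 <= tau * (P ^+ 4 * (t * r) ^+ 4) + tau^-1.
  have [h|h] := leP (P ^+ 2) tau^-1.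
    by apply: le_trans h _; rewrite lerDr; nonneg.
  have tP : 1 <= tau * P ^+ 2 by rewrite -ler_pdivrMl// mulr1 ltW.
  have P21 : 1 <= P ^+ 2 by apply: le_trans tP _; rewrite ler_piMl// sqr_ge0.
  have P1 : 1 <= P by rewrite -(@ler_pXn2r _ 2) ?nnegrE// expr1n.
  have tr1 : 1 <= t * r.
    rewrite leNgt; apply/negP => tr1; move: P1; rewrite leNgt => /negP; apply.
    have n0 : (0 < n)%N.
      by case: (n) @P tP h {P21 P0} => // P; rewrite /P expr0 expr1n invf_lt1// ltNge tau1.
    by rewrite exprn_ilt1 ?mulr_ge0// -lt0n.
  have tr4 : 1 <= (t * r) ^+ 4 by exact: exprn_ege1.
  apply: (@le_trans _ _ (tau * (P ^+ 4 * (t * r) ^+ 4))); last by rewrite lerDl; nonneg.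
  rewrite (_ : tau * _ = (tau * P ^+ 2) * (P ^+ 2 * (t * r) ^+ 4)); last by ring.
  rewrite -[leLHS]mul1r; apply: ler_pM => //; first exact: sqr_ge0.
  by rewrite ler_peMr// sqr_ge0.
have q0 : 0 <= (r ^+ n * r ^+ 2) ^+ 2 by exact: sqr_ge0.
have ry' : y = (r ^+ n) ^+ 2 * r ^+ 2 by rewrite ry exprD mulnC exprM.
have := ler_wpM2l q0 key; rewrite /P ry' exprD !exprMn.
set u := t ^+ n; set v := r ^+ n.
have u0 : 0 <= u by exact: exprn_ge0.
have v0 : 0 <= v by exact: exprn_ge0.
have h1 : 0 <= tau * (u ^+ 4 * v ^+ 4 * (t ^+ 4 * r ^+ 4)) * (v ^+ 2 * r ^+ 2 ^+ 2) by nonneg.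
have h2 : 0 <= v ^+ 2 * r ^+ 2 ^+ 2 * tau^-1 by nonneg.
move: h1 h2; move: (tau^-1) => ti; clear => *.
lra.
Qed.

End Truncation.

(** * Mollifiers *)

Section Bump.
Context {R : realType}.
Implicit Types (x h : R) (p q : {poly R}).

(** A quadratic remainder determines the derivative. This covers both the flat point of the bump
    function and differentiation under the integral sign. *)
Lemma is_derive_quadratic (F : R -> R) x (l C : R) :
  (forall h, `|h| <= 1 -> `|F (x + h) - F x - h * l| <= C * h ^+ 2) ->
  is_derive x 1 F l.
Proof.
move=> H.
have C0 : 0 <= C.
  have := H 1; rewrite normr1 expr1n mulr1 => /(_ (lexx _)); exact: le_trans.
have cv : h^-1 *: (F (h *: 1 + x) - F x) @[h --> 0^'] --> l.
  apply/cvgrPdist_lt => e e0; near=> h.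
  have hn0 : h != 0 by near: h; exact: nbhs_dnbhs_neq.
  have h1 : `|h| <= 1.
    near: h; apply: dnbhs0_le; exact: ltr01.
  have hC : C * `|h| < e.
    have : `|h| < e / (C + 1) by near: h; apply: dnbhs0_lt; rewrite divr_gt0// ltr_wpDl.
    rewrite ltr_pdivlMr ?ltr_wpDl// => he; apply: le_lt_trans he.
    by rewrite mulrC; apply: ler_wpM2l => //; rewrite lerDl.
  rewrite /GRing.scale/= mulr1 [h + x]addrC.
  rewrite (_ : l - _ = - (h^-1 * (F (x + h) - F x - h * l))); last by field.
  rewrite normrN normrM normfV ltr_pdivrMl ?normr_gt0//.
  apply: le_lt_trans (H _ h1) _.
  by rewrite -real_normK ?num_real// expr2 mulrA [ltRHS]mulrC ltr_pM2r ?normr_gt0.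
by split; [apply/cvg_ex; exists l; exact: cv|exact: cvg_lim cv].
Unshelve. all: by end_near. Qed.

(** The flat function [exp(-1/x)] with a polynomial factor in [1/x]. The factor makes the family
    closed under differentiation, which acts on it as [Dpoly], so derivatives of all orders are
    available explicitly. *)
Definition psi p x : R := if 0 < x then p.[x^-1] * expR (- x^-1) else 0.

Definition Dpoly p : {poly R} := 'X^2 * (p - p^`()).

Lemma horner_bound p : exists2 B, 0 <= B &
  forall s, 1 <= s -> `|p.[s]| <= B * s ^+ size p.
Proof.
exists (\sum_(i < size p) `|p`_i|); first by apply: sumr_ge0.
move=> s s1; rewrite horner_coef mulr_suml.
apply: le_trans (ler_norm_sum _ _ _) _; apply: ler_sum => i _.
have s0 : 0 <= s by lra.
rewrite normrM normrX (ger0_norm s0); apply: ler_wpM2l => //.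
by apply: ler_weXn2l => //; apply: ltnW.
Qed.

Lemma expR_pow_bound n (s : R) : 0 < s -> expR (- s) <= n.+1`!%:R / s ^+ n.+1.
Proof.
move=> s0; rewrite expRN -[leRHS]invrK invf_div.
have f0 : (0 : R) < n.+1`!%:R by rewrite ltr0n fact_gt0.
have sn0 : 0 < s ^+ n.+1 by rewrite exprn_gt0.
rewrite lef_pV2 ?posrE ?expR_gt0 ?divr_gt0//.
by apply: le_trans (expR_ge1Dxn n (ltW s0)); rewrite lerDr.
Qed.

(** With [s = 1 / h] the polynomial grows at most like [s ^+ size p], while the factorial bound on
    the exponential is used with exponent [size p + 2]. The two surplus powers leave [h ^+ 2]. *)
Lemma psi_bound p : exists C, forall h, `|h| <= 1 -> `|psi p h| <= C * h ^+ 2.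
Proof.
have [B B0 pB] := horner_bound p; pose n := (size p).+1.
exists (B * n.+1`!%:R) => h h1; rewrite /psi.
have [h0|h0] := ltP 0 h; last first.
  by rewrite normr0; nonneg.
have s1 : 1 <= h^-1 by rewrite invf_ge1// (le_trans (ler_norm _)).
have s0 : 0 < h^-1 by rewrite invr_gt0.
rewrite normrM (ger0_norm (expR_ge0 _)).
have e0 : 0 <= expR (- h^-1) by exact: expR_ge0.
apply: le_trans (ler_pM (normr_ge0 _) e0 (pB _ s1) (expR_pow_bound n s0)) _.
rewrite le_eqVlt; apply/orP; left; apply/eqP.
have hn0 : h != 0 by rewrite gt_eqF.
by rewrite /n !exprS exprVn; field; rewrite ?hn0 ?expf_neq0.
Qed.

Lemma is_derive_psi p x : is_derive x 1 (psi p) (psi (Dpoly p) x).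
Proof.
have [x0|x0|->] := ltgtP x 0.
- have -> : psi (Dpoly p) x = 0 by rewrite /psi ltNge ltW.
  apply: (@near_eq_is_derive _ _ _ (cst 0)) => //.
  near=> t; rewrite /psi; have -> : 0 < t = false by apply/negbTE; rewrite -leNgt ltW//; near: t; exact: lt_nbhsl.
  by [].
- have dV : is_derive x 1 (fun t : R => t^-1) (- (x ^- 2)).
    have x00 : x != 0 by rewrite gt_eqF.
    have := @is_deriveV _ id x 1 1 x00 (is_derive_id x (1 : R)).
    by rewrite /GRing.scale/= mulr1.
  have dE : is_derive x 1 (fun t => expR (- t^-1)) (expR (- x^-1) * x ^- 2).
    have dN : is_derive x 1 (fun t : R => - t^-1) (x ^- 2).
      by have := is_deriveN dV; rewrite opprK.
    exact: (@is_derive1_comp _ expR _ x _ _ (is_derive_expR _) dN).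
  have dP : is_derive x 1 (fun t => p.[t^-1]) (p^`().[x^-1] * - (x ^- 2)).
    exact: (@is_derive1_comp _ (horner p) _ x _ _ (is_derive_poly p _) dV).
  apply: (@near_eq_is_derive _ _ _ (fun t : R => p.[t^-1] * expR (- t^-1) : R)).
    near=> t; rewrite /psi ifT//; near: t; exact: lt_nbhsr.
  rewrite (_ : psi _ x = p^`().[x^-1] * - x ^- 2 * expR (- x^-1) + p.[x^-1] * (expR (- x^-1) * x ^- 2)).
    exact: is_deriveMf dP dE.
  rewrite /psi x0 /Dpoly hornerM hornerXn hornerD hornerN exprVn; ring.
- have [C HC] := psi_bound p.
  apply: (@is_derive_quadratic _ _ _ C) => h h1.
  by rewrite /psi ltxx mulr0 !subr0 add0r; exact: HC.
Unshelve. all: by end_near. Qed.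

End Bump.

(** * Mollifiers with their derivatives of all orders *)

Section Mollifier.
Context {R : realType}.
Implicit Types (x e : R) (k : nat).

Lemma psiN (p : {poly R}) x : psi (- p) x = - psi p x.
Proof. by rewrite /psi; case: ifP; rewrite ?oppr0// hornerN mulNr. Qed.

(** A pair of polynomials encodes one product of flat functions of [1 + x] and [1 - x]. Derivatives
    of the bump are finite lists of such pairs: [bump_deriv] is the product rule, its minus sign the
    inner derivative of [1 - x]. *)
Definition bump_terms := seq ({poly R} * {poly R}).

Definition bump_sum (l : bump_terms) x : R :=
  \sum_(pq <- l) psi pq.1 (1 + x) * psi pq.2 (1 - x).

Definition bump_deriv (l : bump_terms) : bump_terms :=
  flatten [seq [:: (Dpoly pq.1, pq.2); (pq.1, - Dpoly pq.2)] | pq <- l].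

Lemma is_derive_bump_sum l x : is_derive x 1 (bump_sum l) (bump_sum (bump_deriv l) x).
Proof.
elim: l => [|[p q] l ih].
  rewrite /bump_sum big_nil (_ : (fun x => _) = cst 0); first exact: is_derive_cst.
  by apply/funext => t; rewrite big_nil.
rewrite (_ : bump_sum _ = fun t => psi p (1 + t) * psi q (1 - t) + bump_sum l t); last first.
  by apply/funext => t; rewrite /bump_sum big_cons.
rewrite /bump_sum /bump_deriv/= !big_cons/= addrA; apply: is_deriveDf => //.
have dp : is_derive x 1 (fun t => psi p (1 + t)) (psi (Dpoly p) (1 + x)).
  have dl : is_derive x 1 (fun t : R => 1 + t) 1.
    by have := is_deriveDf (is_derive_cst (1 : R) x (1 : R)) (is_derive_id x (1 : R)); rewrite add0r.
  by have := @is_derive1_comp _ (psi p) _ x _ _ (is_derive_psi _ _) dl; rewrite mulr1.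
have dq : is_derive x 1 (fun t => psi q (1 - t)) (- psi (Dpoly q) (1 - x)).
  have dl : is_derive x 1 (fun t : R => 1 - t) (-1).
    by have := is_deriveB (is_derive_cst (1 : R) x (1 : R)) (is_derive_id x (1 : R)); rewrite sub0r.
  by have := @is_derive1_comp _ (psi q) _ x _ _ (is_derive_psi _ _) dl; rewrite mulrN1.
by have := is_deriveMf dp dq; rewrite psiN mulrN.
Qed.

Definition bump k : R -> R := bump_sum (iter k bump_deriv [:: (1, 1)]).

Lemma is_derive_bump k x : is_derive x 1 (bump k) (bump k.+1 x).
Proof. exact: is_derive_bump_sum. Qed.

Lemma bump_support k x : 1 <= `|x| -> bump k x = 0.
Proof.
move=> x1; rewrite /bump /bump_sum big1// => pq _; rewrite /psi.
move: x1; rewrite ler_normr => /orP[h|h].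
  by rewrite [X in _ * X]ifF ?mulr0//; apply/negbTE; rewrite -leNgt; lra.
by rewrite ifF ?mul0r//; apply/negbTE; rewrite -leNgt; lra.
Qed.

Lemma psi1_ge0 x : 0 <= psi (1 : {poly R}) x.
Proof. by rewrite /psi; case: ifP => // _; rewrite hornerC mul1r expR_ge0. Qed.

Lemma bump_ge0 x : 0 <= bump 0 x.
Proof. by rewrite /bump /bump_sum/= big_seq1 mulr_ge0// psi1_ge0. Qed.

Lemma bump_gt0 : 0 < bump 0 0.
Proof.
rewrite /bump /bump_sum/= big_seq1/= addr0 subr0 /psi ltr01 hornerC mul1r.
by rewrite mulr_gt0// expR_gt0.
Qed.

Lemma segint_subset (l L : R) (h : R -> R) : l <= L -> continuous h ->
  (forall x, 0 <= h x) -> segint l h <= segint L h.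
Proof.
move=> lL ch h0; rewrite /segint /Rintegral; apply: fine_le.
- exact/integrable_fin_num/segment_integrable.
- exact/integrable_fin_num/segment_integrable.
apply: ge0_subset_integral => //=.
- by apply/measurable_EFinP/measurable_funTS; exact: continuous_measurable_fun.
- by move=> t _; rewrite lee_fin.
- by move=> t /=; rewrite !in_itv/= => /andP[? ?]; apply/andP; split; lra.
Qed.

Lemma segint_gt0 (L : R) (h : R -> R) : 0 < L -> continuous h ->
  (forall x, 0 <= h x) -> 0 < h 0 -> 0 < segint L h.
Proof.
move=> L0 ch h0 h00.
have e0 : 0 < h 0 / 2 by lra.
have /cvgrPdist_lt/(_ _ e0)/nbhs_ballP[d /= d0 dP] := ch 0.
pose l := Num.min (d / 2) L.
have l0 : 0 < l by rewrite lt_min L0 andbT; lra.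
have lL : l <= L by rewrite ge_min lexx orbT.
have ld : l <= d / 2 by rewrite ge_min lexx.
apply: lt_le_trans (segint_subset lL ch h0).
apply: (@lt_le_trans _ _ (h 0 / 2 * (2 * l))); first by rewrite mulr_gt0//; lra.
rewrite -segint_cst; last exact: ltW.
apply: le_segint => //; first exact: contC.
move=> t /andP[t1 t2].
have := dP t; rewrite /ball/= sub0r normrN => /(_ _).
have td : `|t| < d by rewrite ltr_norml; apply/andP; split; lra.
move=> /(_ td); rewrite ltr_norml => /andP[_]; lra.
Qed.

(* [a k] is the [k]-th derivative of the mollifier [a 0], whose support has half-width [e]. *)
Definition is_mollifier e (a : nat -> R -> R) :=
  [/\ forall k x, is_derive x 1 (a k) (a k.+1 x),
      forall k x, e <= `|x| -> a k x = 0,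
      forall x, 0 <= a 0%N x &
      segint e (a 0%N) = 1].

Lemma derivable_continuous (h h' : R -> R) :
  (forall x, is_derive x 1 h (h' x)) -> continuous h.
Proof.
move=> dh x; apply: differentiable_continuous; apply/derivable1_diffP.
by have [] := dh x.
Qed.

Lemma mollifier_exists e : 0 < e -> exists a, is_mollifier e a.
Proof.
move=> e0; pose b k x := bump k (x / e).
have db k x : is_derive x 1 (b k) (bump k.+1 (x / e) * e^-1).
  have dl : is_derive x 1 (fun t : R => t / e) e^-1.
    have := is_deriveMf (is_derive_id x (1 : R)) (is_derive_cst (e^-1 : R) x (1 : R)).
    by rewrite mul1r mulr0 addr0.
  exact: (@is_derive1_comp _ (bump k) _ x _ _ (is_derive_bump _ _) dl).
have cb k : continuous (b k) by exact: derivable_continuous (db k).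
have Z0 : 0 < segint e (b 0%N).
  apply: segint_gt0 => //; first by move=> x; exact: bump_ge0.
  by rewrite /b mul0r; exact: bump_gt0.
pose Z := segint e (b 0%N).
exists (fun k x => (Z^-1 * e^-1 ^+ k) * b k x); split.
- move=> k x; have := is_deriveMf (is_derive_cst (Z^-1 * e^-1 ^+ k : R) x (1 : R)) (db k x).
  rewrite mul0r add0r.
  have -> : Z^-1 * e^-1 ^+ k * (bump k.+1 (x / e) * e^-1) = Z^-1 * e^-1 ^+ k.+1 * b k.+1 x.
    by rewrite exprSr -!mulrA; congr (_ * (_ * _)); exact: mulrC.
  exact.
- move=> k x xe; rewrite /b bump_support ?mulr0// normrM normfV (gtr0_norm e0).
  by rewrite ler_pdivlMr// mul1r.
- by move=> x; rewrite expr0 mulr1 mulr_ge0 ?bump_ge0// invr_ge0 ltW.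
- by rewrite segintZ// expr0 mulr1 mulVf// gt_eqF.
Qed.

End Mollifier.

(** * Mollification on a square *)

Section Convolution.
Context {R : realType}.
Implicit Types (f g : R * R -> R) (L e : R) (a : nat -> R -> R).

Lemma norm_sqint_le L f (c : R) : 0 <= L -> continuous f ->
  (forall z, square L z -> `|f z| <= c) -> `|sqint L f| <= c * (2 * L) ^+ 2.
Proof.
move=> L0 cf fc; apply: le_trans (norm_sqint L0 cf) _.
rewrite -sqint_cst//; apply: le_sqint => //; first exact: continuous_normfun.
exact: contC.
Qed.

Lemma lipschitz2_continuous f (C : R) :
  (forall x y, `|f x - f y| <= C * (`|x.1 - y.1| + `|x.2 - y.2|)) -> continuous f.
Proof.
move=> H x; apply/cvgrPdist_lt => d d0.
have C1 : 0 < `|C| + 1 by rewrite ltr_wpDl.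
have dC : 0 < d / (2 * (`|C| + 1)) by rewrite divr_gt0// mulr_gt0.
near=> t; apply: le_lt_trans (H _ _) _.
have h1 : `|x.1 - t.1| < d / (2 * (`|C| + 1)).
  by near: t; have /cvgrPdist_lt := @cont_fst R x; apply.
have h2 : `|x.2 - t.2| < d / (2 * (`|C| + 1)).
  by near: t; have /cvgrPdist_lt := @cont_snd R x; apply.
have h3 : `|x.1 - t.1| + `|x.2 - t.2| < d / (`|C| + 1).
  apply: lt_le_trans (ltrD h1 h2) _.
  by rewrite le_eqVlt; apply/orP; left; apply/eqP; field; rewrite gt_eqF.
rewrite ltr_pdivlMr// in h3; apply: le_lt_trans h3; rewrite mulrC.
apply: ler_wpM2l; first exact: addr_ge0.
by rewrite (le_trans (ler_norm _))// lerDl.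
Unshelve. all: by end_near. Qed.

Lemma mean_value_bound (h h' : R -> R) (M : R) : (forall x : R, is_derive x 1 h (h' x)) ->
  (forall x : R, `|h' x| <= M) -> forall s t, `|h s - h t| <= M * `|s - t|.
Proof.
move=> dh hM s t; wlog st : s t / t <= s => [hw|].
  by have [/hw//|/ltW/hw] := leP t s; rewrite distrC [`|t - s|]distrC.
have [c _ ->] := MVT_segment st (fun c _ => dh c)
  (continuous_subspaceT (derivable_continuous dh)).
by rewrite normrM ler_wpM2r.
Qed.

(** The mean value theorem is applied to [h] minus its tangent [k], whose derivative the same
    theorem for [h'] bounds by [M * |d|]. *)
Lemma taylor_bound (h h' h'' : R -> R) (M : R) : (forall x : R, is_derive x 1 h (h' x)) ->
  (forall x : R, is_derive x 1 h' (h'' x)) -> (forall x : R, `|h'' x| <= M) ->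
  forall t d, `|h (t + d) - h t - d * h' t| <= M * d ^+ 2.
Proof.
move=> dh dh' hM t d.
pose k s := h (t + s) - s * h' t.
have dk (s : R) : is_derive s 1 k (h' (t + s) - h' t).
  have dl : is_derive s 1 (fun s : R => t + s) 1.
    by have := is_deriveDf (is_derive_cst (t : R) s (1 : R)) (is_derive_id s (1 : R)); rewrite add0r.
  have dc := @is_derive1_comp _ h _ s _ _ (dh _) dl.
  have dm := is_deriveMf (is_derive_id s (1 : R)) (is_derive_cst (h' t : R) s (1 : R)).
  by have := is_deriveB dc dm; rewrite mulr1 mul1r mulr0 addr0.
have := mean_value_bound dh' hM => lip.
have -> : h (t + d) - h t - d * h' t = k d - k 0 by rewrite /k addr0; ring.
have M0 : 0 <= M by exact: le_trans (hM 0).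
have kb u v : u <= v -> `|u| <= `|d| -> `|v| <= `|d| -> `|k v - k u| <= M * `|d| * (v - u).
  move=> uv ud vd.
  have [c] := MVT_segment uv (fun c _ => dk c)
    (continuous_subspaceT (derivable_continuous dk)).
  rewrite in_itv/= => /andP[uc cv] ->; rewrite normrM (@ger0_norm _ (v - u)) ?subr_ge0//.
  apply: ler_wpM2r; first by rewrite subr_ge0.
  apply: le_trans (lip _ _) _; apply: ler_wpM2l => //.
  rewrite (_ : t + c - t = c); last by ring.
  move: ud vd; rewrite !ler_norml => /andP[? ?] /andP[? ?]; apply/andP; split; lra.
have dd : d ^+ 2 = `|d| * `|d| by rewrite -expr2 real_normK ?num_real.
have [d0|d0] := leP 0 d.
  by have := kb 0 d d0; rewrite normr0 subr0 dd mulrA => /(_ (normr_ge0 _) (lexx _)); rewrite (ger0_norm d0).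
have := kb d 0 (ltW d0); rewrite normr0 sub0r dd mulrA => /(_ (lexx _) (normr_ge0 _)).
by rewrite distrC (ltr0_norm d0).
Qed.

Section FixedMollifier.
Variables (e : R) (a : nat -> R -> R).
Hypotheses (e0 : 0 < e) (ha : is_mollifier e a).

Let da k (x : R) : is_derive x 1 (a k) (a k.+1 x). Proof. by case: ha. Qed.
Let a_supp k x : e <= `|x| -> a k x = 0. Proof. by case: ha => _ + _ _; apply. Qed.
Let cont_a k : continuous (a k). Proof. exact: derivable_continuous (da k). Qed.

Lemma mollifier_bounded k : exists2 M, 0 < M & forall x, `|a k x| <= M.
Proof.
have ep := e0; have ca1 : continuous (fun z : R * R => a k z.1) by exact: cont_comp (@cont_fst R).
have [M M0 HM] := continuous_square_bounded e ca1.
exists M => // x; have [xe|ex] := leP e `|x|.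
  by rewrite a_supp// normr0 ltW.
apply: (HM (x, 0)); apply/squareP.
by move/ltW: ex; rewrite ler_norml => ->; split => //; apply/andP; split; lra.
Qed.

Definition kern i j (x w : R * R) : R := a i (x.1 - w.1) * a j (x.2 - w.2).

(* The [(i, j)]-th derivative of the convolution of [f] with the product mollifier, at the
   points of [square (L - e)]; elsewhere truncating the integral to [square L] matters. *)
Definition mollify L f i j (x : R * R) : R := sqint L (fun w => f w * kern i j x w).

Lemma cont_kern i j x : continuous (kern i j x).
Proof.
apply: contM; apply: cont_comp => //; apply: contB; try exact: contC.
  exact: cont_fst.
exact: cont_snd.
Qed.

Lemma kern_lipschitz i j : exists2 C, 0 <= C & forall x y w,
  `|kern i j x w - kern i j y w| <= C * (`|x.1 - y.1| + `|x.2 - y.2|).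
Proof.
have [Mi Mi0 bi] := mollifier_bounded i; have [Mj Mj0 bj] := mollifier_bounded j.
have [Ni Ni0 ci] := mollifier_bounded i.+1; have [Nj Nj0 cj] := mollifier_bounded j.+1.
exists (Ni * Mj + Mi * Nj); first by nonneg.
move=> x y w; rewrite /kern.
have h1 := mean_value_bound (da i) ci (x.1 - w.1) (y.1 - w.1).
have h2 := mean_value_bound (da j) cj (x.2 - w.2) (y.2 - w.2).
rewrite (_ : x.1 - w.1 - _ = x.1 - y.1) in h1; last by ring.
rewrite (_ : x.2 - w.2 - _ = x.2 - y.2) in h2; last by ring.
rewrite (_ : _ - _ = (a i (x.1 - w.1) - a i (y.1 - w.1)) * a j (x.2 - w.2) +
   a i (y.1 - w.1) * (a j (x.2 - w.2) - a j (y.2 - w.2))); last by ring.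
apply: le_trans (ler_normD _ _) _; rewrite !normrM.
have p1 := ler_pM (normr_ge0 _) (normr_ge0 _) h1 (bj (x.2 - w.2)).
have p2 := ler_pM (normr_ge0 _) (normr_ge0 _) (bi (y.1 - w.1)) h2.
apply: le_trans (lerD p1 p2) _.
have q1 : 0 <= Ni * Mj * `|x.2 - y.2| by nonneg.
have q2 : 0 <= Mi * Nj * `|x.1 - y.1| by nonneg.
by move: q1 q2; move: `|x.1 - y.1| `|x.2 - y.2|; clear => ? ? *; lra.
Qed.

Lemma cont_mollify L f i j : 0 <= L -> continuous f -> continuous (mollify L f i j).
Proof.
move=> L0 cf; have [C C0 HC] := kern_lipschitz i j.
have [M M0 HM] := continuous_square_bounded L cf.
apply: (@lipschitz2_continuous _ (M * C * (2 * L) ^+ 2)) => x y.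
have ckx := @cont_kern i j x; have cky := @cont_kern i j y.
have -> : mollify L f i j x - mollify L f i j y =
    sqint L (fun w => f w * (kern i j x w - kern i j y w)).
  rewrite /mollify -[X in _ + X]mulN1r -sqintZ//; last by cont.
  rewrite -sqintD//; [|by cont..].
  by apply: eq_sqint => w _; ring.
rewrite [leRHS]mulrAC; apply: norm_sqint_le => //; first by cont.
move=> w wL; rewrite normrM -mulrA; apply: ler_pM => //; exact: HM.
Qed.

(** The Taylor remainder of the kernel is quadratic uniformly over the square, so the derivative of
    the integral is read off from a remainder estimate without exchanging limit and integral. *)
Lemma d1_mollify L f i j : 0 <= L -> continuous f -> d1 (mollify L f i j) (mollify L f i.+1 j).
Proof.
move=> L0 cf x y.
have [M M0 HM] := continuous_square_bounded L cf.
have [Mj Mj0 bj] := mollifier_bounded j; have [Mi Mi0 bi] := mollifier_bounded i.+2.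
apply: (@is_derive_quadratic _ _ _ _ (M * (Mi * Mj) * (2 * L) ^+ 2)) => h _.
have c1 := @cont_kern i j (x, y); have c2 := @cont_kern i j (x + h, y).
have c3 := @cont_kern i.+1 j (x, y).
have -> : mollify L f i j (x + h, y) - mollify L f i j (x, y) - h * mollify L f i.+1 j (x, y) =
    sqint L (fun w => f w * (kern i j (x + h, y) w - kern i j (x, y) w - h * kern i.+1 j (x, y) w)).
  rewrite /mollify -[- (h * _)]mulNr -[X in _ + X + _]mulN1r.
  rewrite -sqintZ//; last by cont.
  rewrite -sqintZ//; last by cont.
  rewrite -sqintD//; [|by cont..].
  rewrite -sqintD//; [|by cont..].
  by apply: eq_sqint => w _; ring.
rewrite [leRHS]mulrAC; apply: norm_sqint_le => //; first by cont.
move=> w wL; rewrite normrM -mulrA; apply: ler_pM => //; first exact: HM.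
rewrite /kern/= (_ : _ - _ - _ = (a i (x - w.1 + h) - a i (x - w.1) - h * a i.+1 (x - w.1)) * a j (y - w.2)); last first.
  by rewrite (_ : x + h - w.1 = x - w.1 + h); ring.
rewrite normrM mulrAC; apply: ler_pM => //.
exact: taylor_bound (da i) (da i.+1) bi _ _.
Qed.

Lemma d2_mollify L f i j : 0 <= L -> continuous f -> d2 (mollify L f i j) (mollify L f i j.+1).
Proof.
move=> L0 cf x y.
have [M M0 HM] := continuous_square_bounded L cf.
have [Mj Mj0 bj] := mollifier_bounded i; have [Mi Mi0 bi] := mollifier_bounded j.+2.
apply: (@is_derive_quadratic _ _ _ _ (M * (Mi * Mj) * (2 * L) ^+ 2)) => h _.
have c1 := @cont_kern i j (x, y); have c2 := @cont_kern i j (x, y + h).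
have c3 := @cont_kern i j.+1 (x, y).
have -> : mollify L f i j (x, y + h) - mollify L f i j (x, y) - h * mollify L f i j.+1 (x, y) =
    sqint L (fun w => f w * (kern i j (x, y + h) w - kern i j (x, y) w - h * kern i j.+1 (x, y) w)).
  rewrite /mollify -[- (h * _)]mulNr -[X in _ + X + _]mulN1r.
  rewrite -sqintZ//; last by cont.
  rewrite -sqintZ//; last by cont.
  rewrite -sqintD//; [|by cont..].
  rewrite -sqintD//; [|by cont..].
  by apply: eq_sqint => w _; ring.
rewrite [leRHS]mulrAC; apply: norm_sqint_le => //; first by cont.
move=> w wL; rewrite normrM -mulrA; apply: ler_pM => //; first exact: HM.
rewrite /kern/= (_ : _ - _ - _ = (a j (y - w.2 + h) - a j (y - w.2) - h * a j.+1 (y - w.2)) * a i (x - w.1)); last first.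
  by rewrite (_ : y + h - w.2 = y - w.2 + h); ring.
rewrite normrM mulrAC; apply: ler_pM => //.
exact: taylor_bound (da j) (da j.+1) bi _ _.
Qed.

Lemma mollifyD L f g i j x : 0 <= L -> continuous f -> continuous g ->
  mollify L (fun z => f z + g z) i j x = mollify L f i j x + mollify L g i j x.
Proof.
move=> L0 cf cg; have ck := @cont_kern i j x.
by rewrite /mollify -sqintD//; [apply: eq_sqint => w _; ring|cont..].
Qed.

Lemma mollifyZ L (c : R) f i j x : 0 <= L -> continuous f ->
  mollify L (fun z => c * f z) i j x = c * mollify L f i j x.
Proof.
move=> L0 cf; have ck := @cont_kern i j x.
by rewrite /mollify -sqintZ//; [apply: eq_sqint => w _; ring|cont].
Qed.

Lemma kern_boundary L i j x : square (L - e) x ->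
  vanishes_on_boundary L (kern i j x).
Proof.
have ep := e0; case: x => x1 x2 /squareP[/andP[h1 h2] /andP[h3 h4]] s _.
have b k (t : R) : - (L - e) <= t -> t <= L - e -> a k (t - L) = 0 /\ a k (t - - L) = 0.
  by move=> t1 t2; split; apply: a_supp; rewrite ler_normr; apply/orP; [right|left]; lra.
rewrite /kern/=.
have [-> ->] := b i _ h1 h2; have [-> ->] := b j _ h3 h4.
by rewrite !(mul0r, mulr0).
Qed.

Lemma d1_kern i j (x : R * R) : d1 (kern i j x) (fun w => - kern i.+1 j x w).
Proof.
move=> s t; rewrite /kern/=.
have dl : is_derive s 1 (fun s : R => x.1 - s) (-1).
  by have := is_deriveB (is_derive_cst (x.1 : R) s (1 : R)) (is_derive_id s (1 : R)); rewrite sub0r.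
have dc := @is_derive1_comp _ (a i) _ s _ _ (da i _) dl.
have := is_deriveMf dc (is_derive_cst (a j (x.2 - t) : R) s (1 : R)).
by rewrite mulr0 addr0 mulrN1 mulNr.
Qed.

Lemma d2_kern i j (x : R * R) : d2 (kern i j x) (fun w => - kern i j.+1 x w).
Proof.
move=> s t; rewrite /kern/=.
have dl : is_derive t 1 (fun s : R => x.2 - s) (-1).
  by have := is_deriveB (is_derive_cst (x.2 : R) t (1 : R)) (is_derive_id t (1 : R)); rewrite sub0r.
have dc := @is_derive1_comp _ (a j) _ t _ _ (da j _) dl.
have := is_deriveMf (is_derive_cst (a i (x.1 - s) : R) t (1 : R)) dc.
by rewrite mul0r add0r mulrN1 mulrN.
Qed.

(** Two signs cancel, that of the integration by parts and that of differentiating the kernel in its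
    integration variable. The distance [e] of [x] from the boundary makes the boundary values
    vanish. *)
Lemma mollify_parts1 L g g1 i j x : 0 < L -> continuous g -> continuous g1 -> d1 g g1 ->
  square (L - e) x -> mollify L g1 i j x = mollify L g i.+1 j x.
Proof.
move=> L0 cg cg1 dg xL; have ck := @cont_kern i j x; have ck1 := @cont_kern i.+1 j x.
have := sqint_d1 L0 _ (d1M dg (@d1_kern i j x)) _ => /(_ ltac:(by cont)) H.
have {H} : sqint L (fun w => g1 w * kern i j x w + g w * - kern i.+1 j x w) = 0.
  apply: H => s sL; have [-> -> -> ->] := @kern_boundary L i j x xL s sL.
  by rewrite !mulr0.
rewrite sqintD ?(ltW L0)//; [|by cont..].
rewrite (_ : (fun z => g z * - _) = (fun z => -1 * (g z * kern i.+1 j x z))); last by apply/funext => z; ring.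
rewrite sqintZ ?(ltW L0)//; last by cont.
by rewrite mulN1r => /eqP; rewrite subr_eq0 => /eqP.
Qed.

Lemma mollify_parts2 L g g2 i j x : 0 < L -> continuous g -> continuous g2 -> d2 g g2 ->
  square (L - e) x -> mollify L g2 i j x = mollify L g i j.+1 x.
Proof.
move=> L0 cg cg1 dg xL; have ck := @cont_kern i j x; have ck1 := @cont_kern i j.+1 x.
have := sqint_d2 L0 _ (d2M dg (@d2_kern i j x)) _ => /(_ ltac:(by cont)) H.
have {H} : sqint L (fun w => g2 w * kern i j x w + g w * - kern i j.+1 x w) = 0.
  apply: H => s sL; have [-> -> -> ->] := @kern_boundary L i j x xL s sL.
  by rewrite !mulr0.
rewrite sqintD ?(ltW L0)//; [|by cont..].
rewrite (_ : (fun z => g z * - _) = (fun z => -1 * (g z * kern i j.+1 x z))); last by apply/funext => z; ring.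
rewrite sqintZ ?(ltW L0)//; last by cont.
by rewrite mulN1r => /eqP; rewrite subr_eq0 => /eqP.
Qed.

(** The integral of the translate is a difference of two values of a primitive of the mollifier, and
    this primitive is constant on either side of the support. *)
Lemma segint_mollifier L (s : R) : - (L - e) <= s <= L - e ->
  segint L (fun w => a 0%N (s - w)) = 1.
Proof.
move=> /andP[s1 s2]; have ep := e0.
have a0v (t : R) : t < - e -> a 0%N t = 0.
  by move=> te; apply: a_supp; rewrite ler_normr; apply/orP; right; lra.
pose A := left_primitive (a 0%N).
have dA (t : R) : is_derive t 1 A (a 0%N t) by exact: is_derive_left_primitive (@cont_a 0%N) a0v.
have L0 : 0 < L by lra.
have dF (t : R) : is_derive t 1 (fun w => - A (s - w)) (a 0%N (s - t)).
  have dl : is_derive t 1 (fun w : R => s - w) (-1).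
    by have := is_deriveB (is_derive_cst (s : R) t (1 : R)) (is_derive_id t (1 : R)); rewrite sub0r.
  have := is_deriveN (@is_derive1_comp _ A _ t _ _ (dA _) dl).
  by rewrite mulrN1 opprK.
rewrite (segint_is_derive L0 _ dF); last first.
  by apply: cont_comp => //; apply: contB; [exact: contC|move=> t; exact: cvg_id].
have <- : segint e (a 0%N) = 1 by case: ha.
rewrite (segint_is_derive e0 (@cont_a 0%N) dA) opprK.
have cst_A (u v : R) : u <= v -> (forall c, u < c < v -> a 0%N c = 0) -> A u = A v.
  rewrite le_eqVlt => /predU1P[->//|uv] h.
  have [c] := MVT uv (fun c _ => dA c) (continuous_subspaceT (derivable_continuous dA)).
  by rewrite in_itv/= => /h -> /eqP; rewrite mul0r subr_eq0 => /eqP.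
rewrite (cst_A (s - L) (- e)); [|lra|move=> c /andP[_ ce]; apply: a0v; lra].
rewrite (cst_A e (s - - L)); [by rewrite addrC|lra|].
by move=> c /andP[ce _]; apply: a_supp; rewrite ler_normr (ltW ce).
Qed.

Lemma sqint_kern L x : square (L - e) x -> sqint L (kern 0 0 x) = 1.
Proof.
have ep := e0; case: x => x1 x2 /squareP[h1 h2]; have L0 : 0 <= L by move: h1 => /andP[? ?]; lra.
have ca2 : continuous (fun w : R => a 0%N (x2 - w)).
  by apply: cont_comp => //; apply: contB; [exact: contC|move=> t; exact: cvg_id].
rewrite sqint_iterated1//; last exact: cont_kern.
rewrite -(segint_mollifier h1); apply: eq_segint => s _; rewrite /kern/=.
by rewrite segintZ// segint_mollifier// mulr1.
Qed.

Lemma mollify_approx L f (d : R) x : continuous f -> square (L - e) x ->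
  (forall w, `|x.1 - w.1| < e -> `|x.2 - w.2| < e -> `|f x - f w| <= d) ->
  `|mollify L f 0 0 x - f x| <= d.
Proof.
move=> cf xL H; have ep := e0; have L0 : 0 <= L.
  by case: x xL {H} => x1 x2 /squareP[/andP[? ?] _]; lra.
have ck := @cont_kern 0 0 x.
have a0 t : 0 <= a 0%N t by case: ha.
have -> : mollify L f 0 0 x - f x = sqint L (fun w => (f w - f x) * kern 0 0 x w).
  rewrite /mollify -[X in _ - X = _]mulr1 -(sqint_kern xL) -mulNr -sqintZ// -sqintD//; [|by cont..].
  by apply: eq_sqint => w _; ring.
apply: le_trans (norm_sqint L0 _) _; first by cont.
rewrite -[leRHS]mulr1 -(sqint_kern xL) -sqintZ//.
apply: le_sqint => //; [by cont..|].
move=> w _; rewrite normrM.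
have k0 : 0 <= kern 0 0 x w by rewrite mulr_ge0.
rewrite (ger0_norm k0).
have [h1|h1] := leP e `|x.1 - w.1|; first by rewrite /kern a_supp// mul0r !mulr0.
have [h2|h2] := leP e `|x.2 - w.2|; first by rewrite /kern [a _ (x.2 - _)]a_supp// !mulr0.
by apply: ler_wpM2r => //; rewrite distrC; exact: H.
Qed.

End FixedMollifier.

Lemma mollify_uniform L f (d : R) : continuous f -> 0 < d ->
  exists2 e0, 0 < e0 <= 1 & forall e a, 0 < e <= e0 -> is_mollifier e a ->
    forall x, square L x -> `|mollify a (L + 1) f 0 0 x - f x| <= d.
Proof.
move=> cf d0; have [r r0 rP] := square_uniform_continuity L cf d0.
exists (Num.min r 1); first by rewrite lt_min r0 ltr01/= ge_min lexx orbT.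
move=> e a /andP[e0]; rewrite le_min => /andP[er e1] ha x xL.
apply: (mollify_approx e0 ha cf).
  case: x xL => x1 x2 /squareP[/andP[? ?] /andP[? ?]].
  by apply/squareP; split; apply/andP; split; lra.
by move=> w h1 h2; apply/ltW/rP => //; [exact: lt_le_trans h1 er|exact: lt_le_trans h2 er].
Qed.

End Convolution.

(** * Mollified weak solutions *)

Section PartialDerivatives.
Context {R : realType}.
Implicit Types (f g : R * R -> R) (F : R * R -> R * R).

Lemma ord2_cases (k : 'I_2) : k = ord0 \/ k = lift ord0 ord0.
Proof.
by case: k => [[|[|//]] h]; [left|right]; apply: val_inj.
Qed.

Lemma shift1E (V : Type) (f : R * R -> V) (x y h : R) :
  (f \o shift (x, y)) (h *: ((1, 0) : R * R)) = f (h *: (1 : R) + x, y).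
Proof.
rewrite /= /shift/=; congr (f _); apply: injective_projections => //=.
by rewrite /GRing.scale/= mulr0 add0r.
Qed.

Lemma shift2E (V : Type) (f : R * R -> V) (x y h : R) :
  (f \o shift (x, y)) (h *: ((0, 1) : R * R)) = f (x, h *: (1 : R) + y).
Proof.
rewrite /= /shift/=; congr (f _); apply: injective_projections => //=.
by rewrite /GRing.scale/= mulr0 add0r.
Qed.

(** [pd] differentiates in the plane, whereas integration by parts uses slices; the two difference
    quotients are the same function of the increment. *)
Lemma is_derive_slice1 f (x y l : R) :
  is_derive (x, y) ((1, 0) : R * R) f l <-> is_derive x 1 (fun s => f (s, y)) l.
Proof.
have E : (fun h : R => h^-1 *: ((f \o shift (x, y)) (h *: ((1, 0) : R * R)) - f (x, y))) =
    (fun h : R => h^-1 *: (((fun s => f (s, y)) \o shift x) (h *: (1 : R)) - f (x, y))).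
  by apply/funext => h; rewrite shift1E.
split=> -[d v]; split.
- by move: d; rewrite /derivable E.
- by move: v; rewrite /derive E.
- by rewrite /derivable E.
- by rewrite /derive E.
Qed.

Lemma is_derive_slice2 f (x y l : R) :
  is_derive (x, y) ((0, 1) : R * R) f l <-> is_derive y 1 (fun t => f (x, t)) l.
Proof.
have E : (fun h : R => h^-1 *: ((f \o shift (x, y)) (h *: ((0, 1) : R * R)) - f (x, y))) =
    (fun h : R => h^-1 *: (((fun t => f (x, t)) \o shift y) (h *: (1 : R)) - f (x, y))).
  by apply/funext => h; rewrite shift2E.
split=> -[d v]; split.
- by move: d; rewrite /derivable E.
- by move: v; rewrite /derive E.
- by rewrite /derivable E.
- by rewrite /derive E.
Qed.

Lemma pd1E f f' : d1 f f' -> pd ord0 f = f'.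
Proof.
move=> df; apply/funext => -[x y].
have /is_derive_slice1 d := df x y.
by rewrite /pd /basis_vec eqxx; exact: derive_val.
Qed.

Lemma pd2E f f' : d2 f f' -> pd (lift ord0 ord0) f = f'.
Proof.
move=> df; apply/funext => -[x y].
have /is_derive_slice2 d := df x y.
by rewrite /pd /basis_vec/=; exact: derive_val.
Qed.

Lemma pd_fst F k : (forall z, differentiable F z) -> forall z,
  is_derive z (basis_vec R k) (fun z => (F z).1) (pd k F z).1.
Proof.
move=> dF z; have dv : derivable F z (basis_vec R k) by exact: diff_derivable.
have cv : ((fun h : R => h^-1 *: ((F \o shift z) (h *: basis_vec R k) - F z)) @ 0^') --> pd k F z by exact: dv.
have cv1 := cvg_comp _ _ cv (@cont_fst R (pd k F z)).
by split; [apply/cvg_ex; exists (pd k F z).1; exact: cv1|exact: (cvg_lim _ cv1)].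
Qed.

Lemma pd_snd F k : (forall z, differentiable F z) -> forall z,
  is_derive z (basis_vec R k) (fun z => (F z).2) (pd k F z).2.
Proof.
move=> dF z; have dv : derivable F z (basis_vec R k) by exact: diff_derivable.
have cv : ((fun h : R => h^-1 *: ((F \o shift z) (h *: basis_vec R k) - F z)) @ 0^') --> pd k F z by exact: dv.
have cv1 := cvg_comp _ _ cv (@cont_snd R (pd k F z)).
by split; [apply/cvg_ex; exists (pd k F z).2; exact: cv1|exact: (cvg_lim _ cv1)].
Qed.

Lemma pd_pair F f1 f2 k : (forall z, differentiable F z) ->
  (forall z, is_derive z (basis_vec R k) (fun z => (F z).1) (f1 z)) ->
  (forall z, is_derive z (basis_vec R k) (fun z => (F z).2) (f2 z)) ->
  pd k F = fun z => (f1 z, f2 z).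
Proof.
move=> dF d1F d2F; apply/funext => z; apply: injective_projections => /=.
  have h1 := pd_fst k dF z; have h2 := d1F z.
  by rewrite -(@derive_val _ _ _ _ _ _ _ h1) (@derive_val _ _ _ _ _ _ _ h2).
have h1 := pd_snd k dF z; have h2 := d2F z.
by rewrite -(@derive_val _ _ _ _ _ _ _ h1) (@derive_val _ _ _ _ _ _ _ h2).
Qed.

End PartialDerivatives.

(** * Smooth compactly supported test fields *)

Section TestFunction.
Context {R : realType}.
Variables (e : R) (a : nat -> R -> R).
Hypotheses (e0 : 0 < e) (ha : is_mollifier e a).

Let da k (x : R) : is_derive x 1 (a k) (a k.+1 x). Proof. by case: ha. Qed.

(* Arbitrary derivatives of the mollifier in both components, so that the family is closed
   under partial differentiation. *)
Definition test_field (c1 c2 : R) i j k l (x y : R * R) : R * R :=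
  (c1 * kern a i j x y, c2 * kern a k l x y).

Lemma differentiable_kern i j (x : R * R) z : differentiable (kern a i j x) z.
Proof.
have dfst : differentiable (fst : R * R -> R) z.
  by apply: (@linear_differentiable _ _ _ (fst : {linear (R * R)%type -> R})); exact: cont_fst.
have dsnd : differentiable (snd : R * R -> R) z.
  by apply: (@linear_differentiable _ _ _ (snd : {linear (R * R)%type -> R})); exact: cont_snd.
rewrite /kern; apply: differentiableM.
- apply: (@differentiable_comp _ _ _ _ (fun w : R * R => x.1 - w.1) (a i)).
    exact: differentiableB.
  by apply/derivable1_diffP; have [] := da i (x.1 - z.1).
- apply: (@differentiable_comp _ _ _ _ (fun w : R * R => x.2 - w.2) (a j)).
    exact: differentiableB.
  by apply/derivable1_diffP; have [] := da j (x.2 - z.2).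
Qed.

Lemma differentiable_test c1 c2 i j k l x z : differentiable (test_field c1 c2 i j k l x) z.
Proof.
have cd (c : R) : differentiable (fun _ : R * R => c) z by exact: differentiable_cst.
by apply: differentiable_pair; apply: differentiableM => //; exact: differentiable_kern.
Qed.

Lemma pd1_test c1 c2 i j k l x :
  pd ord0 (test_field c1 c2 i j k l x) = test_field (- c1) (- c2) i.+1 j k.+1 l x.
Proof.
have D c m n z : is_derive z (basis_vec R ord0) (fun y => c * kern a m n x y) (- c * kern a m.+1 n x z).
  case: z => s t; rewrite /basis_vec eqxx; apply/is_derive_slice1.
  by have := d1Z c (d1_kern ha m n x) s t; rewrite mulrN mulNr.
exact: (@pd_pair _ (test_field c1 c2 i j k l x) _ _ _ (differentiable_test _ _ _ _ _ _ _) (D c1 i j) (D c2 k l)).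
Qed.

Lemma pd2_test c1 c2 i j k l x : pd (lift ord0 ord0) (test_field c1 c2 i j k l x) =
  test_field (- c1) (- c2) i j.+1 k l.+1 x.
Proof.
have D c m n z : is_derive z (basis_vec R (lift ord0 ord0)) (fun y => c * kern a m n x y) (- c * kern a m n.+1 x z).
  case: z => s t; rewrite /basis_vec/=; apply/is_derive_slice2.
  by have := d2Z c (d2_kern ha m n x) s t; rewrite mulrN mulNr.
exact: (@pd_pair _ (test_field c1 c2 i j k l x) _ _ _ (differentiable_test _ _ _ _ _ _ _) (D c1 i j) (D c2 k l)).
Qed.

Lemma Cinfty_test c1 c2 i j k l x : Cinfty (test_field c1 c2 i j k l x).
Proof.
move=> n; elim: n c1 c2 i j k l => [|n ih] c1 c2 i j k l.
  by move=> z; apply: differentiable_continuous; exact: differentiable_test.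
split; first by move=> z; exact: differentiable_test.
by move=> m; have [->|->] := ord2_cases m; rewrite ?pd1_test ?pd2_test; exact: ih.
Qed.

Lemma kern_out L i j x z : square (L - e) x -> ~ square L z -> kern a i j x z = 0.
Proof.
case: x => x1 x2; case: z => s t /squareP[/andP[h1 h2] /andP[h3 h4]] nz.
have ep := e0; have [_ a_supp _ _] := ha.
rewrite /kern/=; have [sL|sL] := boolP (- L <= s <= L).
  rewrite [a j _]a_supp ?mulr0//.
  have : ~~ (- L <= t <= L) by apply/negP => tL; apply: nz; apply/squareP.
  rewrite negb_and -!ltNge => /orP[tL|tL].
    by rewrite ler_normr; apply/orP; left; lra.
  by rewrite ler_normr; apply/orP; right; lra.
rewrite a_supp ?mul0r//; move: sL.
rewrite negb_and -!ltNge => /orP[tL|tL].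
  by rewrite ler_normr; apply/orP; left; lra.
by rewrite ler_normr; apply/orP; right; lra.
Qed.

Lemma compact_support_test c1 c2 i j k l L x : square (L - e) x ->
  compact_support (test_field c1 c2 i j k l x).
Proof.
move=> xL; apply: (@subclosed_compact _ _ (square L)).
- exact: closed_closure.
- exact: square_compact.
have cl : closed (square L).
  by apply: compact_closed; [exact: norm_hausdorff|exact: square_compact].
apply: (subset_trans _ cl); apply: closure_subset => z /=.
move=> nz0; apply: contrapT => nz; move/eqP: nz0; apply.
by rewrite /test_field !(kern_out _ _ xL nz) !mulr0.
Qed.

End TestFunction.

Section NavierStokesMollified.
Context {R : realType}.
Variable u : R * R -> R * R.
Hypotheses (hC1 : Cn 1 u) (hNS : NS_weak_solution u).

Let i1 : 'I_2 := lift ord0 ord0.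
Definition vel1 (z : R * R) : R := (u z).1.
Definition vel2 (z : R * R) : R := (u z).2.
Definition vel11 : R * R -> R := Dcomp ord0 ord0 u.
Definition vel12 : R * R -> R := Dcomp i1 ord0 u.
Definition vel21 : R * R -> R := Dcomp ord0 i1 u.
Definition vel22 : R * R -> R := Dcomp i1 i1 u.

Lemma sum2 (F : 'I_2 -> R) : \sum_(i < 2) F i = F ord0 + F i1.
Proof. by rewrite !big_ord_recl big_ord0 addr0. Qed.

Let du z : differentiable u z. Proof. by case: hC1. Qed.

Lemma cont_vel : continuous vel1 /\ continuous vel2.
Proof.
have cu : continuous u by move=> z; exact: differentiable_continuous.
split=> z.
  by apply: (@continuous_comp _ _ _ u fst); [exact: cu|exact: cont_fst].
by apply: (@continuous_comp _ _ _ u snd); [exact: cu|exact: cont_snd].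
Qed.

Lemma vel_derive k z :
  is_derive z (basis_vec R k) vel1 (pd k u z).1 /\
  is_derive z (basis_vec R k) vel2 (pd k u z).2.
Proof. by split; [exact: pd_fst|exact: pd_snd]. Qed.

Lemma DcompE k : Dcomp k ord0 u = (fun z => (pd k u z).1) /\
  Dcomp k i1 u = (fun z => (pd k u z).2).
Proof.
split; apply/funext => z; have [h1 h2] := vel_derive k z.
  exact: (@derive_val _ _ _ _ _ _ _ h1).
exact: (@derive_val _ _ _ _ _ _ _ h2).
Qed.

Lemma cont_Dvel : [/\ continuous vel11, continuous vel12, continuous vel21 & continuous vel22].
Proof.
have cp k : continuous (pd k u) by case: hC1 => _; exact.
have c1 k : continuous (Dcomp k ord0 u).
  rewrite (DcompE k).1 => z; apply: (@continuous_comp _ _ _ (pd k u) fst); [exact: cp|exact: cont_fst].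
have c2 k : continuous (Dcomp k i1 u).
  rewrite (DcompE k).2 => z; apply: (@continuous_comp _ _ _ (pd k u) snd); [exact: cp|exact: cont_snd].
by split; [exact: c1|exact: c1|exact: c2|exact: c2].
Qed.

Lemma d_vel : [/\ d1 vel1 vel11, d2 vel1 vel12, d1 vel2 vel21 & d2 vel2 vel22].
Proof.
have E1 k := (DcompE k).1; have E2 k := (DcompE k).2.
split=> x y.
- apply/is_derive_slice1; rewrite /vel11 E1.
  by have := (vel_derive ord0 (x, y)).1; rewrite /basis_vec eqxx.
- apply/is_derive_slice2; rewrite /vel12 E1.
  exact: (vel_derive i1 (x, y)).1.
- apply/is_derive_slice1; rewrite /vel21 E2.
  by have := (vel_derive ord0 (x, y)).2; rewrite /basis_vec eqxx.
- apply/is_derive_slice2; rewrite /vel22 E2.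
  exact: (vel_derive i1 (x, y)).2.
Qed.

Lemma vel_div z : vel11 z + vel22 z = 0.
Proof.
by case: hNS => /(_ z) + _; rewrite sum2.
Qed.

Section Identity.
Variables (e L : R) (a : nat -> R -> R).
Hypotheses (e0 : 0 < e) (ha : is_mollifier e a) (L0 : 0 < L).

Lemma Rintegral_square (g : R * R -> R) : (forall z, ~ square L z -> g z = 0) ->
  \int[lebesgue2 R]_z g z = sqint L g.
Proof.
move=> g0; rewrite /sqint [RHS]Rintegral_mkcond; congr (Rintegral _ _ _).
apply/funext => z; rewrite /patch; case: ifPn => // /negP zL.
by rewrite g0// => zL'; apply: zL; rewrite inE.
Qed.

Lemma weak_identity x : square (L - e) x ->
  sqint L (fun z => vel12 z * (-1 * kern a 0 2 x z) + vel22 z * kern a 1 1 x z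
     + (vel11 z * (-1 * kern a 1 1 x z) + vel21 z * kern a 2 0 x z)) =
  sqint L (fun z =>
     vel1 z * vel1 z * (-1 * kern a 1 1 x z) + vel1 z * vel2 z * kern a 2 0 x z +
     (vel2 z * vel1 z * (-1 * kern a 0 2 x z) + vel2 z * vel2 z * kern a 1 1 x z)).
Proof.
(* Differentiating [kern] in its second argument changes the sign, so with [K = kern a 0 0 x] this
   field is [(- d2 K, d1 K)], whose divergence vanishes. *)
move=> xL; pose f := test_field a 1 (-1) 0 1 1 0 x.
have D1 c m n : d1 (fun y => c * kern a m n x y) (fun y => (- c) * kern a m.+1 n x y).
  by apply: d1_ext (d1Z c (d1_kern ha m n x)) => z; ring.
have D2 c m n : d2 (fun y => c * kern a m n x y) (fun y => (- c) * kern a m n.+1 x y).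
  by apply: d2_ext (d2Z c (d2_kern ha m n x)) => z; ring.
have F00 : Dcomp ord0 ord0 f = (fun y => (-1) * kern a 1 1 x y).
  exact: pd1E (D1 1 0%N 1%N).
have F10 : Dcomp i1 ord0 f = (fun y => (-1) * kern a 0 2 x y).
  exact: pd2E (D2 1 0%N 1%N).
have F01 : Dcomp ord0 i1 f = (fun y => kern a 2 0 x y).
  rewrite (_ : (fun y => kern a 2 0 x y) = (fun y => (- -1) * kern a 2 0 x y)).
    exact: pd1E (D1 (-1) 1%N 0%N).
  by apply/funext => y; rewrite opprK mul1r.
have F11 : Dcomp i1 i1 f = (fun y => kern a 1 1 x y).
  rewrite (_ : (fun y => kern a 1 1 x y) = (fun y => (- -1) * kern a 1 1 x y)).
    exact: pd2E (D2 (-1) 1%N 0%N).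
  by apply/funext => y; rewrite opprK mul1r.
have df : div_free f.
  by move=> z; rewrite sum2 F00 F11 mulN1r addNr.
have cf : Cinfty f by exact: (@Cinfty_test _ e a ha 1 (-1) 0 1 1 0 x).
have sf : compact_support f by exact: (@compact_support_test _ e a e0 ha 1 (-1) 0 1 1 0 L x xL).
have := hNS.2 f cf sf df.
have E1 : (fun z => \sum_(i < 2) \sum_(k < 2) Dcomp k i u z * Dcomp k i f z) =
   (fun z => vel11 z * (-1 * kern a 1 1 x z) + vel12 z * (-1 * kern a 0 2 x z) +
     (vel21 z * kern a 2 0 x z + vel22 z * kern a 1 1 x z)).
  by apply/funext => z; rewrite !sum2 F00 F10 F01 F11.
have E2 : (fun z : R * R => \sum_(k < 2) \sum_(i < 2) Defs.coord k (u z) * Defs.coord i (u z) * Dcomp k i f z) =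
   (fun z => vel1 z * vel1 z * (-1 * kern a 1 1 x z) + vel1 z * vel2 z * kern a 2 0 x z +
     (vel2 z * vel1 z * (-1 * kern a 0 2 x z) + vel2 z * vel2 z * kern a 1 1 x z)).
  by apply/funext => z; rewrite !sum2 F00 F10 F01 F11.
rewrite E1 E2 Rintegral_square; last first.
  by move=> z zL; rewrite !(kern_out e0 ha _ _ xL zL) !(mulr0, addr0).
rewrite Rintegral_square; last first.
  by move=> z zL; rewrite !(kern_out e0 ha _ _ xL zL) !(mulr0, addr0).
move/eqP; rewrite subr_eq0 => /eqP <-.
by apply: eq_sqint => z _; rewrite addrC addrACA.
Qed.

End Identity.

End NavierStokesMollified.

(* The continuous scalar fields of a solution: [vij] is the derivative of the
   [i]-th velocity component in direction [j], and the last clause is the weak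
   equation tested with the rotated gradient of a translated mollifier. *)
Definition solution_fields {R : realType} (v1 v2 v11 v12 v21 v22 : R * R -> R) :=
  [/\ [/\ continuous v1, continuous v2, continuous v11 & continuous v12],
      continuous v21 /\ continuous v22,
      [/\ d1 v1 v11, d2 v1 v12, d1 v2 v21 & d2 v2 v22],
      forall z, v11 z + v22 z = 0 &
      forall (e L : R) a x, 0 < e -> is_mollifier e a -> square (L - e) x ->
        sqint L (fun z => v12 z * (-1 * kern a 0 2 x z) + v22 z * kern a 1 1 x z
          + (v11 z * (-1 * kern a 1 1 x z) + v21 z * kern a 2 0 x z)) =
        sqint L (fun z =>
          v1 z * v1 z * (-1 * kern a 1 1 x z) + v1 z * v2 z * kern a 2 0 x z +
          (v2 z * v1 z * (-1 * kern a 0 2 x z) + v2 z * v2 z * kern a 1 1 x z))].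

Lemma solution_fieldsP {R : realType} (u : R * R -> R * R) : Cn 1 u -> NS_weak_solution u ->
  solution_fields (vel1 u) (vel2 u) (vel11 u) (vel12 u) (vel21 u) (vel22 u).
Proof.
move=> hC1 hNS; have [cv1 cv2] := cont_vel hC1.
have [c11 c12 c21 c22] := cont_Dvel hC1.
split; [by []|by []|exact: d_vel|exact: vel_div|].
by move=> e L a x e0 ha xL; exact: (weak_identity hNS e0 ha xL).
Qed.

Section MollifiedSolution.
Context {R : realType}.
Variables vel1 vel2 vel11 vel12 vel21 vel22 : R * R -> R.
Hypothesis fields : solution_fields vel1 vel2 vel11 vel12 vel21 vel22.

Let cv1 : continuous vel1. Proof. by case: fields => -[]. Qed.
Let cv2 : continuous vel2. Proof. by case: fields => -[]. Qed.
Let c11 : continuous vel11. Proof. by case: fields => -[]. Qed.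
Let c12 : continuous vel12. Proof. by case: fields => -[]. Qed.
Let c21 : continuous vel21. Proof. by case: fields => _ []. Qed.
Let c22 : continuous vel22. Proof. by case: fields => _ []. Qed.
Let dv11 : d1 vel1 vel11. Proof. by case: fields => _ _ []. Qed.
Let dv12 : d2 vel1 vel12. Proof. by case: fields => _ _ []. Qed.
Let dv21 : d1 vel2 vel21. Proof. by case: fields => _ _ []. Qed.
Let dv22 : d2 vel2 vel22. Proof. by case: fields => _ _ []. Qed.
Let vel_div z : vel11 z + vel22 z = 0. Proof. by case: fields => _ _ _ + _; apply. Qed.

Definition vort (z : R * R) : R := vel21 z - vel12 z.

(** For a divergence-free field, vorticity times velocity is the divergence of a quadratic
    expression: its components are [d1(v1 v2) + d2 q] and [d1 q - d2(v1 v2)] with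
    [q = (v2^2 - v1^2) / 2]. This links the products in the weak equation to [w v], although the
    vorticity is only continuous. *)
Lemma vort_vel1 z : vort z * vel1 z = (vel11 z * vel2 z + vel1 z * vel21 z) +
  1 / 2 * ((vel22 z * vel2 z + vel2 z * vel22 z) - (vel12 z * vel1 z + vel1 z * vel12 z)).
Proof.
rewrite /vort; have := vel_div z.
move: (vel11 z) (vel12 z) (vel21 z) (vel22 z) (vel1 z) (vel2 z) => a b c d v w.
by rewrite addrC => /eqP; rewrite addr_eq0 => /eqP ->; field.
Qed.

Lemma vort_vel2 z : vort z * vel2 z =
  1 / 2 * ((vel21 z * vel2 z + vel2 z * vel21 z) - (vel11 z * vel1 z + vel1 z * vel11 z))
  + -1 * (vel12 z * vel2 z + vel1 z * vel22 z).
Proof.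
rewrite /vort; have := vel_div z.
move: (vel11 z) (vel12 z) (vel21 z) (vel22 z) (vel1 z) (vel2 z) => a b c d v w.
by rewrite addrC => /eqP; rewrite addr_eq0 => /eqP ->; field.
Qed.

Variables (e L : R) (a : nat -> R -> R).
Hypotheses (e0 : 0 < e) (ha : is_mollifier e a) (L0 : 0 < L).

Local Notation "[* f ; i , j ]" := (mollify a L f i j).

(** Tested with a rotated gradient, the quadratic term of the equation involves only [vel1 * vel2]
    and the difference of the squares, here [uu] and [q]. These are exactly the quantities whose
    derivatives make up [vort * vel1] and [vort * vel2]. *)
Lemma mollified_vorticity x : square (L - e) x ->
  ([* vel2 ; 3, 0] x - [* vel1 ; 2, 1] x) + ([* vel2 ; 1, 2] x - [* vel1 ; 0, 3] x) =
  [* (fun z => vort z * vel1 z) ; 1, 0] x + [* (fun z => vort z * vel2 z) ; 0, 1] x.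
Proof.
move=> xL; have L0' := ltW L0; have W := let: And5 _ _ _ _ W := fields in W e L a x e0 ha xL.
have ck i j : continuous (kern a i j x) by exact: cont_kern ha _ _ _.
have P1 g g1 i j := @mollify_parts1 _ _ _ e0 ha L g g1 i j x L0.
have P2 g g2 i j := @mollify_parts2 _ _ _ e0 ha L g g2 i j x L0.
have c1 := ck 0%N 2; have c2 := ck 1%N 1%N; have c3 := ck 2 0%N.
have e1 : [* vel1 ; 2, 1] x = [* vel11 ; 1, 1] x by symmetry; exact: P1.
have e2 : [* vel1 ; 0, 3] x = [* vel12 ; 0, 2] x by symmetry; exact: P2.
have e3 : [* vel2 ; 3, 0] x = [* vel21 ; 2, 0] x by symmetry; exact: P1.
have e4 : [* vel2 ; 1, 2] x = [* vel22 ; 1, 1] x by symmetry; exact: P2.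
pose uu z := vel1 z * vel2 z.
pose q z := 1 / 2 * (vel2 z * vel2 z - vel1 z * vel1 z).
pose uu1 z := vel11 z * vel2 z + vel1 z * vel21 z.
pose uu2 z := vel12 z * vel2 z + vel1 z * vel22 z.
pose q1 z := 1 / 2 * ((vel21 z * vel2 z + vel2 z * vel21 z) - (vel11 z * vel1 z + vel1 z * vel11 z)).
pose q2 z := 1 / 2 * ((vel22 z * vel2 z + vel2 z * vel22 z) - (vel12 z * vel1 z + vel1 z * vel12 z)).
have cuu : continuous uu by rewrite /uu; cont.
have cq : continuous q by rewrite /q; cont.
have cuu1 : continuous uu1 by rewrite /uu1; cont.
have cuu2 : continuous uu2 by rewrite /uu2; cont.
have cq1 : continuous q1 by rewrite /q1; cont.
have cq2 : continuous q2 by rewrite /q2; cont.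
have duu1 : d1 uu uu1 by exact: (d1M dv11 dv21).
have duu2 : d2 uu uu2 by exact: (d2M dv12 dv22).
have dq1 : d1 q q1 by exact: (d1Z (1 / 2) (d1B (d1M dv21 dv21) (d1M dv11 dv11))).
have dq2 : d2 q q2 by exact: (d2Z (1 / 2) (d2B (d2M dv22 dv22) (d2M dv12 dv12))).
have h1 : [* uu1 ; 1, 0] x = [* uu ; 2, 0] x by exact: P1.
have h2 : [* uu2 ; 0, 1] x = [* uu ; 0, 2] x by exact: P2.
have h3 : [* q1 ; 0, 1] x = [* q ; 1, 1] x by exact: P1.
have h4 : [* q2 ; 1, 0] x = [* q ; 1, 1] x by exact: P2.
have g1 : [* (fun z => vort z * vel1 z) ; 1, 0] x = [* uu ; 2, 0] x + [* q ; 1, 1] x.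
  rewrite -h1 -h4 -(@mollifyD _ _ _ ha L uu1 q2 1 0 x L0' cuu1 cq2).
  by congr (mollify _ _ _ _ _ _); apply/funext => z; exact: vort_vel1.
have g2 : [* (fun z => vort z * vel2 z) ; 0, 1] x = [* q ; 1, 1] x - [* uu ; 0, 2] x.
  rewrite -h2 -h3 -mulN1r -(@mollifyZ _ _ _ ha L (-1) uu2 0 1 x L0' cuu2).
  have cN : continuous (fun z => -1 * uu2 z) by cont.
  rewrite -(@mollifyD _ _ _ ha L q1 _ 0 1 x L0' cq1 cN).
  by congr (mollify _ _ _ _ _ _); apply/funext => z; exact: vort_vel2.
rewrite e1 e2 e3 e4 g1 g2.
have W1 : sqint L (fun z => vel12 z * (-1 * kern a 0 2 x z) + vel22 z * kern a 1 1 x z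
     + (vel11 z * (-1 * kern a 1 1 x z) + vel21 z * kern a 2 0 x z)) =
   - [* vel12 ; 0, 2] x + [* vel22 ; 1, 1] x - [* vel11 ; 1, 1] x + [* vel21 ; 2, 0] x.
  rewrite /mollify -[- sqint L (fun w => vel12 w * _)]mulN1r -[- sqint L (fun w => vel11 w * _)]mulN1r.
  rewrite -[in RHS]sqintZ; [|by []|by cont].
  rewrite -[in RHS]sqintZ; [|by []|by cont].
  rewrite -[in RHS]sqintD; [|by []|by cont|by cont].
  rewrite -[in RHS]sqintD; [|by []|by cont|by cont].
  rewrite -[in RHS]sqintD; [|by []|by cont|by cont].
  by apply: eq_sqint => z _; ring.
have W2 : sqint L (fun z =>
     vel1 z * vel1 z * (-1 * kern a 1 1 x z) + vel1 z * vel2 z * kern a 2 0 x z +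
     (vel2 z * vel1 z * (-1 * kern a 0 2 x z) + vel2 z * vel2 z * kern a 1 1 x z)) =
   [* uu ; 2, 0] x - [* uu ; 0, 2] x + 2 * [* q ; 1, 1] x.
  rewrite /mollify -[- sqint L (fun w => uu w * _)]mulN1r.
  rewrite -[in RHS]sqintZ; [|by []|by cont].
  rewrite -[in RHS]sqintZ; [|by []|by cont].
  rewrite -[in RHS]sqintD; [|by []|by cont|by cont].
  rewrite -[in RHS]sqintD; [|by []|by cont|by cont].
  by apply: eq_sqint => z _; rewrite /uu /q; field.
rewrite W1 W2 in W.
by move: W; move: (mollify _ _ _ _ _ _) => A; lra.
Qed.

Lemma mollified_div i j x : square (L - e) x ->
  [* vel1 ; i.+1, j] x + [* vel2 ; i, j.+1] x = 0.
Proof.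
move=> xL; have L0' := ltW L0.
rewrite -(@mollify_parts1 _ _ _ e0 ha L vel1 vel11 i j x)//.
rewrite -(@mollify_parts2 _ _ _ e0 ha L vel2 vel22 i j x)//.
rewrite -(mollifyD ha)// /mollify (@eq_sqint _ _ _ (fun=> 0)) ?sqint_cst ?mul0r//.
by move=> z _; rewrite vel_div mul0r.
Qed.

Lemma mollified_vort i j x : square (L - e) x ->
  [* vel2 ; i.+1, j] x - [* vel1 ; i, j.+1] x = [* vort ; i, j] x.
Proof.
move=> xL; have L0' := ltW L0.
rewrite -(@mollify_parts1 _ _ _ e0 ha L vel2 vel21 i j x)//.
rewrite -(@mollify_parts2 _ _ _ e0 ha L vel1 vel12 i j x)//.
rewrite -mulN1r -(mollifyZ ha)// -(mollifyD ha)//; last by cont.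
by congr (sqint _ _); apply/funext => z; rewrite /vort; ring.
Qed.

End MollifiedSolution.

(** * The energy system of a mollified solution *)

Section Assembly.
Context {R : realType}.
Implicit Types (C D W V X Y T A E N L s r t : R).

(** One constant for all inequalities of the system. The fourth power arises where the squared
    weight derivative is squared again, in the bound for [T]; 2000 exceeds [12 * 6 ^ 2 * 4 = 1728],
    the largest numerical requirement, which comes from the bound for [D]. *)
Definition system_const (n : nat) : R := 2000 * (n.+1)%:R ^+ 4.

Lemma system_const_ge1 n : 1 <= system_const n.
Proof.
rewrite /system_const; have : 1 <= (n.+1)%:R ^+ 4 :> R by rewrite exprn_ege1// ler1n.
by lra.
Qed.

Lemma system_const_ge n (x : R) : 0 <= x -> x <= 2000 -> x <= system_const n.
Proof.
move=> x0 x2; have : 1 <= (n.+1)%:R ^+ 4 :> R by rewrite exprn_ege1// ler1n.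
by rewrite /system_const; move: (n.+1%:R ^+ 4) x2; clear => N; lra.
Qed.

Lemma affine_le_scale (b c n : nat) : (c <= b)%N -> (b * n + c <= b * n.+1)%N.
Proof. by move=> cb; rewrite mulnS [leqRHS]addnC leq_add2l. Qed.

Lemma natr_le_scale (m b n : nat) : (m <= b * n.+1)%N -> m%:R <= b%:R * (n.+1)%:R :> R.
Proof. by rewrite -natrM ler_nat. Qed.

Lemma scaled_const_sqr (m b n : nat) (c : R) L : 0 < L -> (m <= b * n.+1)%N -> 0 <= c ->
  c * b%:R ^+ 2 * 4 <= 2000 -> c * (m%:R * (2 / L)) ^+ 2 <= system_const n / L ^+ 2.
Proof.
move=> L0 /natr_le_scale mb c0 cb.
have N1 : 1 <= (n.+1)%:R :> R by rewrite ler1n.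
rewrite (_ : c * (m%:R * (2 / L)) ^+ 2 = c * 4 * m%:R ^+ 2 / L ^+ 2); last first.
  by field; rewrite gt_eqF.
apply: ler_wpM2r; first by nonneg.
have m2 : m%:R ^+ 2 <= (b%:R * (n.+1)%:R) ^+ 2 :> R.
  by apply: lerXn2r; rewrite ?nnegrE// mulr_ge0.
have N24 : (n.+1)%:R ^+ 2 <= (n.+1)%:R ^+ 4 :> R by exact: ler_weXn2l.
have c4 : 0 <= c * 4 by nonneg.
apply: le_trans (ler_wpM2l c4 m2) _.
rewrite /system_const; apply: le_trans (_ : (c * b%:R ^+ 2 * 4) * (n.+1)%:R ^+ 4 <= _).
  rewrite exprMn (_ : c * 4 * _ = (c * b%:R ^+ 2 * 4) * (n.+1)%:R ^+ 2); last by ring.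
  by apply: ler_wpM2l => //; nonneg.
by apply: ler_wpM2r => //; nonneg.
Qed.

(** The indices of [D1] and [D2] are crossed: the Laplacian of the first velocity component is, up
    to sign, the second derivative of the vorticity, and vice versa. *)
Lemma assemble_W C L s D1 D2 W1 W2 V1 V2 k : 1 <= C -> 0 < s -> 0 <= D1 -> 0 <= D2 ->
  0 <= V1 -> 0 <= V2 -> k <= C / L ^+ 2 ->
  W1 <= s * D2 + (1 / s + k) * V1 -> W2 <= s * D1 + (1 / s + k) * V2 ->
  W1 + W2 <= C * (s * (D1 + D2) + (V1 + V2) / s + (V1 + V2) / L ^+ 2).
Proof.
move=> C1 s0 D10 D20 V10 V20 kC h1 h2.
have V0 : 0 <= V1 + V2 by nonneg.
have t1 : s * (D1 + D2) <= C * (s * (D1 + D2)) by rewrite ler_peMl//; nonneg.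
have t2 : (V1 + V2) / s <= C * ((V1 + V2) / s) by rewrite ler_peMl//; nonneg.
have t3 := ler_wpM2r V0 kC.
move: t1 t2 t3 h1 h2; move: (s^-1) ((L ^+ 2)^-1) => si Li; clear; lra.
Qed.

Lemma assemble_V C L delta t V1 V2 T1 T2 A1 A2 A : 128 <= C -> 0 < t -> 0 <= T1 ->
  0 <= T2 -> 0 <= A1 -> 0 <= A2 -> A1 + A2 <= A ->
  V1 <= 64 * (L ^+ 2 * delta ^+ 2 + (t * T1 + A1 / t)) ->
  V2 <= 64 * (L ^+ 2 * delta ^+ 2 + (t * T2 + A2 / t)) ->
  V1 + V2 <= C * (L ^+ 2 * delta ^+ 2 + (t * (T1 + T2) + A / t)).
Proof.
move=> C1 t0 T10 T20 A10 A20 AA h1 h2.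
have ti : 0 <= t^-1 by nonneg.
have q : 0 <= L ^+ 2 * delta ^+ 2 + (t * (T1 + T2) + A / t).
  by have : 0 <= A by [lra]; move=> ?; nonneg.
apply: le_trans (ler_wpM2r q C1).
have := ler_wpM2r ti AA.
have : 0 <= t * T1 by nonneg.
have : 0 <= t * T2 by nonneg.
have : 0 <= A1 * t^-1 by nonneg.
have : 0 <= A2 * t^-1 by nonneg.
move: h1 h2; move: (t^-1) => ti'; clear; lra.
Qed.

Lemma assemble_T C L r T1 T2 A1 A2 A W1 W2 V1 V2 k : 1 <= k -> 2 * k ^+ 2 <= C ->
  0 < L -> 0 < r ->
  0 <= A1 -> 0 <= A2 -> A1 + A2 <= A -> 0 <= W1 -> 0 <= W2 -> 0 <= V1 -> 0 <= V2 ->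
  T1 <= (r * A1 + (W1 + k / L ^+ 2 * V1) / r) ^+ 2 ->
  T2 <= (r * A2 + (W2 + k / L ^+ 2 * V2) / r) ^+ 2 ->
  T1 + T2 <= C * (r * A + (W1 + W2 + (V1 + V2) / L ^+ 2) / r) ^+ 2.
Proof.
move=> k1 kC L0 r0 A10 A20 AA W10 W20 V10 V20 h1 h2.
set B := r * A + _.
have Li : 0 <= (L ^+ 2)^-1 by nonneg.
have ri : 0 <= r^-1 by nonneg.
have A0 : 0 <= A by lra.
have k0 : 0 <= k by lra.
have bnd A' W' V' : 0 <= A' -> A' <= A -> 0 <= W' -> W' <= W1 + W2 -> 0 <= V' -> V' <= V1 + V2 ->
    (r * A' + (W' + k / L ^+ 2 * V') / r) ^+ 2 <= k ^+ 2 * B ^+ 2.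
  move=> A'0 A'A W'0 W'W V'0 V'V; rewrite -exprMn.
  have B0 : 0 <= B by rewrite /B; nonneg.
  apply: lerXn2r; rewrite ?nnegrE; [by nonneg|by nonneg|].
  rewrite /B mulrDr; apply: lerD.
    apply: le_trans (_ : r * A <= _); first by apply: ler_wpM2l => //; exact: ltW.
    by rewrite ler_peMl//; nonneg.
  rewrite mulrA; apply: ler_wpM2r => //.
  rewrite mulrDr; apply: lerD.
    by apply: le_trans W'W _; rewrite ler_peMl//; nonneg.
  by rewrite mulrAC mulrA; apply: ler_wpM2r => //; apply: ler_wpM2l.
apply: le_trans (ler_wpM2r (sqr_ge0 B) kC).
have b1 := bnd A1 W1 V1 ltac:(by []) ltac:(lra) ltac:(by []) ltac:(lra) ltac:(by []) ltac:(lra).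
have b2 := bnd A2 W2 V2 ltac:(by []) ltac:(lra) ltac:(by []) ltac:(lra) ltac:(by []) ltac:(lra).
move: (le_trans h1 b1) (le_trans h2 b2); move: (B ^+ 2) (k ^+ 2); clear => ? ? *; lra.
Qed.

Lemma assemble_D C L D W W0 X E k1 k2 : 0 < L -> 3 <= C -> 0 <= W0 -> W0 <= 2 * W ->
  0 <= X -> 0 <= E -> 0 <= W -> 2 * k1 <= C / L ^+ 2 -> 0 <= k1 -> k2 <= C / L ->
  D <= k1 * W0 + 3 * E + k2 * X -> D <= C * (W / L ^+ 2 + X / L + E).
Proof.
move=> L0 C3 W00 WW X0 E0 W'0 h1 k10 h2 h.
have q1 := ler_wpM2l k10 WW.
have q2 := ler_wpM2r W'0 h1; have q3 := ler_wpM2r X0 h2; have q4 := ler_wpM2r E0 C3.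
move: h q1 q2 q3 q4; move: ((L ^+ 2)^-1) (L^-1); clear => ? ? *; lra.
Qed.

Lemma assemble_X C delta s t X1 X2 W W0 T1 T2 A1 A2 A Y : 64 <= C -> 0 <= delta ->
  0 < s -> 0 < t -> 0 <= W -> W0 <= 2 * W -> 0 <= T1 -> 0 <= T2 -> A1 + A2 <= A ->
  0 <= A1 -> 0 <= A2 -> 0 <= Y ->
  X1 <= 4 * delta * W0 + 64 * s * (t * T1 + A1 / t) + Y / s ->
  X2 <= 4 * delta * W0 + 64 * s * (t * T2 + A2 / t) + Y / s ->
  X1 + X2 <= C * (delta * W + s * (t * (T1 + T2) + A / t) + Y / s).
Proof.
move=> C64 de0 s0 t0 W'0 WW T10 T20 AA A10 A20 Y0 h1 h2.
have A0 : 0 <= A by lra.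
have q : 0 <= delta * W + s * (t * (T1 + T2) + A / t) + Y / s by nonneg.
apply: le_trans (ler_wpM2r q C64).
have d4 : 0 <= 8 * delta by nonneg.
have st : 0 <= 64 * s / t by nonneg.
have q1 := ler_wpM2l d4 WW; have q2 := ler_wpM2l st AA.
have q3 : 0 <= delta * W by nonneg.
have q4 : 0 <= Y / s by nonneg.
move: h1 h2 q1 q2 q3 q4; move: (s^-1) (t^-1); clear => ? ? *; lra.
Qed.

Lemma assemble_Y C L r D W W0 Y k : 4 <= C -> 2 * k <= C / L -> 0 < L -> 0 < r -> 0 <= D -> 0 <= W ->
  0 <= W0 -> W0 <= 2 * W -> 0 <= k ->
  Y <= (r * D + (1 / r + k) * W0) ^+ 2 ->
  Y <= C ^+ 2 * (r * D + W / r + W / L) ^+ 2.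
Proof.
move=> C4 kC L0 r0 D0 W'0 W00 WW k0 h; apply: le_trans h _; rewrite -exprMn.
have ri : 0 <= r^-1 by nonneg.
have C0 : 0 <= C by lra.
apply: lerXn2r; rewrite ?nnegrE; [by nonneg|by nonneg|].
have rk : 0 <= 1 / r + k by nonneg.
have q1 := ler_wpM2l rk WW; have q2 := ler_wpM2r W'0 kC.
have q3 : 0 <= r * D by nonneg.
have q4 : 0 <= W / r by nonneg.
have q5 := ler_wpM2r q3 C4; have q6 := ler_wpM2r q4 C4.
move: q1 q2 q3 q4 q5 q6; move: (r^-1) (L^-1); clear => ? ? *; lra.
Qed.

End Assembly.

(** * The energy system for a smooth flow with perturbed convection term *)

Section SmoothFlow.
Context {R : realType}.

Definition C2_fields (f fx fy fxx fyy : R * R -> R) :=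
  [/\ continuous f, continuous fx /\ continuous fy, continuous fxx /\ continuous fyy,
      d1 f fx /\ d2 f fy & d1 fx fxx /\ d2 fy fyy].

Variables (v1 v1x v1y v1xx v1yy v2 v2x v2y v2xx v2yy w w1 w2 w11 w22 : R * R -> R).
Variables (p1 p2 p11 p22 : R * R -> R).
Hypotheses (hv1 : C2_fields v1 v1x v1y v1xx v1yy) (hv2 : C2_fields v2 v2x v2y v2xx v2yy).
Hypothesis hw : C2_fields w w1 w2 w11 w22.
Hypotheses (cp : continuous p1 /\ continuous p2) (cdp : continuous p11 /\ continuous p22).
Hypothesis hp : d1 p1 p11 /\ d2 p2 p22.
Variables (L delta A : R) (n : nat) (g G : R -> R).
Hypotheses (L1 : 1 <= L) (delta0 : 0 <= delta).
Hypotheses (cg : continuous g) (cG : continuous G).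
Hypothesis dG : forall x : R, is_derive x 1 G (g x).
Hypotheses (g0 : forall x, 0 <= g x) (hG : forall x, `|G x| <= `|x| * g x).
Hypothesis tr : truncates n delta g G.
Hypothesis hdiv : forall z, square L z -> v1x z + v2y z = 0.
Hypothesis hlap1 : forall z, square L z -> v1xx z + v1yy z = - w2 z.
Hypothesis hlap2 : forall z, square L z -> v2xx z + v2yy z = w1 z.
Hypothesis hcurl : forall z, square L z -> w z = v2x z - v1y z.
Hypothesis hvort : forall z, square L z -> w11 z + w22 z = p11 z + p22 z.

Definition massA (f : R * R -> R) := sqint L (fun z => g (f z) ^+ 2).
Hypothesis hA : massA v1 + massA v2 <= A.

Definition energyD := wint L n 6 4 (fun z => w1 z ^+ 2 + w2 z ^+ 2).
Definition gradW (fx fy : R * R -> R) := wint L n 4 2 (fun z => fx z ^+ 2 + fy z ^+ 2).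
Definition massV (f : R * R -> R) := wint L n 2 0 (fun z => f z ^+ 2).
Definition truncT (f : R * R -> R) := wint L n 4 4 (fun z => G (f z) ^+ 2).
Definition convX (f : R * R -> R) := wint L n 6 3 (fun z => `|f z| * w z ^+ 2).
Definition energyY := wint L n 10 6 (fun z => w z ^+ 4).
Definition energyE := sqint L (fun z => (p1 z - v1 z * w z) ^+ 2 + (p2 z - v2 z * w z) ^+ 2).
Definition vortW := wint L n 4 2 (fun z => w z ^+ 2).

Let L0 : 0 < L. Proof. exact: lt_le_trans L1. Qed.
Let L0' : 0 <= L. Proof. exact: ltW. Qed.
Let c1 : continuous v1. Proof. by case: hv1. Qed.
Let c1x : continuous v1x. Proof. by case: hv1 => _ []. Qed.
Let c1y : continuous v1y. Proof. by case: hv1 => _ []. Qed.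
Let c1xx : continuous v1xx. Proof. by case: hv1 => _ _ []. Qed.
Let c1yy : continuous v1yy. Proof. by case: hv1 => _ _ []. Qed.
Let c2 : continuous v2. Proof. by case: hv2. Qed.
Let c2x : continuous v2x. Proof. by case: hv2 => _ []. Qed.
Let c2y : continuous v2y. Proof. by case: hv2 => _ []. Qed.
Let c2xx : continuous v2xx. Proof. by case: hv2 => _ _ []. Qed.
Let c2yy : continuous v2yy. Proof. by case: hv2 => _ _ []. Qed.
Let cv : continuous w. Proof. by case: hw. Qed.
Let cv1 : continuous w1. Proof. by case: hw => _ []. Qed.
Let cv2 : continuous w2. Proof. by case: hw => _ []. Qed.
Let cv11 : continuous w11. Proof. by case: hw => _ _ []. Qed.
Let cv22 : continuous w22. Proof. by case: hw => _ _ []. Qed.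

Let wge0 k j f : (forall z, 0 <= f z) -> 0 <= wint L n k j f.
Proof. exact: wint_ge0. Qed.
Let gradW_ge0 fx fy : 0 <= gradW fx fy.
Proof. by apply: wge0 => z; rewrite addr_ge0 ?sqr_ge0. Qed.
Let massV_ge0 f : 0 <= massV f. Proof. by apply: wge0 => z; exact: sqr_ge0. Qed.
Let truncT_ge0 f : 0 <= truncT f. Proof. by apply: wge0 => z; exact: sqr_ge0. Qed.
Let convX_ge0 f : 0 <= convX f. Proof. by apply: wge0 => z; rewrite mulr_ge0 ?sqr_ge0. Qed.
Let massA_ge0 f : 0 <= massA f. Proof. by apply: sqint_ge0 => z _; exact: sqr_ge0. Qed.
Let energyD_ge0 : 0 <= energyD. Proof. by apply: wge0 => z; rewrite addr_ge0 ?sqr_ge0. Qed.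
Let vortW_ge0 : 0 <= vortW. Proof. by apply: wge0 => z; exact: sqr_ge0. Qed.
Let energyY_ge0 : 0 <= energyY. Proof. by apply: wge0 => z; rewrite exprn_even_ge0. Qed.
Let energyE_ge0 : 0 <= energyE.
Proof. by apply: sqint_ge0 => z _; rewrite addr_ge0 ?sqr_ge0. Qed.

Local Notation C := (@system_const R n).
Let C1 : 1 <= C. Proof. exact: system_const_ge1. Qed.
Let N1 : 1 <= n.+1%:R :> R. Proof. by rewrite ler1n. Qed.

Let wint_add k j f h : continuous f -> continuous h ->
  wint L n k j (fun z => f z + h z) = wint L n k j f + wint L n k j h.
Proof.
move=> cf ch; have cw := @cont_weight R L; rewrite /wint -sqintD //; try by cont.
by apply: eq_sqint => z _; rewrite mulrDr.
Qed.

Lemma vortW_le : vortW <= 2 * (gradW v1x v1y + gradW v2x v2y).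
Proof.
have cw := @cont_weight R L.
rewrite /vortW /gradW /wint -sqintD //; try by cont.
rewrite -sqintZ; [|by []|by cont].
apply: le_sqint; [by []|by cont|by cont|].
move=> z zL; have /andP[t0 _] := weight_power_bounds (4 * n + 2) L0 zL.
rewrite hcurl// -[X in _ <= 2 * X]mulrDr [leRHS]mulrCA; apply: ler_wpM2l => //.
have := sqr_ge0 (v2x z + v1y z); have := sqr_ge0 (v1x z); have := sqr_ge0 (v2y z).
move: (v1x z) (v1y z) (v2x z) (v2y z); move=> a b c d; nra.
Qed.

Lemma systemH1 s : 0 < s -> gradW v1x v1y + gradW v2x v2y <=
  C * (s * energyD + (massV v1 + massV v2) / s + (massV v1 + massV v2) / L ^+ 2).
Proof.
move=> s0; have [_ _ _ [d1a d1b] [d1c d1d]] := hv1; have [_ _ _ [d2a d2b] [d2c d2d]] := hv2.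
have cw1s : continuous (fun z => w1 z ^+ 2) by cont.
have cw2s : continuous (fun z => w2 z ^+ 2) by cont.
rewrite /energyD wint_add//.
apply: (@assemble_W _ C L s _ _ _ _ _ _ (2 * ((4 * n + 2)%:R * (2 / L)) ^+ 2)) => //.
- by apply: wge0 => z; exact: sqr_ge0.
- by apply: wge0 => z; exact: sqr_ge0.
- by apply: (@scaled_const_sqr _ _ 4) => //; [exact: affine_le_scale|lra].
- have := gradient_energy n L0 s0 c1 c1x c1y c1xx c1yy d1a d1b d1c d1d.
  rewrite (_ : wint L n 6 4 (fun z => (v1xx z + v1yy z) ^+ 2) = wint L n 6 4 (fun z => w2 z ^+ 2))//.
  by apply: eq_sqint => z zL; rewrite hlap1// sqrrN.
- have := gradient_energy n L0 s0 c2 c2x c2y c2xx c2yy d2a d2b d2c d2d.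
  rewrite (_ : wint L n 6 4 (fun z => (v2xx z + v2yy z) ^+ 2) = wint L n 6 4 (fun z => w1 z ^+ 2))//.
  by apply: eq_sqint => z zL; rewrite hlap2.
Qed.

Lemma systemH2 t : 0 < t <= 1 -> massV v1 + massV v2 <=
  C * (L ^+ 2 * delta ^+ 2 + (t * (truncT v1 + truncT v2) + A / t)).
Proof.
move=> t01; have /andP[t0 _] := t01.
apply: assemble_V hA _ _ => //; first by apply: system_const_ge; lra.
  exact: velocity_energy.
exact: velocity_energy.
Qed.

Lemma systemH3 r : 0 < r -> truncT v1 + truncT v2 <=
  C * (r * A + (gradW v1x v1y + gradW v2x v2y + (massV v1 + massV v2) / L ^+ 2) / r) ^+ 2.
Proof.
move=> r0; have [_ _ _ [d1a d1b] [d1c d1d]] := hv1; have [_ _ _ [d2a d2b] [d2c d2d]] := hv2.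
have E : ((2 * n + 2)%:R * (2 / L)) ^+ 2 = (16 * n.+1%:R ^+ 2) / L ^+ 2.
  rewrite (_ : (2 * n + 2)%N = (2 * n.+1)%N); last by rewrite mulnS addnC.
  by rewrite natrM; field; rewrite gt_eqF.
have h1 := trunc_energy n L0 r0 c1 c1x c1y d1a d1b cg cG dG g0 hG.
have h2 := trunc_energy n L0 r0 c2 c2x c2y d2a d2b cg cG dG g0 hG.
rewrite E in h1; rewrite E in h2.
apply: (assemble_T _ _ L0 r0 (massA_ge0 v1) (massA_ge0 v2) hA (gradW_ge0 v1x v1y)
  (gradW_ge0 v2x v2y) (massV_ge0 v1) (massV_ge0 v2) h1 h2).
  have : 1 <= n.+1%:R ^+ 2 :> R by rewrite exprn_ege1.
  by lra.
rewrite /system_const (_ : (16 * n.+1%:R ^+ 2) ^+ 2 = 256 * n.+1%:R ^+ 4); last by ring.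
have : 0 <= n.+1%:R ^+ 4 :> R by exact: exprn_ge0.
by lra.
Qed.

Lemma systemH4 : energyD <= C * ((gradW v1x v1y + gradW v2x v2y) / L ^+ 2 +
  (convX v1 + convX v2) / L + energyE).
Proof.
have [_ _ _ [d1a d1b] [d1c d1d]] := hv1; have [_ _ _ [d2a d2b] [d2c d2d]] := hv2.
have [_ _ _ [dwa dwb] [dwc dwd]] := hw.
have [cp1 cp2] := cp; have [cp11 cp22] := cdp; have [hp1 hp2] := hp.
have H := vorticity_energy n L0 cv cv1 cv2 cv11 cv22 c1 c2 c1x c2y cp1 cp2 cp11 cp22
  dwa dwb dwc dwd d1a d2b hp1 hp2 hdiv hvort.
have XE : wint L n 6 3 (fun z => (`|v1 z| + `|v2 z|) * w z ^+ 2) = convX v1 + convX v2.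
  rewrite -wint_add; try by cont.
  by congr (wint _ _ _ _ _); apply/funext => z; rewrite mulrDl.
rewrite XE in H.
have k1 : 2 * (6 * ((6 * n + 4)%:R * (2 / L)) ^+ 2) <= C / L ^+ 2.
  rewrite mulrA; apply: (@scaled_const_sqr _ _ 6) => //; first exact: affine_le_scale.
  by lra.
apply: (assemble_D L0 _ vortW_ge0 vortW_le (addr_ge0 (convX_ge0 v1) (convX_ge0 v2))
  energyE_ge0 (addr_ge0 (gradW_ge0 v1x v1y) (gradW_ge0 v2x v2y)) k1 _ _ H).
- by apply: system_const_ge; lra.
- by rewrite mulr_ge0// sqr_ge0.
- rewrite mulrA; apply: ler_wpM2r; first by rewrite invr_ge0.
  have h : (6 * n + 4)%:R <= 6%:R * n.+1%:R :> R by apply: natr_le_scale; exact: affine_le_scale.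
  have : n.+1%:R <= n.+1%:R ^+ 4 :> R by rewrite -[leLHS]expr1; exact: ler_weXn2l.
  have n0 : 0 <= n.+1%:R :> R by exact: ler0n.
  rewrite /system_const; move: h n0; move: (n.+1%:R) ((6 * n + 4)%:R); move=> N m *; lra.
Qed.

Lemma systemH5 s t : 0 < s -> 0 < t <= 1 -> convX v1 + convX v2 <=
  C * (delta * (gradW v1x v1y + gradW v2x v2y) +
       s * (t * (truncT v1 + truncT v2) + A / t) + energyY / s).
Proof.
move=> s0 t01; have /andP[t0 _] := t01.
have W0 := addr_ge0 (gradW_ge0 v1x v1y) (gradW_ge0 v2x v2y).
apply: (assemble_X _ delta0 s0 t0 W0 vortW_le (truncT_ge0 v1) (truncT_ge0 v2) hA
  (massA_ge0 v1) (massA_ge0 v2) energyY_ge0).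
- by apply: system_const_ge; lra.
- exact: convective_energy.
- exact: convective_energy.
Qed.

Lemma systemH6 r : 0 < r -> energyY <=
  C * (r * energyD + (gradW v1x v1y + gradW v2x v2y) / r + (gradW v1x v1y + gradW v2x v2y) / L) ^+ 2.
Proof.
move=> r0; have [_ _ _ [dwa dwb] [dwc dwd]] := hw.
have H := quartic_energy n L0 r0 cv cv1 cv2 dwa dwb.
have n0 : 0 <= n.+1%:R :> R by exact: ler0n.
have W0 := addr_ge0 (gradW_ge0 v1x v1y) (gradW_ge0 v2x v2y).
have h := assemble_Y _ _ L0 r0 energyD_ge0 W0 vortW_ge0 vortW_le _ H.
(* Twice the coefficient [(5n+3) * 2] is at most [20 * (n+1)], and the square of this number is
   still below the constant of the system. *)
apply: le_trans (h (20 * n.+1%:R) _ _ _) _.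
- by move: N1; move: (n.+1%:R); move=> N; lra.
- have h5 : (5 * n + 3)%:R <= 5%:R * n.+1%:R :> R by apply: natr_le_scale; exact: affine_le_scale.
  have li : 0 <= L^-1 by rewrite invr_ge0.
  have := ler_wpM2r li h5; move: (L^-1) ((5 * n + 3)%:R) (n.+1%:R) => l m N; lra.
- by rewrite mulr_ge0// divr_ge0.
apply: ler_wpM2r; first exact: sqr_ge0.
rewrite /system_const exprMn.
have : n.+1%:R ^+ 2 <= n.+1%:R ^+ 4 :> R by exact: ler_weXn2l.
have : 0 <= n.+1%:R ^+ 4 :> R by exact: exprn_ge0.
by move: (n.+1%:R ^+ 2) (n.+1%:R ^+ 4); move=> a b; lra.
Qed.

Lemma smooth_energy_system : energy_system C delta A L energyD
  (gradW v1x v1y + gradW v2x v2y) (massV v1 + massV v2) (convX v1 + convX v2) energyY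
  (truncT v1 + truncT v2) energyE.
Proof.
have E0 := energyE_ge0; have D0 := energyD_ge0; have Y0 := energyY_ge0.
have W0 := addr_ge0 (gradW_ge0 v1x v1y) (gradW_ge0 v2x v2y).
have V0 := addr_ge0 (massV_ge0 v1) (massV_ge0 v2).
have X0 := addr_ge0 (convX_ge0 v1) (convX_ge0 v2).
have T0 := addr_ge0 (truncT_ge0 v1) (truncT_ge0 v2).
split; first by split.
- by split.
- exact: systemH1.
- exact: systemH2.
- split; first exact: systemH3.
  split; [exact: systemH4|exact: systemH5|exact: systemH6].
Qed.

End SmoothFlow.

(** * Properties of all sufficiently narrow mollifiers *)

Section FineMollifiers.
Context {R : realType}.
Implicit Types (f g : R * R -> R) (L d e : R) (a : nat -> R -> R).
Implicit Types P Q : R -> (nat -> R -> R) -> Prop.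

(** The threshold is uniform over the shapes of the mollifiers, and finitely many such properties
    hold simultaneously. The cap 1 matches the margin between [L] and the enlarged square of
    half-width [L + 1]. *)
Definition for_fine P :=
  exists2 e0, 0 < e0 <= 1 & forall e a, 0 < e <= e0 -> is_mollifier e a -> P e a.

Lemma for_fineI P Q : for_fine P -> for_fine Q -> for_fine (fun e a => P e a /\ Q e a).
Proof.
move=> [r /andP[r0 r1] hP] [s /andP[s0 s1] hQ].
exists (Num.min r s); first by rewrite lt_min r0 s0/= ge_min r1.
move=> e a /andP[e0]; rewrite le_min => /andP[er es] ha.
by split; [apply: hP|apply: hQ] => //; rewrite e0.
Qed.

Lemma for_fineW P Q : (forall e a, 0 < e <= 1 -> is_mollifier e a -> P e a -> Q e a) ->
  for_fine P -> for_fine Q.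
Proof.
move=> PQ [r /andP[r0 r1] hP]; exists r; first by rewrite r0.
move=> e a /andP[e0 er] ha; apply: PQ => //; first by rewrite e0 (le_trans er).
by apply: hP => //; rewrite e0.
Qed.

Lemma for_fine_exists P : for_fine P -> exists e a, [/\ 0 < e <= 1, is_mollifier e a & P e a].
Proof.
move=> [e /andP[e0 e1] hP]; have [a ha] := mollifier_exists e0.
by exists e, a; split => //; [rewrite e0|apply: hP; rewrite ?e0/=].
Qed.

(** On the square [f] takes values in a bounded interval, on which [h] is uniformly continuous; [h]
    is viewed as a function on the plane depending on the first coordinate only. *)
Lemma mollify_comp_uniform L f (h : R -> R) d : continuous f -> continuous h -> 0 < d ->
  for_fine (fun e a => forall x, square L x ->
    `|h (mollify a (L + 1) f 0 0 x) - h (f x)| <= d).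
Proof.
move=> cf ch d0; have [M M0 fM] := continuous_square_bounded L cf.
have [r r0 hr] := square_uniform_continuity M (cont_comp ch (@cont_fst R)) d0.
have r20 : 0 < r / 2 by rewrite divr_gt0.
apply: for_fineW (mollify_uniform L cf r20) => e a _ _ H x xL; rewrite distrC.
apply/ltW/(hr (f x, 0) (mollify a (L + 1) f 0 0 x, 0)).
- by have := fM x xL; rewrite ler_norml => ?; apply/squareP; split => //; apply/andP; split; lra.
- by rewrite /= distrC; apply: le_lt_trans (H x xL) _; lra.
- by rewrite /= subrr normr0.
Qed.

Lemma sqint_mollify_comp L f (h : R -> R) d : 0 < L -> continuous f -> continuous h ->
  0 < d -> for_fine (fun e a => sqint L (fun z => h (mollify a (L + 1) f 0 0 z)) <=
    sqint L (fun z => h (f z)) + d).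
Proof.
move=> L0 cf ch d0; have L0' := ltW L0.
have q : 0 < d / (2 * L) ^+ 2 by rewrite divr_gt0// exprn_gt0// mulr_gt0.
apply: for_fineW (mollify_comp_uniform L cf ch q) => e a /andP[e0 _] ha H.
have chf := cont_comp ch cf.
have cm : continuous (mollify a (L + 1) f 0 0) by apply: (cont_mollify e0 ha) => //; lra.
have chm := cont_comp ch cm.
have -> : d = sqint L (fun=> d / (2 * L) ^+ 2).
  by rewrite sqint_cst// divfK// expf_neq0// mulf_neq0// gt_eqF.
rewrite -sqintD//; last exact: contC.
apply: le_sqint => //; first by cont.
by move=> z zL; have := H z zL; rewrite ler_norml => /andP[_]; rewrite lerBlDl.
Qed.

Lemma mollify_product L f g d : 0 < L -> continuous f -> continuous g -> 0 < d ->
  for_fine (fun e a => forall x, square L x ->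
    `|mollify a (L + 1) (fun z => f z * g z) 0 0 x -
      mollify a (L + 1) g 0 0 x * mollify a (L + 1) f 0 0 x| <= d).
Proof.
move=> L0 cf cg d0.
have [Mf Mf0 fM] := continuous_square_bounded L cf.
have [Mg Mg0 gM] := continuous_square_bounded L cg.
have q0 : 0 < Mf + Mg + 2 by lra.
pose r := Num.min 1 (d / (Mf + Mg + 2)).
have r0 : 0 < r by rewrite lt_min ltr01 divr_gt0.
have r1 : r <= 1 by rewrite ge_min lexx.
have rd : r * (Mf + Mg + 2) <= d by rewrite -ler_pdivlMr// ge_min lexx orbT.
have H := for_fineI (mollify_uniform L (contM cf cg) r0)
  (for_fineI (mollify_uniform L cf r0) (mollify_uniform L cg r0)).
apply: for_fineW H => e a _ _ [h1 [h2 h3]] x xL.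
move: (h1 x xL) (h2 x xL) (h3 x xL) (fM x xL) (gM x xL).
move: (mollify a (L + 1) _ 0 0 x) (mollify a (L + 1) f 0 0 x) (mollify a (L + 1) g 0 0 x).
move: (f x) (g x) => F G p F' G' k1 k2 k3 b1 b2.
rewrite (_ : p - G' * F' = (p - F * G) - (G' - G) * F' - G * (F' - F)); last by ring.
apply: le_trans (ler_normB _ _) _; apply: le_trans (lerD (ler_normB _ _) (lexx _)) _.
rewrite !normrM.
have F'M : `|F'| <= Mf + 1.
  rewrite (_ : F' = (F' - F) + F); last by ring.
  by apply: le_trans (ler_normD _ _) _; lra.
have m1 : `|G' - G| * `|F'| <= r * (Mf + 1) by apply: ler_pM.
have m2 : `|G| * `|F' - F| <= Mg * r by apply: ler_pM.
by move: k1 m1 m2 rd; move: `|_ - _| (`|_| * _) (`|_| * _); clear => *; lra.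
Qed.

Lemma eq0_small (x K : R) : (forall k : R, 0 < k <= 1 -> `|x| <= K * k) -> x = 0.
Proof.
move=> H; apply/eqP; rewrite -normr_le0 leNgt; apply/negP => x0.
have K0 : 0 < K by have := H 1; rewrite ltr01 lexx mulr1 => /(_ erefl); lra.
pose k := Num.min 1 (`|x| / (2 * K)).
have k0 : 0 < k by rewrite lt_min ltr01 divr_gt0// mulr_gt0.
have := H k; rewrite k0 ge_min lexx => /(_ erefl).
have : 2 * (k * K) <= `|x| by rewrite mulrCA -ler_pdivlMr ?mulr_gt0// ge_min lexx orbT.
by rewrite [K * k]mulrC; move: (k * K) `|x| x0; clear => y z; lra.
Qed.

Lemma mollify_norm_le L e a i j (M : R) f x : 0 <= L -> 0 < e -> is_mollifier e a ->
  continuous f -> (forall z w, `|kern a i j z w| <= M) ->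
  `|mollify a L f i j x| <= M * sqint L (fun z => `|f z|).
Proof.
move=> L0 e0 ha cf kM; have ck := @cont_kern R e a ha i j x; have cnf := continuous_normfun cf.
apply: le_trans (norm_sqint L0 _) _; first by cont.
rewrite -sqintZ//; apply: le_sqint; [by []|by cont|by cont|].
by move=> z _; rewrite normrM mulrC; apply: ler_wpM2r.
Qed.

Lemma kern_bounded e a i j : 0 < e -> is_mollifier e a ->
  exists2 M, 0 < M & forall z w, `|kern a i j z w| <= M.
Proof.
move=> e0 ha; have [Mi Mi0 bi] := mollifier_bounded e0 ha i.
have [Mj Mj0 bj] := mollifier_bounded e0 ha j.
exists (Mi * Mj); first exact: mulr_gt0.
by move=> z w; rewrite normrM; apply: ler_pM.
Qed.

(** The pointwise bound [|f| <= k + f ^+ 2 / k] replaces the Cauchy-Schwarz inequality. *)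
Lemma sqint_norm_le L f k : 0 <= L -> continuous f -> 0 < k ->
  sqint L (fun z => f z ^+ 2) <= k ^+ 2 ->
  sqint L (fun z => `|f z|) <= ((2 * L) ^+ 2 + 1) * k.
Proof.
move=> L0 cf k0 fk; have cnf := continuous_normfun cf.
apply: le_trans (_ : sqint L (fun z => k + k^-1 * f z ^+ 2) <= _).
  apply: le_sqint => //; first by cont.
  move=> z _; rewrite -(ler_pM2l k0) mulrDr mulrA mulfV ?gt_eqF// mul1r -expr2.
  have := sqr_ge0 (`|f z| - k); rewrite -[f z ^+ 2]real_normK ?num_real//.
  move: `|f z| (normr_ge0 (f z)) => y y0; nra.
rewrite sqintD//; [|exact: contC|by cont].
rewrite sqint_cst// sqintZ//; last by cont.
rewrite (_ : (_ + 1) * k = k * (2 * L) ^+ 2 + k); last by ring.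
apply: lerD => //.
by rewrite ler_pdivrMl// -expr2.
Qed.

(* [f x] is the limit of the mollifications of [f] at [x], each of which is bounded by a
   multiple of the integral of [|f|]. *)
Lemma eq0_sqint_norm L f x : continuous f -> square L x ->
  (forall d, 0 < d -> sqint (L + 1) (fun z => `|f z|) <= d) -> f x = 0.
Proof.
move=> cf xL H; apply: (@eq0_small _ 2) => k /andP[k0 k1].
have [e [a [/andP[e0 e1] ha /(_ x xL) h]]] := for_fine_exists (mollify_uniform L cf k0).
have [M M0 kM] := kern_bounded 0 0 e0 ha.
have L10 : 0 <= L + 1.
  by case: x xL {h} => x1 x2 /squareP[/andP[? ?] _]; lra.
have := mollify_norm_le x L10 e0 ha cf kM.
have := ler_wpM2l (ltW M0) (H (k / M) (divr_gt0 k0 M0)).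
rewrite mulrCA mulfV ?gt_eqF// mulr1 => h1 /le_trans/(_ h1) h2.
rewrite (_ : f x = mollify a (L + 1) f 0 0 x - (mollify a (L + 1) f 0 0 x - f x)); last by ring.
by apply: le_trans (ler_normB _ _) _; rewrite mulr2n mulrDl mul1r lerD.
Qed.

(** All derivatives fall on the kernel, so closeness of [f] and [g] in the mean is enough to compare
    derivatives of their mollifications. *)
Lemma mollify_test (b : nat -> R -> R) (e l k M : R) f g j1 j2 x : 0 <= l -> 0 < k -> 0 < e ->
  is_mollifier e b -> continuous f -> continuous g ->
  (forall z w, `|kern b j1 j2 z w| <= M) -> 0 <= M ->
  sqint l (fun z => `|f z - g z|) <= k ->
  `|mollify b l f j1 j2 x| <= M * k + `|mollify b l g j1 j2 x|.
Proof.
move=> l0 k0 e0 hb cf ch kM M0 fh.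
have E : mollify b l f j1 j2 x = mollify b l (fun z => f z - g z) j1 j2 x + mollify b l g j1 j2 x.
  rewrite -(mollifyD hb)//; last exact: contB.
  by congr (mollify b l _ j1 j2 x); apply/funext => z; rewrite subrK.
rewrite E; apply: le_trans (ler_normD _ _) _; apply: lerD => //.
apply: le_trans (mollify_norm_le x l0 e0 hb (contB cf ch) kM) _.
exact: ler_wpM2l.
Qed.

Lemma sqint_norm_sub_le (l L k : R) f g : 0 <= l -> l <= L -> continuous f -> continuous g ->
  (forall z, square L z -> `|g z - f z| <= k) ->
  sqint l (fun z => `|f z - g z|) <= k * (2 * l) ^+ 2.
Proof.
move=> l0 lL cf ch fh; rewrite -sqint_cst//; apply: le_sqint => //.
- exact: continuous_normfun (contB cf ch).
- exact: contC.
move=> z zl; rewrite distrC; apply: fh; case: z zl => x y /squareP[/andP[? ?] /andP[? ?]].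
by apply/squareP; split; apply/andP; split; lra.
Qed.

End FineMollifiers.

(** * Vanishing of the velocity gradient *)

Section SubSquares.
Context {R : realType}.
Implicit Types (f g : R * R -> R) (L l : R).

Lemma sqint_subset l L f : 0 <= l -> l <= L -> continuous f ->
  (forall z, square L z -> 0 <= f z) -> sqint l f <= sqint L f.
Proof.
move=> l0 lL cf f0; have L0 := le_trans l0 lL; rewrite /sqint /Rintegral; apply: fine_le.
- by apply: integrable_fin_num; [exact: square_measurable|exact: continuous_square_integrable].
- by apply: integrable_fin_num; [exact: square_measurable|exact: continuous_square_integrable].
apply: ge0_subset_integral => //=; try exact: square_measurable.
- by apply/measurable_EFinP/measurable_funTS; exact: continuous_plane_measurable.
- move=> [x y] /squareP[/andP[? ?] /andP[? ?]].
  by apply/squareP; split; apply/andP; split; lra.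
Qed.

(** Each factor of the weight is at least [3 / 4] on the half-size square, and [9 / 16] exceeds
    [1 / 2]. *)
Lemma weight_inner_ge L l z : 0 < l -> 2 * l <= L -> square l z -> 1 <= 2 * weight L z.
Proof.
move=> l0 lL; case: z => x y /squareP[xl yl]; have L0 : 0 < L by lra.
have sc (t : R) : - l <= t <= l -> 3 / 4 <= 1 - (t / L) ^+ 2.
  move=> /andP[t1 t2].
  have : `|t / L| <= 1 / 2.
    by rewrite normrM normfV (gtr0_norm L0) ler_pdivrMr// ler_norml; apply/andP; split; lra.
  by move=> /norm_sqr_le; move: ((t / L) ^+ 2) => q; lra.
have := sc _ xl; have := sc _ yl; rewrite /weight/=.
by move: (1 - _) (1 - _) => p q; nra.
Qed.

Lemma sqint_le_wint L l n k j f : 0 < l -> 2 * l <= L -> continuous f ->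
  (forall z, 0 <= f z) -> sqint l f <= 2 ^+ (k * n + j) * wint L n k j f.
Proof.
move=> l0 lL cf f0; have L0 : 0 < L by lra.
have lL' : l <= L by lra.
have cw := @cont_wpow R L (k * n + j) f cf.
apply: (@le_trans _ _ (sqint l (fun z => 2 ^+ (k * n + j) * (weight L z ^+ (k * n + j) * f z)))).
  apply: le_sqint; [exact: ltW|by []|by apply: contM => //; exact: contC|].
  move=> z zl; rewrite mulrA -exprMn ler_peMl// exprn_ege1//.
  exact: weight_inner_ge zl.
rewrite sqintZ ?(ltW l0)//; apply: ler_wpM2l; first by rewrite exprn_ge0.
apply: sqint_subset => //; first exact: ltW.
move=> z zL; apply: mulr_ge0 => //.
by have /andP[] := weight_power_bounds (k * n + j) L0 zL.
Qed.

Lemma le_wint L n k j f g : 0 < L -> continuous f -> continuous g ->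
  (forall z, f z <= g z) -> wint L n k j f <= wint L n k j g.
Proof.
move=> L0 cf cg fg; apply: le_sqint; [exact: ltW|exact: cont_wpow|exact: cont_wpow|].
by move=> z zL; apply: ler_wpM2l => //; have /andP[] := weight_power_bounds (k * n + j) L0 zL.
Qed.

Lemma d1_cst f (a b y : R) : d1 f (fun=> 0) -> f (a, y) = f (b, y).
Proof. by move=> df; apply: (is_derive_0_is_cst (f := fun s => f (s, y))) => s; exact: df. Qed.

Lemma d2_cst f (a b x : R) : d2 f (fun=> 0) -> f (x, a) = f (x, b).
Proof. by move=> df; apply: (is_derive_0_is_cst (f := fun s => f (x, s))) => s; exact: df. Qed.

Lemma exists_small (B d : R) : 0 < d -> exists2 k, 0 < k <= 1 & B * k <= d.
Proof.
move=> d0; have B0 : 0 < `|B| + 1 by rewrite ltr_wpDl.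
exists (Num.min 1 (d / (`|B| + 1))); first by rewrite lt_min ltr01 divr_gt0//= ge_min lexx.
set k := Num.min _ _; have k0 : 0 < k by rewrite lt_min ltr01 divr_gt0.
apply: (@le_trans _ _ ((`|B| + 1) * k)).
  by apply: ler_wpM2r; [exact: ltW|have := ler_norm B; lra].
by rewrite mulrC -ler_pdivlMr// ge_min lexx orbT.
Qed.

End SubSquares.

Section Liouville.
Context {R : realType}.
Variables vel1 vel2 vel11 vel12 vel21 vel22 : R * R -> R.
Hypothesis fields : solution_fields vel1 vel2 vel11 vel12 vel21 vel22.
Variables (n i : nat).
Hypothesis ni : (2 * n + 2 = 2 ^ i)%N.

Local Notation g := (trunc n i).
Local Notation om := (vort vel12 vel21).
Local Notation C := (@system_const R n).

Definition trunc_mass (delta L : R) :=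
  sqint L (fun z => g delta (vel1 z) ^+ 2) + sqint L (fun z => g delta (vel2 z) ^+ 2).

Hypothesis mass_bounded : forall delta : R, 0 < delta <= 1 ->
  exists2 A, 1 <= A & forall L, 0 < L -> trunc_mass delta L <= A.

Let cv1 : continuous vel1. Proof. by case: fields => -[]. Qed.
Let cv2 : continuous vel2. Proof. by case: fields => -[]. Qed.
Let c11 : continuous vel11. Proof. by case: fields => -[]. Qed.
Let c12 : continuous vel12. Proof. by case: fields => -[]. Qed.
Let c21 : continuous vel21. Proof. by case: fields => _ []. Qed.
Let c22 : continuous vel22. Proof. by case: fields => _ []. Qed.
Let com : continuous om. Proof. by rewrite /vort; apply: contB. Qed.
Let C1 : 1 <= C. Proof. exact: system_const_ge1. Qed.

Definition moll_vort (a : nat -> R -> R) (L : R) j k (z : R * R) : R :=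
  mollify a (L + 1) vel2 j.+1 k z - mollify a (L + 1) vel1 j k.+1 z.

Definition moll_error (a : nat -> R -> R) (L : R) :=
  energyE (mollify a (L + 1) vel1 0 0) (mollify a (L + 1) vel2 0 0) (moll_vort a L 0 0)
    (mollify a (L + 1) (fun z => om z * vel1 z) 0 0)
    (mollify a (L + 1) (fun z => om z * vel2 z) 0 0) L.

Definition moll_grad (a : nat -> R -> R) (L : R) :=
  gradW L n (mollify a (L + 1) vel1 1 0) (mollify a (L + 1) vel1 0 1) +
  gradW L n (mollify a (L + 1) vel2 1 0) (mollify a (L + 1) vel2 0 1).

Definition moll_mass (delta : R) (a : nat -> R -> R) (L : R) :=
  massA L (g delta) (mollify a (L + 1) vel1 0 0) +
  massA L (g delta) (mollify a (L + 1) vel2 0 0).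

Section Mollified.
Variables (e : R) (a : nat -> R -> R) (L : R).
Hypotheses (e01 : 0 < e <= 1) (ha : is_mollifier e a) (L1 : 1 <= L).

Let e0 : 0 < e. Proof. by case/andP: e01. Qed.
Let L0 : 0 < L + 1. Proof. by have := L1; lra. Qed.
Let L0' : 0 <= L + 1. Proof. exact: ltW. Qed.

Lemma C2_mollify f : continuous f -> C2_fields (mollify a (L + 1) f 0 0)
  (mollify a (L + 1) f 1 0) (mollify a (L + 1) f 0 1)
  (mollify a (L + 1) f 2 0) (mollify a (L + 1) f 0 2).
Proof.
move=> cf; have cm j k : continuous (mollify a (L + 1) f j k) by exact: (cont_mollify e0 ha).
by split => //; split; [exact: (d1_mollify e0 ha)|exact: (d2_mollify e0 ha)|
  exact: (d1_mollify e0 ha)|exact: (d2_mollify e0 ha)].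
Qed.

Lemma cont_moll_vort j k : continuous (moll_vort a L j k).
Proof. by apply: contB; exact: (cont_mollify e0 ha). Qed.

Lemma d1_moll_vort j k : d1 (moll_vort a L j k) (moll_vort a L j.+1 k).
Proof. by apply: d1B; exact: (d1_mollify e0 ha). Qed.

Lemma d2_moll_vort j k : d2 (moll_vort a L j k) (moll_vort a L j k.+1).
Proof. by apply: d2B; exact: (d2_mollify e0 ha). Qed.

Lemma inner_square z : square L z -> square (L + 1 - e) z.
Proof.
have /andP[_ e1] := e01; case: z => x y /squareP[/andP[? ?] /andP[? ?]].
by apply/squareP; split; apply/andP; split; lra.
Qed.

Lemma moll_vortE j k z : square L z -> moll_vort a L j k z = mollify a (L + 1) om j k z.
Proof. by move=> zL; apply: (mollified_vort fields e0 ha L0); exact: inner_square. Qed.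

Lemma mollified_energy_system (delta A : R) : 0 < delta -> moll_mass delta a L <= A ->
  exists V X Y T, energy_system C delta A L
    (energyD (moll_vort a L 1 0) (moll_vort a L 0 1) L n) (moll_grad a L) V X Y T
    (moll_error a L).
Proof.
move=> de0 mA; have de0' := ltW de0; do 4 eexists.
have hw : C2_fields (moll_vort a L 0 0) (moll_vort a L 1 0) (moll_vort a L 0 1)
    (moll_vort a L 2 0) (moll_vort a L 0 2).
  by split; [|split|split|split|split];
    solve [exact: cont_moll_vort | exact: d1_moll_vort | exact: d2_moll_vort].
have [p1c [p11 _] _ [p1d _] _] := C2_mollify (contM com cv1).
have [p2c [_ p22] _ [_ p2d] _] := C2_mollify (contM com cv2).
apply: (smooth_energy_system (C2_mollify cv1) (C2_mollify cv2) hw (conj p1c p2c)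
  (conj p11 p22) (conj p1d p2d) L1 de0' (@cont_trunc R n i delta) (cont_truncI (n := n) (i := i) de0')) => //.
- by move=> x; exact: is_derive_truncI.
- by move=> x; exact: trunc_ge0.
- by move=> x; exact: truncI_le.
- exact: truncatesP.
- by move=> z zL; apply: (mollified_div fields e0 ha L0); exact: inner_square.
(* Differentiating the divergence constraint in the first variable turns the Laplacian of the first
   component into minus the second derivative of the vorticity; the next case is its counterpart. *)
- move=> z zL; have := mollified_div fields e0 ha L0 1 0 (inner_square zL).
  rewrite /moll_vort; move: (mollify _ _ vel1 2 0 z) (mollify _ _ vel1 0 2 z) => x y.
  by move: (mollify _ _ _ _ _ _) => t; lra.
- move=> z zL; have := mollified_div fields e0 ha L0 0 1 (inner_square zL).
  rewrite /moll_vort; move: (mollify _ _ vel2 2 0 z) (mollify _ _ vel2 0 2 z) => x y.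
  by move: (mollify _ _ _ _ _ _) => t; lra.
- move=> z zL; exact: (mollified_vorticity fields e0 ha L0 (inner_square zL)).
Qed.

End Mollified.

(** On a fixed square the truncated mass of the mollified field converges to that of the field. The
    added unit leaves room for the difference, independently of [L]. *)
Lemma moll_mass_bounded (delta L A : R) : 0 < L -> trunc_mass delta L <= A ->
  for_fine (fun e a => moll_mass delta a L <= A + 1).
Proof.
move=> L0 tA; have ch : continuous (fun x => g delta x ^+ 2) by apply: contX; exact: cont_trunc.
have h : 0 < 1 / 2 :> R by lra.
apply: for_fineW (for_fineI (sqint_mollify_comp L0 cv1 ch h) (sqint_mollify_comp L0 cv2 ch h)).
move=> e a _ _ [h1 h2]; apply: le_trans (lerD h1 h2) _; rewrite addrACA; apply: lerD => //.
by rewrite -splitr.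
Qed.

Lemma moll_error_small (L d : R) : 1 <= L -> 0 < d -> for_fine (fun e a => moll_error a L <= d).
Proof.
move=> L1 d0; have L0 : 0 < L by lra.
have q0 : 0 < 2 * (2 * L) ^+ 2 by rewrite mulr_gt0// exprn_gt0// mulr_gt0.
pose r := Num.min 1 (d / (2 * (2 * L) ^+ 2)).
have r0 : 0 < r by rewrite lt_min ltr01 divr_gt0.
have rd : r * (2 * (2 * L) ^+ 2) <= d by rewrite -ler_pdivlMr// ge_min lexx orbT.
have r2 : r ^+ 2 <= r by rewrite expr2 ler_piMr ?(ltW r0)// ge_min lexx.
apply: for_fineW (for_fineI (mollify_product L0 com cv1 r0) (mollify_product L0 com cv2 r0)).
move=> e a e01 ha [h1 h2]; rewrite /moll_error /energyE; have /andP[e0 _] := e01.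
have L0' : 0 <= L + 1 by lra.
have cm f j k : continuous f -> continuous (mollify a (L + 1) f j k) by exact: (cont_mollify e0 ha).
have cw : continuous (moll_vort a L 0 0) by exact: (cont_moll_vort e01 ha L1).
have m1 := cm _ 0%N 0%N cv1; have m2 := cm _ 0%N 0%N cv2.
have m3 := cm _ 0%N 0%N (contM com cv1); have m4 := cm _ 0%N 0%N (contM com cv2).
apply: le_trans rd; rewrite mulrA [r * 2]mulrC -sqint_cst ?(ltW L0)//.
apply: le_sqint; [by rewrite ltW|by cont|exact: contC|].
move=> z zL; rewrite (moll_vortE e01 ha L1)//.
have := norm_sqr_le (h1 z zL); have := norm_sqr_le (h2 z zL).
by move: (_ ^+ 2) (_ ^+ 2) r2 => x y; lra.
Qed.

(** The order of choices matters: [L0] depends on [delta] and [A], and the admissible width of the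
    mollifier is chosen after [L]. *)
Lemma energyD_small (delta : R) : 0 < delta <= 1 -> exists2 L0, 1 <= L0 &
  forall L, L0 <= L -> for_fine (fun e a =>
    energyD (moll_vort a L 1 0) (moll_vort a L 0 1) L n <= (32 * C ^+ 4 + 1) ^+ 2 * delta ^+ 4).
Proof.
move=> de; have [A A1 hA] := mass_bounded de; have /andP[de0 _] := de.
have A11 : 1 <= A + 1 by lra.
have [L0 L01 H] := energy_bootstrap C1 de A11; exists L0 => // L L0L.
have Lp : 0 < L by lra.
have L1 : 1 <= L by lra.
have q : 0 < delta ^+ 4 / (4 * C).
  apply: divr_gt0; first exact: exprn_gt0.
  by apply: mulr_gt0; [exact: ltr0n|exact: lt_le_trans ltr01 C1].
apply: for_fineW (for_fineI (moll_mass_bounded Lp (hA L Lp)) (moll_error_small L1 q)).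
move=> e a e01 ha [hm he].
have [V [X [Y [T sys]]]] := mollified_energy_system e01 ha L1 de0 hm.
exact: H L0L sys he.
Qed.

(** The second pass. A small positive [D] would control [W] only relative to [L]; with [D] exactly
    zero the bound on [W] no longer grows with [L]. *)
Lemma moll_grad_small (delta : R) : 0 < delta <= 1 ->
  (forall e a L, 0 < e <= 1 -> is_mollifier e a -> 1 <= L ->
    energyD (moll_vort a L 1 0) (moll_vort a L 0 1) L n = 0) ->
  exists2 L0, 1 <= L0 &
  forall L, L0 <= L -> for_fine (fun e a => moll_grad a L <= (8 * C ^+ 2 + 2) * delta ^+ 2).
Proof.
move=> de D0; have [A A1 hA] := mass_bounded de; have /andP[de0 _] := de.
have A11 : 1 <= A + 1 by lra.
have d20 : 0 < delta ^+ 2 by rewrite exprn_gt0.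
have q0 : 0 <= 88 * C ^+ 3 * (A + 1) / delta ^+ 2.
  apply: divr_ge0 (ltW d20); apply: mulr_ge0 (le_trans ler01 A11).
  by apply: mulr_ge0; [exact: ler0n|exact: exprn_ge0 (le_trans ler01 C1)].
exists (1 + 88 * C ^+ 3 * (A + 1) / delta ^+ 2); first by rewrite lerDl.
move: q0; set q := _ / _ => q0.
move=> L L0L; have Lp : 0 < L by lra.
have L1 : 1 <= L by lra.
apply: for_fineW (moll_mass_bounded Lp (hA L Lp)) => e a e01 ha hm.
have [V [X [Y [T]]]] := mollified_energy_system e01 ha L1 de0 hm.
rewrite (D0 e)//; apply: energy_system_degenerate => //.
rewrite -ler_pdivrMr//; apply: (@le_trans _ _ L); last by rewrite expr2 ler_peMr// ltW.
by apply: le_trans L0L; rewrite lerDr.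
Qed.

(* The smallness of [energyD] at large scales passes to any fixed mollification of the
   vorticity, because the fine mollifications approximate the vorticity uniformly. *)
Lemma mollified_vort_gradient0 (e : R) a (L : R) x : 0 < e <= 1 -> is_mollifier e a -> 1 <= L ->
  square L x -> mollify a (L + 1) om 1 0 x = 0 /\ mollify a (L + 1) om 0 1 x = 0.
Proof.
move=> e01 ha L1 xL; have /andP[e0 e1] := e01.
have l0 : 0 < L + 1 by lra.
have l0' := ltW l0.
have [M0 M00 k0M] := kern_bounded 0 0 e0 ha.
have [M1 M10 k1M] := kern_bounded 1 0 e0 ha.
have [M2 M20 k2M] := kern_bounded 0 1 e0 ha.
pose q := (2 * (L + 1)) ^+ 2.
suff H (k : R) : 0 < k <= 1 ->
    `|mollify a (L + 1) om 1 0 x| <= (M1 * q + M0 * (q + 1)) * k /\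
    `|mollify a (L + 1) om 0 1 x| <= (M2 * q + M0 * (q + 1)) * k.
  by split; [apply: (@eq0_small _ _ (M1 * q + M0 * (q + 1))) => k /H[] |
    apply: (@eq0_small _ _ (M2 * q + M0 * (q + 1))) => k /H[] ].
move=> /andP[k0 k1].
have k20 : 0 < k ^+ 2 by exact: exprn_gt0.
(* The power of 2 is the price of removing the weight on the inner square; smallness to first order
   in [delta] suffices because [delta ^+ 4 <= delta]. *)
have [de de01 hde] := exists_small (2 ^+ (6 * n + 4) * (32 * C ^+ 4 + 1) ^+ 2) k20.
have /andP[de0 de1] := de01.
have [L0 L01 HD] := energyD_small de01.
(* Two mollifiers are in play: the given [a] only tests on the inner square, while a finer [a'] at
   the scale [L'] carries the energy bound. The scale exceeds [L0] and twice the inner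
   half-width. *)
pose L' := L0 + 2 * (L + 1).
have L'0 : L0 <= L' by rewrite /L'; lra.
have L'1 : 1 <= L' by rewrite /L'; lra.
have lL' : 2 * (L + 1) <= L' by rewrite /L'; lra.
have lL'' : L + 1 <= L' by rewrite /L'; lra.
have [e' [a' [e'01 ha' [hD hom]]]] :=
  for_fine_exists (for_fineI (HD L' L'0) (mollify_uniform L' com k0)).
have cw j1 j2 : continuous (moll_vort a' L' j1 j2) by exact: (cont_moll_vort e'01 ha' L'1).
have dw : sqint (L + 1) (fun z => moll_vort a' L' 1 0 z ^+ 2 + moll_vort a' L' 0 1 z ^+ 2) <= k ^+ 2.
  apply: le_trans (sqint_le_wint n 6 4 l0 lL' _ _) _.
  - by apply: contD; exact: contX.
  - by move=> z; rewrite addr_ge0 ?sqr_ge0.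
  apply: le_trans hde; rewrite -mulrA; apply: ler_wpM2l; first by rewrite exprn_ge0.
  apply: le_trans hD _; apply: ler_wpM2l; first exact: sqr_ge0.
  by rewrite -[leRHS]expr1; apply: ler_wiXn2l => //; exact: ltW.
have comp (f : R * R -> R) : continuous f -> (forall z, f z ^+ 2 <=
    moll_vort a' L' 1 0 z ^+ 2 + moll_vort a' L' 0 1 z ^+ 2) ->
    `|mollify a (L + 1) f 0 0 x| <= M0 * ((q + 1) * k).
  move=> cf fw; apply: le_trans (mollify_norm_le x l0' e0 ha cf k0M) _.
  apply: ler_wpM2l; first exact: ltW.
  apply: sqint_norm_le => //; apply: le_trans dw; apply: le_sqint => //.
    exact: contX.
  by apply: contD; exact: contX.
have om_w : sqint (L + 1) (fun z => `|om z - moll_vort a' L' 0 0 z|) <= q * k.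
  rewrite mulrC; apply: sqint_norm_sub_le lL'' _ _ _ => //.
  by move=> z zL; rewrite (moll_vortE e'01 ha' L'1)//; exact: hom.
have qk : 0 < q * k by rewrite mulr_gt0// exprn_gt0// mulr_gt0.
have xl : square (L + 1 - e) x by exact: (inner_square e01).
have split_k M : (M * q + M0 * (q + 1)) * k = M * (q * k) + M0 * ((q + 1) * k).
  by rewrite mulrDl; congr (_ + _); rewrite [RHS]mulrA.
rewrite !split_k; split.
- apply: le_trans (mollify_test x l0' qk e0 ha com (cw 0%N 0%N) k1M (ltW M10) om_w) _.
  apply: lerD => //.
  rewrite -(mollify_parts1 e0 ha 0 0 l0 (cw _ _) (cw _ _) (d1_moll_vort e'01 ha' L'1 0 0) xl).
  by apply: comp => // z; rewrite lerDl sqr_ge0.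
- apply: le_trans (mollify_test x l0' qk e0 ha com (cw 0%N 0%N) k2M (ltW M20) om_w) _.
  apply: lerD => //.
  rewrite -(mollify_parts2 e0 ha 0 0 l0 (cw _ _) (cw _ _) (d2_moll_vort e'01 ha' L'1 0 0) xl).
  by apply: comp => // z; rewrite lerDr sqr_ge0.
Qed.

(** Approximate smallness for fine mollifiers has become exact vanishing for every mollifier of
    width at most 1, as the second pass requires. *)
Lemma energyD_eq0 (e : R) a (L : R) : 0 < e <= 1 -> is_mollifier e a -> 1 <= L ->
  energyD (moll_vort a L 1 0) (moll_vort a L 0 1) L n = 0.
Proof.
move=> e01 ha L1; rewrite /energyD /wint.
rewrite (@eq_sqint _ _ _ (fun=> 0)) ?sqint_cst ?mul0r//; first by have := L1; lra.
move=> z zL; have [w1 w2] := mollified_vort_gradient0 e01 ha L1 zL.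
by rewrite !(moll_vortE e01 ha L1)// w1 w2 expr0n addr0 mulr0.
Qed.

(** [f] is one of the four velocity derivatives, and [h] the same derivative of the mollified
    velocity, the form in which it occurs in [moll_grad]. It agrees with the mollification of [f]
    only where integration by parts leaves no boundary terms. *)
Lemma gradient_component_eq0 (f : R * R -> R) (x : R * R) : continuous f ->
  (forall e a L, 0 < e <= 1 -> is_mollifier e a -> 1 <= L -> exists h : R * R -> R,
    [/\ continuous h, forall z, square L z -> h z = mollify a (L + 1) f 0 0 z &
        wint L n 4 2 (fun z => h z ^+ 2) <= moll_grad a L]) -> f x = 0.
Proof.
move=> cf H; pose l := `|x.1| + `|x.2|; have l0 : 0 <= l by rewrite addr_ge0.
have xl : square l x.
  case: x @l l0 => x y /= _; apply/squareP.
  by rewrite -!ler_norml lerDl lerDr !normr_ge0.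
apply: (eq0_sqint_norm cf xl) => d d0; pose q := (2 * (l + 1)) ^+ 2.
have l1 : 0 < l + 1 by lra.
have [k /andP[k0 k1] hk] := exists_small (q + (q + 1)) d0.
have k20 : 0 < k ^+ 2 by exact: exprn_gt0.
have [de de01 hde] := exists_small (2 ^+ (4 * n + 2) * (8 * C ^+ 2 + 2)) k20.
have /andP[de0 de1] := de01.
have [L0 L01 HD] := moll_grad_small de01 (fun e a L => @energyD_eq0 e a L).
pose L := L0 + 2 * (l + 1).
have L'0 : L0 <= L by rewrite /L; lra.
have L1 : 1 <= L by rewrite /L; lra.
have lL : 2 * (l + 1) <= L by rewrite /L; lra.
have lL' : l + 1 <= L by rewrite /L; lra.
have [e [a [e01 ha [hD hf]]]] := for_fine_exists (for_fineI (HD L L'0) (mollify_uniform L cf k0)).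
have [h [ch hE hw]] := H e a L e01 ha L1.
have fh : sqint (l + 1) (fun z => `|f z - h z|) <= k * q.
  apply: sqint_norm_sub_le lL' cf ch _; first exact: ltW.
  by move=> z zL; rewrite hE//; exact: hf.
have hh : sqint (l + 1) (fun z => `|h z|) <= (q + 1) * k.
  apply: sqint_norm_le => //; first exact: ltW.
  have ch2 : continuous (fun z => h z ^+ 2) by exact: contX.
  apply: le_trans (sqint_le_wint n 4 2 l1 lL ch2 _) _; first by move=> z; exact: sqr_ge0.
  apply: le_trans hde; rewrite -mulrA; apply: ler_wpM2l; first by rewrite exprn_ge0.
  apply: le_trans hw _; apply: le_trans hD _; apply: ler_wpM2l.
    by rewrite addr_ge0// mulr_ge0// sqr_ge0.
  by rewrite -[leRHS]expr1; apply: ler_wiXn2l => //; exact: ltW.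
apply: le_trans hk; rewrite mulrDl [q * k]mulrC; apply: le_trans (lerD fh hh).
have cfh := continuous_normfun (contB cf ch); have cnh := continuous_normfun ch.
rewrite -sqintD ?(ltW l1)//; apply: le_sqint; [exact: ltW|exact: continuous_normfun|exact: contD|].
by move=> z _; rewrite -[X in `|X| <= _](subrK (h z)) ler_normD.
Qed.

Lemma velocity_gradient_eq0 z : [/\ vel11 z = 0, vel12 z = 0, vel21 z = 0 & vel22 z = 0].
Proof.
have [_ _ [dv11 dv12 dv21 dv22] _ _] := fields.
have cm (e : R) a L (f : R * R -> R) j1 j2 : 0 < e <= 1 -> is_mollifier e a -> 1 <= L -> continuous f ->
    continuous (mollify a (L + 1) f j1 j2).
  by move=> /andP[e0 _] ha L1 cf; apply: (cont_mollify e0 ha) => //; lra.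
have gW (L : R) (fx fy : R * R -> R) : 1 <= L -> continuous fx -> continuous fy ->
    [/\ wint L n 4 2 (fun z => fx z ^+ 2) <= gradW L n fx fy,
        wint L n 4 2 (fun z => fy z ^+ 2) <= gradW L n fx fy & 0 <= gradW L n fx fy].
  move=> L1 cx cy; have L0 : 0 < L by lra.
  have cs : continuous (fun z => fx z ^+ 2 + fy z ^+ 2) by apply: contD; exact: contX.
  split; [| |by apply: wint_ge0 => // t; rewrite addr_ge0 ?sqr_ge0].
    by apply: le_wint => //; [exact: contX|move=> t; rewrite lerDl sqr_ge0].
  by apply: le_wint => //; [exact: contX|move=> t; rewrite lerDr sqr_ge0].
split; apply: gradient_component_eq0 => // e a L e01 ha L1; have /andP[e0 e1] := e01;
  have L10 : 0 < L + 1 by [lra];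
  have [g1 g2 g3] := gW L _ _ L1 (cm e a L vel1 1%N 0%N e01 ha L1 cv1) (cm e a L vel1 0%N 1%N e01 ha L1 cv1);
  have [g4 g5 g6] := gW L _ _ L1 (cm e a L vel2 1%N 0%N e01 ha L1 cv2) (cm e a L vel2 0%N 1%N e01 ha L1 cv2).
- exists (mollify a (L + 1) vel1 1 0); split; [exact: (cm e)| |].
    by move=> t tL; rewrite -(mollify_parts1 e0 ha 0 0 L10 cv1 c11 dv11)//; exact: inner_square.
  by apply: le_trans g1 _; rewrite /moll_grad lerDl; exact: g6.
- exists (mollify a (L + 1) vel1 0 1); split; [exact: (cm e)| |].
    by move=> t tL; rewrite -(mollify_parts2 e0 ha 0 0 L10 cv1 c12 dv12)//; exact: inner_square.
  by apply: le_trans g2 _; rewrite /moll_grad lerDl; exact: g6.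
- exists (mollify a (L + 1) vel2 1 0); split; [exact: (cm e)| |].
    by move=> t tL; rewrite -(mollify_parts1 e0 ha 0 0 L10 cv2 c21 dv21)//; exact: inner_square.
  by apply: le_trans g4 _; rewrite /moll_grad lerDr; exact: g3.
- exists (mollify a (L + 1) vel2 0 1); split; [exact: (cm e)| |].
    by move=> t tL; rewrite -(mollify_parts2 e0 ha 0 0 L10 cv2 c22 dv22)//; exact: inner_square.
  by apply: le_trans g5 _; rewrite /moll_grad lerDr; exact: g3.
Qed.

Lemma velocity_cst z : vel1 z = vel1 (0, 0) /\ vel2 z = vel2 (0, 0).
Proof.
have [_ _ [dv11 dv12 dv21 dv22] _ _] := fields.
have E11 : vel11 = fun=> 0 by apply/funext => t; have [] := velocity_gradient_eq0 t.
have E12 : vel12 = fun=> 0 by apply/funext => t; have [] := velocity_gradient_eq0 t.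
have E21 : vel21 = fun=> 0 by apply/funext => t; have [] := velocity_gradient_eq0 t.
have E22 : vel22 = fun=> 0 by apply/funext => t; have [] := velocity_gradient_eq0 t.
move: dv11 dv12 dv21 dv22; rewrite E11 E12 E21 E22 => dv11 dv12 dv21 dv22.
case: z => x y; split.
  by rewrite (d1_cst x 0 y dv11) (d2_cst y 0 0 dv12).
by rewrite (d1_cst x 0 y dv21) (d2_cst y 0 0 dv22).
Qed.

Lemma trunc_eq0 (delta c : R) : 0 <= delta -> g delta c = 0 -> `|c| <= delta.
Proof.
move=> de0 gc; have gc' : gpos n i delta `|c| = 0.
  rewrite -(trunc_pos n i de0 (normr_ge0 c)) -gc.
  by have [_|_] := ger0P c; rewrite ?truncN.
rewrite leNgt; apply/negP => cd; move: gc'; rewrite /gpos max_l ?subr_ge0 ?(ltW cd)//.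
move/eqP; rewrite expf_eq0 => /andP[_ /eqP r0].
have cd0 : 0 < `|c| - delta by rewrite subr_gt0.
have := root2_expr i (ltW cd0); rewrite r0 expr0n.
by rewrite -[_ == _]negbK -lt0n expn_gt0/= => c0; move: cd0; rewrite -c0 ltxx.
Qed.

(** The truncated mass of a constant field is proportional to the area of the square, so a bound
    uniform in [L] forces the constant below the truncation level, and this for every level. *)
Lemma liouville z : vel1 z = 0 /\ vel2 z = 0.
Proof.
have [-> ->] := velocity_cst z; pose c1 := vel1 (0, 0); pose c2 := vel2 (0, 0).
suff H (k : R) : 0 < k <= 1 -> `|c1| <= 1 * k /\ `|c2| <= 1 * k.
  by split; apply: (@eq0_small _ _ 1) => k /H[].
move=> k01; have /andP[k0 k1] := k01; have [A A1 hA] := mass_bounded k01.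
have E L : 0 < L -> trunc_mass k L = (g k c1 ^+ 2 + g k c2 ^+ 2) * (2 * L) ^+ 2.
  move=> L0; rewrite mulrDl /trunc_mass -!sqint_cst ?(ltW L0)//.
  by congr (_ + _); apply: eq_sqint => t _; have [h1 h2] := velocity_cst t; rewrite ?h1 ?h2.
suff : g k c1 ^+ 2 + g k c2 ^+ 2 <= 0.
  move=> s0; have s1 := sqr_ge0 (g k c1); have s2 := sqr_ge0 (g k c2).
  have /eqP : g k c1 ^+ 2 = 0 by lra.
  have /eqP : g k c2 ^+ 2 = 0 by lra.
  rewrite !sqrf_eq0 => /eqP t2 /eqP t1; rewrite !mul1r.
  by split; apply: trunc_eq0 => //; exact: ltW.
rewrite leNgt; apply/negP => s0.
have A0 : 0 < A by lra.
(* At this half-width the mass of a nonzero truncated constant exceeds [A]. *)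
have := hA (A / (g k c1 ^+ 2 + g k c2 ^+ 2) + 1).
move: s0 E; set s := _ + _ => s0 E.
have q0 : 0 < A / s by rewrite divr_gt0.
have As : A = (A / s) * s by rewrite divfK// gt_eqF.
rewrite E ?addr_gt0// => /(_ isT); rewrite {2}As.
by move: (A / s) q0 s0 => q; nra.
Qed.

End Liouville.

(** * Integrability *)

Section Integrability.
Context {R : realType}.
Implicit Types (u : R * R -> R * R) (p : R).

Lemma norm_coord_le_enorm (z : R * R) : `|z.1| <= enorm z /\ `|z.2| <= enorm z.
Proof.
rewrite /enorm !big_ord_recl big_ord0 addr0 /Defs.coord /= -!sqrtr_sqr.
by split; apply: ler_wsqrtr; rewrite ?lerDl ?lerDr sqr_ge0.
Qed.

(** The condition says that the truncation exponent [1 + 2 ^- j] is at most [p]; a power of 2 is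
    required so that iterated square roots realise it. *)
Lemma dyadic_exponent p : 1 < p -> exists j, 1 <= (2 ^ j)%:R * (p - 1).
Proof.
move=> p1; have p0 : 0 < p - 1 by lra.
pose m := Num.bound ((p - 1)^-1); exists m.
rewrite -ler_pdivrMr// div1r; apply: le_trans (_ : m%:R <= _).
  by have := archi_boundP (ltW _ : 0 <= (p - 1)^-1); rewrite invr_gt0 => /(_ p0)/ltW.
by rewrite ler_nat ltnW// ltn_expl.
Qed.

(* With [N = n+1] one has [trunc^2 = (x - delta) r^2] and [(r^2)^N = x - delta], so the
   bound follows by comparing the [N]-th powers of [r^2] and [K x^(p-1)]. *)
Lemma trunc_sqr_le_powR (n j : nat) (delta p : R) : (n.+1 = 2 ^ j)%N -> 0 < delta ->
  1 < p -> 1 <= (2 ^ j)%:R * (p - 1) ->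
  exists2 K, 0 <= K & forall x, trunc n j.+1 delta x ^+ 2 <= K * `|x| `^ p.
Proof.
move=> nj de0 p1 jp; pose m := n.+1%:R * (p - 1) - 1.
have m0 : 0 <= m by rewrite /m nj; lra.
have dm0 : 0 < delta `^ m by exact: powR_gt0.
(* For [y >= delta] one has [y ^ m >= delta ^ m] as [m >= 0], so this choice gives [K * y ^ m >= 1];
   [K >= 1] then allows [K] to be replaced by its power [n + 1]. *)
pose K := 1 + (delta `^ m)^-1.
have di0 : 0 <= (delta `^ m)^-1 by rewrite invr_ge0 ltW.
have K1 : 1 <= K by rewrite /K; lra.
have K0 : 0 <= K by lra.
exists K => // x.
have -> : trunc n j.+1 delta x = trunc n j.+1 delta `|x|.
  by have [_|_] := ger0P x; rewrite ?truncN.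
have y0 := normr_ge0 x; move: `|x| y0 => y y0.
rewrite trunc_pos//; last exact: ltW.
have [yd|dy] := leP y delta.
  by rewrite gpos_0// expr0n/= mulr_ge0// powR_ge0.
have yd0 : 0 <= y - delta by lra.
have yp : 0 < y by lra.
rewrite /gpos max_l//; set r := root2 _ _.
have r0 : 0 <= r by exact: root2_ge0.
have rE : (r ^+ 2) ^+ n.+1 = y - delta.
  by rewrite nj -exprM -expnS; exact: root2_expr.
have -> : (r ^+ (n + 2)) ^+ 2 = (y - delta) * r ^+ 2.
  by rewrite -rE -!exprM -exprD; congr (_ ^+ _); clear; lia.
have powS t : y `^ (1 + t) = y * y `^ t.
  by rewrite powRD ?powRr1// (gt_eqF yp) implybT.
have -> : y `^ p = y * y `^ (p - 1) by rewrite -powS addrC subrK.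
rewrite [leRHS]mulrCA; apply: ler_pM => //; [exact: sqr_ge0|by lra|].
have s0 : 0 <= K * y `^ (p - 1) by rewrite mulr_ge0// powR_ge0.
rewrite -(@ler_pXn2r _ n.+1)// ?nnegrE ?sqr_ge0// rE exprMn.
have -> : (y `^ (p - 1)) ^+ n.+1 = y * y `^ m.
  rewrite -powR_mulrn ?powR_ge0// -powRrM -powS.
  by congr (_ `^ _); rewrite /m; ring.
have ym : delta `^ m <= y `^ m by apply: ge0_ler_powR; rewrite ?nnegrE//; lra.
apply: (@le_trans _ _ y); first by lra.
rewrite [leRHS]mulrCA; apply: ler_peMr; first exact: ltW.
apply: (@le_trans _ _ (K * delta `^ m)).
  by rewrite /K mulrDl mul1r mulVf ?gt_eqF//; lra.
apply: ler_pM => //; first exact: ltW.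
by rewrite -[leLHS]expr1; exact: ler_weXn2l.
Qed.

Lemma trunc_mass_bounded u p (n j : nat) (delta : R) : continuous u -> in_Lp p u ->
  (n.+1 = 2 ^ j)%N -> 0 < delta -> 1 < p -> 1 <= (2 ^ j)%:R * (p - 1) ->
  exists2 A, 1 <= A & forall L, 0 < L ->
    trunc_mass (vel1 u) (vel2 u) n j.+1 delta L <= A.
Proof.
move=> cu [_ up] nj de0 p1 jp; have [K K0 HK] := trunc_sqr_le_powR nj de0 p1 jp.
have p0 : 0 <= p by lra.
pose F z := K * `|enorm (u z)| `^ p.
have F0 z : 0 <= F z by rewrite mulr_ge0// powR_ge0.
have iF : (lebesgue2 R).-integrable setT (EFin \o F).
  have := Lfun_integrable (ltW p1) up => /(integrableZl measurableT K).
  by apply: eq_integrable => // z _; rewrite /= EFinM.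
have iFL L : (lebesgue2 R).-integrable (square L) (EFin \o F).
  by apply: integrableS iF => //; exact: square_measurable.
pose I := \int[lebesgue2 R]_z F z.
have FI L : \int[lebesgue2 R]_(z in square L) F z <= I.
  apply: fine_le; [by apply: integrable_fin_num (iFL L); exact: square_measurable|exact: integrable_fin_num iF|].
  apply: ge0_subset_integral => //=; first exact: square_measurable.
  - by case/integrableP: iF.
  - by move=> z _; rewrite lee_fin.
have I0 : 0 <= I by exact: Rintegral_ge0.
have comp (f : R * R -> R) L : 0 <= L -> continuous f -> (forall z, `|f z| <= enorm (u z)) ->
    sqint L (fun z => trunc n j.+1 delta (f z) ^+ 2) <= I.
  move=> L0 cf fu; apply: le_trans (FI L); apply: le_Rintegral => //.
  - exact: square_measurable.
  - apply: continuous_square_integrable => //; apply: contX; apply: cont_comp cf.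
    exact: cont_trunc.
  - move=> z _; apply: le_trans (HK (f z)) _; apply: ler_wpM2l => //.
    by apply: ge0_ler_powR; rewrite ?nnegrE//; apply: le_trans (fu z) (ler_norm _).
exists (1 + (I + I)); first by lra.
move=> L L0; have L0' := ltW L0; apply: (@le_trans _ _ (I + I)); last by lra.
apply: lerD; apply: comp => //.
- by move=> z; apply: (@continuous_comp _ _ _ u fst); [exact: cu|exact: cont_fst].
- by move=> z; have [] := norm_coord_le_enorm (u z).
- by move=> z; apply: (@continuous_comp _ _ _ u snd); [exact: cu|exact: cont_snd].
- by move=> z; have [] := norm_coord_le_enorm (u z).
Qed.

End Integrability.

Theorem corollary1p3 (R : realType) (u : R * R -> R * R) (p : R)
  (hC1 : Cn 1 u) (hNS : NS_weak_solution u) (hp : 1 < p) (hLp : in_Lp p u) :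
  forall x, u x = 0.
Proof.
move=> x; have [j hj] := dyadic_exponent hp.
(* With [n + 1 = 2 ^ j] the root of order [2n + 2] is the [(j + 1)]-fold iterated square root. *)
have nj : ((2 ^ j).-1.+1 = 2 ^ j)%N by rewrite prednK// expn_gt0.
have ni : (2 * (2 ^ j).-1 + 2 = 2 ^ j.+1)%N by rewrite -mulnSr nj expnS.
have cu : continuous u by move=> z; apply: differentiable_continuous; case: hC1.
have [|v1 v2] := liouville (solution_fieldsP hC1 hNS) ni _ x.
  by move=> delta /andP[de0 _]; exact: trunc_mass_bounded cu hLp nj de0 hp hj.
by move: v1 v2; rewrite /vel1 /vel2; case: (u x) => a b /= -> ->.
Qed.
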